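(* Let $M\ge 2$ be an integer. There exists a strictly stationary sequence $\tilde X=(\tilde X_k,k\in\mathbb Z)$ of real-valued random variables with $E\tilde X_0=0$ and $E\tilde X_0^2=1/2$ such that: (A) $\tilde X$ satisfies $M$-tuplewise independence; (B) $\tilde X$ is mixing (in the ergodic-theoretic sense); (C) the random variables $|\tilde X_k|$, $k\in\mathbb Z$, are independent (and identically distributed); (D) for every infinite set $Q\subset\mathbb N$ there exist an infinite set $T\subset Q$ and a nondegenerate, non-normal probability measure $\tilde\mu$ on $(\mathbb R,\mathcal R)$ such that $S(\tilde X,n)/\sqrt n\Rightarrow\tilde\mu$ as $n\to\infty$, $n\in T$. *)

(* Defs.v *)
From HB Require Import structures.
From mathcomp Require Import all_boot all_order all_algebra.
From mathcomp Require Import all_classical all_reals all_analysis.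
From mathcomp Require Import normal_distribution.
Set Implicit Arguments. Unset Strict Implicit. Unset Printing Implicit Defensive.
Import Order.TTheory GRing.Theory Num.Theory.
Import numFieldTopology.Exports.
Local Open Scope classical_set_scope.
Local Open Scope ring_scope.

Definition prodZ_measurable {R : realType} (A : set (int -> R)) : Prop :=
  <<s [set C | exists (k : int) (B : set R), measurable B /\
                 C = (fun f : int -> R => f k) @^-1` B] >> A.

Definition traj {T : Type} {R : realType} (X : int -> T -> R) (n : int) (w : T)
  : int -> R := fun k => X (k + n) w.

(* random variables (Y k)_{k in s} are mutually independent (s duplicate-free);
   for Borel B_k, P(cap_k {Y k in B_k}) = prod_k P(Y k in B_k). *)
Definition indep_family {d} {T : measurableType d} {R : realType}
  (P : probability T R) (Y : int -> T -> R) (s : seq int) : Prop :=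
  forall B : int -> set R, (forall k, measurable (B k)) ->
    P (\bigcap_(k in [set` s]) (Y k @^-1` B k)) =
    (\prod_(k <- s) P (Y k @^-1` B k))%E.

Definition strictly_stationary {d} {T : measurableType d} {R : realType}
  (P : probability T R) (X : int -> T -> R) : Prop :=
  forall (n : int) (A : set (int -> R)), prodZ_measurable A ->
    P [set w | A (traj X n w)] = P [set w | A (traj X 0 w)].

Definition M_tuplewise_indep {d} {T : measurableType d} {R : realType}
  (P : probability T R) (M : nat) (X : int -> T -> R) : Prop :=
  forall s : seq int, uniq s -> size s = M -> indep_family P X s.

Definition mixing {d} {T : measurableType d} {R : realType}
  (P : probability T R) (X : int -> T -> R) : Prop :=
  forall A B : set (int -> R), prodZ_measurable A -> prodZ_measurable B ->
    (fun n : nat => P [set w | A (traj X 0 w) /\ B (traj X n%:Z w)])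
      @ \oo --> (P [set w | A (traj X 0 w)] * P [set w | B (traj X 0 w)])%E.

Definition Ssum {T : Type} {R : realType} (X : int -> T -> R) (n : nat) (w : T) : R :=
  \sum_(1 <= k < n.+1) X k%:Z w.

Definition cvg_along {R : realType} (Tset : set nat) (u : nat -> \bar R) (l : \bar R)
  : Prop :=
  forall eps : R, 0 < eps -> \forall n \near \oo, Tset n -> (`|u n - l| < eps%:E)%E.

Definition cvg_dist_along {d} {T : measurableType d} {R : realType}
  (P : probability T R) (Tset : set nat) (Y : nat -> T -> R) (mu : probability R R)
  : Prop :=
  forall f : R -> R, continuous f -> (exists C : R, forall x, `|f x| <= C) ->
    cvg_along Tset (fun n => ('E_P[f \o Y n])%E) (\int[mu]_x (f x)%:E)%E.

Definition nondeg_law {R : realType} (mu : probability R R) : Prop :=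
  forall c : R, mu [set c] != 1%E.

Definition non_normal {R : realType} (mu : probability R R) : Prop :=
  ~ exists m s : R, 0 < s /\
      forall A : set R, measurable A -> mu A = normal_prob m s A.

(* Main.v *)
Require Import Defs.

(* Fix an even K > max (M, 5). A block of K^(j+1) signs consists of K blocks
   of K^j signs, drawn independently and then reweighted by one minus the
   product of the signs of their sums. Fewer than K of the signs are
   independent, but the K-th moment of the sum of a block lies below its value
   for independent signs by at least (E|T|)^K, with T the sum of one of the K
   smaller blocks. The process reads such a block cyclically, from a uniform
   starting point, at the times when a fair coin shows heads, and is 0
   otherwise: the absolute values are the coins, and the coins randomize the
   position of the reader inside the small blocks, which gives mixing. A path
   of the model is coded by a real number in base 8, and Helly's theorem
   yields a law on R under which the digits form the required process.

   The moments of order 1, 2 and 4 of S_n / sqrt n are 0, 1/2 and at most 3/4,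
   and that of order K stays below the moment of N(0, 1/2) by a fixed amount,
   at all n >= 4 K. A subsequential weak limit therefore has mean 0 and
   variance 1/2, while by Fatou's lemma its K-th moment is below that of N(0,
   1/2). *)

From HB Require Import structures.
From mathcomp Require Import all_boot all_order all_algebra perm.
From mathcomp Require Import ring lra zify.
Set Implicit Arguments. Unset Strict Implicit. Unset Printing Implicit Defensive.
Import Order.TTheory GRing.Theory Num.Theory.
Local Open Scope ring_scope.

(** * Blocks of signs *)

(** The infinite set Q in (D) is arbitrary, so non-normality must show at every scale: a sum of n
    variables has to cover, with fixed probability, a whole block of size comparable to n. This is
    why the correlation is put in at all levels at once. K even keeps the weights symmetric under a
    change of all signs and makes x^K nonnegative, as Fatou's lemma requires. K > 4 gives the fourth
    moment of a block sum, hence a first moment of order sqrt(K^j), and the gap is then a fixed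
    fraction of n^(K/2). A reader taking one step per time unit would have a position periodic
    modulo K^J, an obstacle to mixing; a lazy reader forgets it, and windows far apart fall into
    distinct small blocks, which are independent. The digits of the code are read by continuous
    functions, so that weak convergence on R passes to all means of finitely many coordinates. *)

Section Blocks.
Variables (R : rcfType) (k : nat) (th : R).
Notation K := k.+1.

(** A block is stored as a tree, not as a list of K^j signs, so that weights, means and characters
    are handled by recursion on the level. *)
Fixpoint conf (j : nat) : finType :=
  if j is j'.+1 then {ffun 'I_K -> conf j'} else bool.

(** The base K digits of u, most significant first, lead down the tree. [inord] turns a quotient
    that is too large into 0, so [leaf] is total. *)
Fixpoint leaf (j : nat) : conf j -> nat -> R :=
  match j return conf j -> nat -> R with
  | 0 => fun b _ => (-1) ^+ b
  | j'.+1 => fun y u => leaf (y (inord (u %/ K ^ j'))) (u %% K ^ j')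
  end.

Definition tot (j : nat) (y : conf j) : R := \sum_(u < K ^ j) leaf y u.

(* The correlation factor has mean 1 given any K - 1 of the children, so that
   fewer than K leaves remain independent; th = 0 is the i.i.d. comparison model. *)
Fixpoint wt (j : nat) : conf j -> R :=
  match j return conf j -> R with
  | 0 => fun _ => 2^-1
  | j'.+1 => fun y =>
      (\prod_i wt (y i)) * (1 - th * \prod_i Num.sg (tot (y i)))
  end.

Definition Exp (j : nat) (f : conf j -> R) : R := \sum_y wt y * f y.

Fixpoint flip (j : nat) : conf j -> conf j :=
  match j return conf j -> conf j with
  | 0 => negb
  | j'.+1 => fun y => [ffun i => flip (y i)]
  end.

Lemma flipK j : involutive (@flip j).
Proof.
elim: j => [|j IH] /=; first exact: negbK.
by move=> y; apply/ffunP => i; rewrite !ffunE IH.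
Qed.

Lemma leaf_flip j (y : conf j) u : leaf (flip y) u = - leaf y u.
Proof.
elim: j y u => [|j IH] /= y u; last by rewrite ffunE IH.
by case: y; rewrite ?expr0 ?expr1 ?opprK.
Qed.

Lemma tot_flip j (y : conf j) : tot (flip y) = - tot y.
Proof. by rewrite /tot -sumrN; apply: eq_bigr => u _; rewrite leaf_flip. Qed.

Lemma leaf_sqr j (y : conf j) u : leaf y u ^+ 2 = 1.
Proof. by elim: j y u => [|j IH] /= y u; rewrite ?sqrr_sign. Qed.

Lemma tot_recE j (y : conf j.+1) : tot y = \sum_i tot (y i).
Proof.
rewrite /tot /= pair_big /=.
have N0 : (0 < K ^ j)%N by rewrite expn_gt0.
have lt1 (p : 'I_K * 'I_(K ^ j)) : (p.1 * K ^ j + p.2 < K ^ j.+1)%N.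
  case: p => a b /=; rewrite expnS; apply: (@leq_trans (a.+1 * K ^ j)).
    by rewrite mulSn addnC ltn_add2r.
  by rewrite leq_mul2r ltn_ord orbT.
have lt2 (u : 'I_(K ^ j.+1)) : (u %/ K ^ j < K)%N.
  by rewrite ltn_divLR // -expnS.
have lt3 (u : 'I_(K ^ j.+1)) : (u %% K ^ j < K ^ j)%N by rewrite ltn_pmod.
rewrite (reindex (fun p => Ordinal (lt1 p))) /=; last first.
  exists (fun u => (Ordinal (lt2 u), Ordinal (lt3 u))) => [[a b]|u] _.
    congr pair; apply: val_inj => /=.
      by rewrite divnMDl // divn_small // addn0.
    by rewrite modnMDl modn_small.
  by apply: val_inj; rewrite /= -divn_eq.
apply: eq_bigr => -[a b] _ /=.
by rewrite divnMDl // divn_small // addn0 inord_val modnMDl modn_small.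
Qed.

Hypothesis k_odd : odd k.
Hypothesis k5 : (5 <= k)%N.
Hypotheses (th0 : 0 <= th) (th1 : th <= 1).

(** Flipping all leaves multiplies the product of the K signs by (-1)^K, so this symmetry rests on K
    being even. *)
Lemma wt_flip j (y : conf j) : wt (flip y) = wt y.
Proof.
elim: j y => //= j IH y; congr (_ * (1 - th * _)).
  by apply: eq_bigr => i _; rewrite ffunE IH.
under eq_bigr => i _ do rewrite ffunE tot_flip sgrN.
by rewrite prodrN card_ord -signr_odd /= k_odd mul1r.
Qed.

Lemma Exp_flip j (f : conf j -> R) : Exp f = Exp (f \o @flip j).
Proof.
rewrite /Exp (reindex_inj (inv_inj (@flipK j))) /=.
by apply: eq_bigr => y _; rewrite wt_flip.
Qed.

Lemma eq_Exp j (f g : conf j -> R) : f =1 g -> Exp f = Exp g.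
Proof. by move=> fg; apply: eq_bigr => y _; rewrite fg. Qed.

Lemma Exp_odd j (f : conf j -> R) : (forall y, f (flip y) = - f y) -> Exp f = 0.
Proof.
move=> fo; have : Exp f = - Exp f.
  rewrite {1}Exp_flip /Exp -sumrN; apply: eq_bigr => y _.
  by rewrite /= fo mulrN.
by move=> h; lra.
Qed.

(** A total 0 gets sign 0, so ties do not spoil the symmetry. *)
Lemma Exp_sg j : Exp (fun y : conf j => Num.sg (tot y)) = 0.
Proof. by apply: Exp_odd => y; rewrite tot_flip sgrN. Qed.

Lemma ExpD j (f g : conf j -> R) : Exp (fun y => f y + g y) = Exp f + Exp g.
Proof. by rewrite /Exp -big_split; apply: eq_bigr => y _; rewrite mulrDr. Qed.

Lemma ExpZ j c (f : conf j -> R) : Exp (fun y => c * f y) = c * Exp f.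
Proof. by rewrite /Exp mulr_sumr; apply: eq_bigr => y _; rewrite mulrCA. Qed.

Lemma Exp_sum j (I : Type) (r : seq I) (P : pred I) (f : I -> conf j -> R) :
  Exp (fun y => \sum_(i <- r | P i) f i y) = \sum_(i <- r | P i) Exp (f i).
Proof. by rewrite /Exp exchange_big; apply: eq_bigr => y _; rewrite mulr_sumr. Qed.

(** Each of the two terms of the correlation factor is a product over the children, so the mean
    splits into two products of means over a block of the lower level. *)
Lemma Exp_prod j (f : 'I_K -> conf j -> R) :
  Exp (fun y : conf j.+1 => \prod_i f i (y i)) =
  \prod_i Exp (f i) - th * \prod_i Exp (fun z => f i z * Num.sg (tot z)).
Proof.
rewrite /Exp !bigA_distr_bigA /= mulr_sumr -sumrB; apply: eq_bigr => y _.
rewrite -mulrA mulrBl mul1r -mulrA mulrBr mulrCA.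
rewrite -!big_split /=; congr (_ - _ * _).
by apply: eq_bigr => i _; rewrite mulrA mulrAC -mulrA mulrCA.
Qed.

Lemma Exp1 j : Exp (fun _ : conf j => 1) = 1.
Proof.
elim: j => [|j IH].
  by rewrite /Exp big_bool /= mulr1; lra.
rewrite (@eq_Exp _ _ (fun y : conf j.+1 => \prod_(i < K) (fun _ : conf j => 1) (y i))).
  rewrite (Exp_prod (fun _ _ => 1)) (eq_bigr (fun=> 1)) // big1 // big_ord_recl.
  rewrite (@eq_Exp _ (fun z => 1 * Num.sg (tot z)) (fun z => Num.sg (tot z))).
    by rewrite Exp_sg mul0r mulr0 subr0.
  by move=> z; rewrite mul1r.
by move=> y; rewrite big1.
Qed.

Lemma ExpC j c : Exp (fun _ : conf j => c) = c.
Proof. by rewrite -[RHS]mulr1 -(Exp1 j) -ExpZ; apply: eq_Exp => y; rewrite mulr1. Qed.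

Lemma sg_prod_le1 j (y : conf j.+1) : `|\prod_i Num.sg (tot (y i))| <= 1.
Proof.
rewrite normr_prod prodr_ile1 // => i _.
by rewrite normr_ge0 normr_sg lern1 leq_b1.
Qed.

Lemma wt_ge0 j (y : conf j) : 0 <= wt y.
Proof.
elim: j y => [|j IH] y /=; first by rewrite invr_ge0.
rewrite mulr_ge0 ?prodr_ge0 // subr_ge0.
apply: le_trans (ler_norm _) _; rewrite normrM ger0_norm //.
by rewrite -[leRHS]mulr1 ler_pM // sg_prod_le1.
Qed.

Lemma le_Exp j (f g : conf j -> R) : (forall y, f y <= g y) -> Exp f <= Exp g.
Proof. by move=> fg; apply: ler_sum => y _; rewrite ler_wpM2l ?wt_ge0. Qed.

Definition upd j (y : conf j.+1) i (z : conf j) : conf j.+1 :=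
  [ffun i' => if i' == i then z else y i'].

(** Swapping z with the i-th child of y is an involution on pairs (y, z), and it turns F (upd y i z)
    into F y. *)
Lemma sum_upd j i (F : conf j.+1 -> R) :
  \sum_(y : conf j.+1) \sum_(z : conf j) F (upd y i z) = \sum_y F y *+ #|conf j|.
Proof.
rewrite pair_bigA /=.
pose h (p : conf j.+1 * conf j) := (upd p.1 i p.2, (p.1 : {ffun 'I_K -> conf j}) i).
have hK : involutive h.
  move=> [y z]; rewrite /h /=; congr pair; last by rewrite ffunE eqxx.
  by apply/ffunP => i'; rewrite !ffunE; case: eqP => // ->.
rewrite (reindex_inj (inv_inj hK)) /=.
rewrite (eq_bigr (fun p => F p.1)); last first.
  move=> [y z] _ /=; congr F; apply/ffunP => i'; rewrite !ffunE.
  by case: eqP => // ->.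
rewrite -(pair_bigA _ (fun y z => F y)) /=; apply: eq_bigr => y _.
by rewrite sumr_const.
Qed.

Lemma card_conf_gt0 j : (0 < #|conf j|)%N.
Proof.
apply/card_gt0P; elim: j => [|j [z _]]; first by exists true.
by exists [ffun=> z].
Qed.

(** Fubini for one child: an identity of sums may be checked with the other children frozen. *)
Lemma sum_child j i (F G : conf j.+1 -> R) :
  (forall y, \sum_z F (upd y i z) = \sum_z G (upd y i z)) -> \sum_y F y = \sum_y G y.
Proof.
move=> FG; have : \sum_y F y *+ #|conf j| = \sum_y G y *+ #|conf j|.
  by rewrite -!(sum_upd i); apply: eq_bigr => y _.
rewrite !sumrMnl => /eqP; rewrite eqrMn2r ?eqn0Ngt ?card_conf_gt0 //.
by move/eqP.
Qed.

Lemma Exp_tot_child j i (g : R -> R) :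
  Exp (fun y : conf j.+1 => tot y * g (tot y)) =
  K%:R * Exp (fun y : conf j.+1 => tot (y i) * g (tot y)).
Proof.
rewrite (@eq_Exp _ _ (fun y : conf j.+1 => \sum_i' tot (y i') * g (tot y))); last first.
  by move=> y; rewrite {1}tot_recE mulr_suml.
rewrite (Exp_sum _ _ (fun i' (y : conf j.+1) => tot (y i') * g (tot y))).
rewrite -[X in X%:R](card_ord K) mulr_natl -sumr_const; apply: eq_bigr => i' _.
pose h (y : conf j.+1) : conf j.+1 := [ffun l => y (tperm i i' l)].
have hK : involutive h by move=> y; apply/ffunP => l; rewrite !ffunE tpermK.
rewrite /Exp (reindex_inj (inv_inj hK)) /=; apply: eq_bigr => y _.
have ht : @tot j.+1 (h y) = @tot j.+1 y.
  rewrite !tot_recE (reindex_inj (@perm_inj _ (tperm i i'))) /=.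
  by apply: eq_bigr => l _; rewrite !ffunE tpermK.
rewrite ht ffunE tpermR; congr (_ * _ * _).
  rewrite (reindex_inj (@perm_inj _ (tperm i i'))) /=.
  by apply: eq_bigr => l _; rewrite !ffunE tpermK.
congr (1 - th * _); rewrite (reindex_inj (@perm_inj _ (tperm i i'))) /=.
by apply: eq_bigr => l _; rewrite !ffunE tpermK.
Qed.

(** Children are exchangeable, and with the others frozen the correlation factor and g depend on
    child i only through its total; so the induction continues inside the child with another
    function [g'] of the total. With g the sign, single leaves are linked to E|tot|. *)
Lemma Exp_leaf_tot j u (g : R -> R) : (u < K ^ j)%N ->
  (K ^ j)%:R * Exp (fun y : conf j => leaf y u * g (tot y)) =
  Exp (fun y : conf j => tot y * g (tot y)).
Proof.
elim: j u g => [|j IH] u g uN.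
  by rewrite mul1r; apply: eq_Exp => y; rewrite /tot expn0 big_ord1.
set i : 'I_K := inord (u %/ K ^ j).
rewrite (Exp_tot_child j i) expnS natrM -mulrA; congr (_ * _).
rewrite -ExpZ /Exp; apply: (@sum_child _ i) => y.
pose c := \sum_(l | l != i) tot (y l).
pose p := \prod_(l | l != i) Num.sg (tot (y l)).
pose w := \prod_(l | l != i) wt (y l).
pose g' t := w * (1 - th * (Num.sg t * p)) * g (t + c).
have E (z : conf j) (x : R) :
    wt (upd y i z) * (x * g (tot (upd y i z))) = wt z * (x * g' (tot z)).
  have -> : tot (upd y i z) = tot z + c.
    rewrite tot_recE (bigD1 i) //= ffunE eqxx; congr (_ + _).
    by apply: eq_bigr => l /negbTE h; rewrite ffunE h.
  have -> : wt (upd y i z) = wt z * w * (1 - th * (Num.sg (tot z) * p)).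
    rewrite /= (bigD1 i) //= [X in _ - th * X](bigD1 i) //= ffunE eqxx.
    rewrite (eq_bigr (fun l => wt (y l))); last first.
      by move=> l /negbTE h; rewrite ffunE h.
    congr (_ * _ * (1 - th * (_ * _))).
    by apply: eq_bigr => l /negbTE h; rewrite ffunE h.
  by rewrite /g'; ring.
have uN' : (u %% K ^ j < K ^ j)%N by rewrite ltn_pmod // expn_gt0.
transitivity (\sum_(z : conf j) wt z * (tot z * g' (tot z))); last first.
  by apply: eq_bigr => z _; rewrite E ffunE eqxx.
have := IH _ g' uN'; rewrite /Exp mulr_sumr => <-.
apply: eq_bigr => z _; rewrite (mulrA (K ^ j)%:R) E /= -/i ffunE eqxx; ring.
Qed.

Lemma Exp_leaf_sg j u : (u < K ^ j)%N ->
  (K ^ j)%:R * Exp (fun y : conf j => leaf y u * Num.sg (tot y)) =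
  Exp (fun y : conf j => `|tot y|).
Proof.
move=> uN; rewrite (Exp_leaf_tot (fun t => Num.sg t)) //.
by apply: eq_Exp => y; rewrite mulrC -normrEsg.
Qed.

Lemma Exp_leaf_sg_ge0 j u : (u < K ^ j)%N ->
  0 <= Exp (fun y : conf j => leaf y u * Num.sg (tot y)).
Proof.
move=> uN; have N0 : 0 < (K ^ j)%:R :> R by rewrite ltr0n expn_gt0.
rewrite -(pmulr_rge0 _ N0) Exp_leaf_sg // -(ExpC j 0).
by apply: le_Exp => y.
Qed.

(** For duplicate-free s these are the Walsh characters of the K^j signs. *)
Definition chi j (s : seq nat) (y : conf j) : R := \prod_(u <- s) leaf y u.

Definition child_pos j (s : seq nat) (i : 'I_K) : seq nat :=
  [seq u %% K ^ j | u <- s & inord (u %/ K ^ j) == i]%N.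

Lemma chi_child j s (y : conf j.+1) : chi s y = \prod_i chi (child_pos j s i) (y i).
Proof.
rewrite /chi (partition_big (fun u => inord (u %/ K ^ j) : 'I_K) xpredT) //=.
apply: eq_bigr => i _; rewrite big_map big_filter.
by apply: eq_bigr => u /eqP ->.
Qed.

Lemma child_pos_uniq j s i : all (fun u => u < K ^ j.+1)%N s -> uniq s ->
  uniq (child_pos j s i).
Proof.
move=> /allP sN us; rewrite map_inj_in_uniq ?filter_uniq // => u v.
rewrite !mem_filter => /andP[/eqP ui us'] /andP[/eqP vi vs'] uv.
have E w : w \in s -> @nat_of_ord K (inord (w %/ K ^ j)) = (w %/ K ^ j)%N.
  by move=> /sN wN; rewrite inordK // ltn_divLR ?expn_gt0 // -expnS.
by rewrite (divn_eq u (K ^ j)) (divn_eq v (K ^ j)) uv -(E _ us') -(E _ vs') ui vi.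
Qed.

Lemma child_pos_lt j s i : all (fun u => u < K ^ j)%N (child_pos j s i).
Proof. by apply/allP => _ /mapP[u _ ->]; rewrite ltn_pmod // expn_gt0. Qed.

Lemma child_pos_size j s : (\sum_i size (child_pos j s i))%N = size s.
Proof.
rewrite -[in RHS](filter_predT s) size_filter -sum1_count.
rewrite (partition_big (fun u => inord (u %/ K ^ j) : 'I_K) xpredT) //=.
by apply: eq_bigr => i _; rewrite size_map size_filter -sum1_count.
Qed.

Lemma chi_nil j (y : conf j) : chi [::] y = 1.
Proof. by rewrite /chi big_nil. Qed.

Lemma Exp_chi_rec j s : Exp (fun y : conf j.+1 => chi s y) =
  \prod_i Exp (fun z : conf j => chi (child_pos j s i) z) -
  th * \prod_i Exp (fun z : conf j => chi (child_pos j s i) z * Num.sg (tot z)).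
Proof. by rewrite -Exp_prod; apply: eq_Exp => y; rewrite chi_child. Qed.

Lemma Exp_chi_sg_nil j : Exp (fun z : conf j => chi [::] z * Num.sg (tot z)) = 0.
Proof. by rewrite -(Exp_sg j); apply: eq_Exp => z; rewrite chi_nil mul1r. Qed.

Lemma Exp_chi_nil j : Exp (fun z : conf j => chi [::] z) = 1.
Proof. by rewrite -(Exp1 j); apply: eq_Exp => z; rewrite chi_nil. Qed.

Lemma prod_eq0 (I : finType) (F : I -> R) i : F i = 0 -> \prod_i F i = 0.
Proof. by move=> Fi; rewrite (bigD1 i) //= Fi mul0r. Qed.

(** By induction, a child that holds a position makes the first product of [Exp_chi_rec] vanish; a
    child that holds none makes the second vanish, as its sign has mean 0. With fewer than K
    positions some child holds none. *)
Lemma Exp_chi0 j s : all (fun u => u < K ^ j)%N s -> uniq s ->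
  (0 < size s)%N -> (th == 0) || (size s < K)%N -> Exp (fun y : conf j => chi s y) = 0.
Proof.
elim: j s => [|j IH] s sN us s0 sK.
  case: s sN us s0 sK => [//|[|//] [|[|//] s]] //= _ _ _ _.
  rewrite /Exp big_bool /chi !big_seq1 /= expr0 expr1; lra.
rewrite Exp_chi_rec.
have [/forallP h|] := boolP [forall i, size (child_pos j s i) == 0]%N.
  move: s0; rewrite -(child_pos_size j) big1 // => i _; exact/eqP/h.
rewrite negb_forall => /existsP[i]; rewrite -lt0n => si.
have le_s : (size (child_pos j s i) <= size s)%N.
  by rewrite -[leqRHS](child_pos_size j) (bigD1 i) //= leq_addr.
rewrite (@prod_eq0 _ (fun i => Exp (fun z : conf j => chi (child_pos j s i) z)) i).
  rewrite sub0r; case/orP: sK => [/eqP -> |sK]; first by rewrite mul0r oppr0.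
  have [/forallP h|] := boolP [forall i, 0 < size (child_pos j s i)]%N.
    move: sK; rewrite -(child_pos_size j) ltnNge -{1}(card_ord K) -sum1_card.
    by rewrite leq_sum.
  rewrite negb_forall => /existsP[l]; rewrite lt0n negbK => /eqP/size0nil h.
  rewrite (@prod_eq0 _ _ l) ?mulr0 ?oppr0 //.
  by rewrite h Exp_chi_sg_nil.
apply: IH => //; [exact: child_pos_lt|exact: child_pos_uniq|].
by case/orP: sK => [->//|sK]; rewrite (leq_ltn_trans le_s sK) orbT.
Qed.

(** A single leaf has no K distinct positions. In a larger block the first product is 0 unless one
    child holds all positions, where induction applies. The second is 0 unless each child holds
    exactly one; its factors are then nonnegative by [Exp_leaf_sg_ge0], and it enters with a minus
    sign. *)
Lemma Exp_chi_le0 j s : all (fun u => u < K ^ j)%N s -> uniq s ->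
  size s = K -> Exp (fun y : conf j => chi s y) <= 0.
Proof.
elim: j s => [|j IH] s sN us sK.
  have : (size s <= size [:: 0%N])%N.
    by apply: uniq_leq_size => // u /(allP sN); rewrite expn0 ltnS leqn0 inE.
  by rewrite sK /= ltnS leqNgt (leq_trans _ k5).
rewrite Exp_chi_rec subr_le0.
apply: (@le_trans _ _ 0).
  have [/forallP h|] := boolP [forall i, size (child_pos j s i) == 0]%N.
    have : size s = 0%N by rewrite -(child_pos_size j) big1 // => i _; exact/eqP/h.
    by rewrite sK.
  rewrite negb_forall => /existsP[i]; rewrite -lt0n => si.
  have le_s : (size (child_pos j s i) <= K)%N.
    by rewrite -sK -[leqRHS](child_pos_size j) (bigD1 i) //= leq_addr.
  move: (le_s); rewrite leq_eqVlt => /orP[/eqP e|lt_s]; last first.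
    rewrite (@prod_eq0 _ _ i) // Exp_chi0 ?lt_s ?orbT //.
    - exact: child_pos_lt.
    - exact: child_pos_uniq.
  rewrite (bigD1 i) //= [X in _ * X]big1 ?mulr1.
    by apply: IH => //; [exact: child_pos_lt|exact: child_pos_uniq].
  move=> l li; have /eqP := child_pos_size j s.
  rewrite sK (bigD1 i) //= e -[X in _ == X]addn0 eqn_add2l sum_nat_eq0 => /forallP/(_ l)/implyP/(_ li)/eqP/size0nil ->.
  exact: Exp_chi_nil.
rewrite mulr_ge0 //.
have [/forallP h|] := boolP [forall i, 0 < size (child_pos j s i)]%N; last first.
  rewrite negb_forall => /existsP[l]; rewrite lt0n negbK => /eqP/size0nil h.
  by rewrite (@prod_eq0 _ _ l) // h Exp_chi_sg_nil.
have h1 i : size (child_pos j s i) = 1%N.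
  have : (\sum_i (size (child_pos j s i) - 1))%N == 0%N.
    rewrite sumnB // child_pos_size sK sum1_card card_ord subnn //.
  rewrite sum_nat_eq0 => /forallP/(_ i)/=; rewrite subn_eq0 => h'.
  by apply/eqP; rewrite eqn_leq h' h.
apply: prodr_ge0 => i _.
have := child_pos_lt j s i; move: (h1 i); case: child_pos => [//|u [|//]] _ /=.
rewrite andbT => uN; rewrite (@eq_Exp _ _ (fun z : conf j => leaf z u * Num.sg (tot z))).
  exact: Exp_leaf_sg_ge0.
by move=> z; rewrite /chi big_seq1.
Qed.

Lemma Exp_transversal j (g : {ffun 'I_K -> 'I_(K ^ j)}) :
  Exp (fun y : conf j.+1 => \prod_(i < K) leaf y (i * K ^ j + g i)%N) =
  \prod_(i < K) Exp (fun z : conf j => leaf z (g i)) -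
  th * \prod_(i < K) Exp (fun z : conf j => leaf z (g i) * Num.sg (tot z)).
Proof.
rewrite -Exp_prod; apply: eq_Exp => y; apply: eq_bigr => i _ /=.
by rewrite divnMDl ?expn_gt0 // divn_small // addn0 inord_val modnMDl modn_small.
Qed.

(** Over all choices of one leaf per child the second product sums to the K-th power of E(tot
    sg(tot)), that is of E|tot|, while the first contains factors of mean 0. *)
Lemma sum_Exp_transversal j :
  \sum_(g : {ffun 'I_K -> 'I_(K ^ j)})
    Exp (fun y : conf j.+1 => \prod_(i < K) leaf y (i * K ^ j + g i)%N) =
  - th * Exp (fun z : conf j => `|tot z|) ^+ K.
Proof.
under eq_bigr do rewrite Exp_transversal.
rewrite sumrB -(bigA_distr_bigA (fun _ (u : 'I_(K ^ j)) => Exp (fun z : conf j => leaf z u))) /=.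
rewrite -mulr_sumr -(bigA_distr_bigA (fun _ (u : 'I_(K ^ j)) =>
  Exp (fun z : conf j => leaf z u * Num.sg (tot z)))) /=.
rewrite [X in X - _](_ : _ = 0) ?sub0r ?mulNr.
  congr (- (_ * _)); rewrite prodr_const card_ord; congr (_ ^+ _).
  rewrite -Exp_sum; apply: eq_Exp => z; rewrite -mulr_suml.
  by rewrite mulrC -normrEsg.
rewrite (@prod_eq0 _ _ ord0) // big1 // => u _.
by apply: Exp_odd => z; rewrite leaf_flip.
Qed.

Fixpoint sub (d l : nat) : conf (d + l) -> nat -> conf l :=
  match d return conf (d + l) -> nat -> conf l with
  | 0 => fun y _ => y
  | d'.+1 => fun y b => sub (y (inord (b %/ K ^ d'))) (b %% K ^ d')
  end.

Lemma leaf_sub d l (y : conf (d + l)) b u : (b < K ^ d)%N -> (u < K ^ l)%N ->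
  leaf y (b * K ^ l + u)%N = leaf (sub y b) u.
Proof.
elim: d y b => [|d IH] y b bd ul /=.
  by move: bd; rewrite expn0 ltnS leqn0 => /eqP ->.
have l0 : (0 < K ^ l)%N by rewrite expn_gt0.
have d0 : (0 < K ^ d)%N by rewrite expn_gt0.
have E : ((b * K ^ l + u) %/ K ^ (d + l) = b %/ K ^ d)%N.
  by rewrite expnD [(K ^ d * _)%N]mulnC divnMA divnMDl // (divn_small ul) addn0.
rewrite -IH ?ltn_pmod // E; congr (leaf _ _).
rewrite {1}(divn_eq b (K ^ d)) mulnDl -mulnA -addnA expnD modnMDl modn_small //.
apply: (@leq_trans ((b %% K ^ d).+1 * K ^ l)).
  by rewrite mulSn addnC ltn_add2r.
by rewrite leq_mul2r ltn_pmod ?orbT.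
Qed.

Lemma exists_neq (i : 'I_K) : exists l : 'I_K, l != i.
Proof.
exists (if i == ord0 then ord_max else ord0); have [->|] := eqVneq i ord0; last by rewrite eq_sym.
by rewrite -val_eqE /= -lt0n (leq_trans _ k5).
Qed.

(** Another child l carries no function, so its sign has mean 0 and removes the correlation term.
    [Exp_child2] uses a third child in the same way. *)
Lemma Exp_child j i (f : conf j -> R) :
  Exp (fun y : conf j.+1 => f (y i)) = Exp f.
Proof.
have [l li] := exists_neq i.
pose F l z : R := if l == i then f z else 1.
have FE (y : conf j.+1) : f (y i) = \prod_l F l (y l).
  rewrite (bigD1 i) //= /F eqxx big1 ?mulr1 // => m /negbTE -> //.
rewrite (eq_Exp FE) Exp_prod (@prod_eq0 _ (fun m => Exp (fun z => F m z * _)) l); last first.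
  rewrite -(Exp_sg j); apply: eq_Exp => z.
  by rewrite /F (negbTE li) mul1r.
rewrite mulr0 subr0 (bigD1 i) //= big1 ?mulr1.
  by apply: eq_Exp => z; rewrite /F eqxx.
by move=> m /negbTE mi; rewrite -(Exp1 j); apply: eq_Exp => z; rewrite /F mi.
Qed.

Lemma exists_neq2 (i i' : 'I_K) : exists l : 'I_K, (l != i) && (l != i').
Proof.
have : (0 < #|~: [set i; i']|)%N.
  rewrite cardsCs setCK card_ord subn_gt0 cards2 ltnS.
  by case: (_ != _); rewrite (leq_trans _ k5).
by case/card_gt0P => l; rewrite !inE negb_or => ?; exists l.
Qed.

Lemma Exp_child2 j i i' (f g : conf j -> R) : i != i' ->
  Exp (fun y : conf j.+1 => f (y i) * g (y i')) = Exp f * Exp g.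
Proof.
move=> ii'; have [l /andP[li li']] := exists_neq2 i i'.
pose F l z : R := if l == i then f z else if l == i' then g z else 1.
have FE (y : conf j.+1) : f (y i) * g (y i') = \prod_l F l (y l).
  rewrite (bigD1 i) //= (bigD1 i') 1?eq_sym //= /F !eqxx [i' == i]eq_sym (negbTE ii').
  by rewrite big1 ?mulr1 // => m /andP[/negbTE -> /negbTE ->].
rewrite (eq_Exp FE) Exp_prod (@prod_eq0 _ (fun m => Exp (fun z => F m z * _)) l); last first.
  rewrite -(Exp_sg j); apply: eq_Exp => z.
  by rewrite /F (negbTE li) (negbTE li') mul1r.
rewrite mulr0 subr0 (bigD1 i) //= (bigD1 i') 1?eq_sym //= big1 ?mulr1.
  congr (_ * _); apply: eq_Exp => z; rewrite /F ?eqxx //.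
  by rewrite [i' == i]eq_sym (negbTE ii').
move=> m /andP[/negbTE mi /negbTE mi']; rewrite -(Exp1 j).
by apply: eq_Exp => z; rewrite /F mi mi'.
Qed.

Lemma Exp_sub d l b (f : conf l -> R) :
  Exp (fun y : conf (d + l) => f (sub y b)) = Exp f.
Proof.
elim: d b => [|d IH] b //=.
by rewrite (@Exp_child (d + l) _ (fun z => f (sub z (b %% K ^ d)))) IH.
Qed.

(** The paths to b and b' separate at some level; there [Exp_child2] applies, and by [Exp_sub] each
    side has the law of a block. *)
Lemma Exp_sub2 d l b b' (f g : conf l -> R) :
  (b < K ^ d)%N -> (b' < K ^ d)%N -> b != b' ->
  Exp (fun y : conf (d + l) => f (sub y b) * g (sub y b')) = Exp f * Exp g.
Proof.
elim: d b b' => [|d IH] b b' bd bd' bb'.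
  by move: bd bd' bb'; rewrite expn0 !ltnS !leqn0 => /eqP -> /eqP ->.
have lt c : (c < K ^ d.+1)%N -> (c %/ K ^ d < K)%N.
  by rewrite ltn_divLR ?expn_gt0 // -expnS.
have [e|ne] := eqVneq (b %/ K ^ d)%N (b' %/ K ^ d)%N.
  rewrite /= e (@Exp_child (d + l) _ (fun z => f (sub z (b %% K ^ d)) * g (sub z (b' %% K ^ d)))).
  apply: IH; rewrite ?ltn_pmod ?expn_gt0 //.
  by apply: contra bb' => /eqP h; rewrite (divn_eq b (K ^ d)) (divn_eq b' (K ^ d)) e h.
rewrite /= (@Exp_child2 (d + l) _ _ (fun z => f (sub z (b %% K ^ d)))
  (fun z => g (sub z (b' %% K ^ d)))) ?Exp_sub //.
by rewrite -val_eqE /= !inordK // lt.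
Qed.

End Blocks.

(** * Moments of sums of partly independent variables against normal moments *)

Section Moments.
Variable R : rcfType.

(** The l-th moment of N(0, v), which is (l - 1)!! v^(l/2) for even l. *)
Definition gmom (l : nat) (v : R) : R :=
  if odd l then 0 else (l`!)%:R / (2 ^+ l./2 * (l./2)`!%:R) * v ^+ l./2.

Lemma gmom_ge0 l v : 0 <= v -> 0 <= gmom l v.
Proof.
move=> v0; rewrite /gmom; case: ifP => // _.
by rewrite mulr_ge0 ?exprn_ge0 // divr_ge0 ?mulr_ge0 ?exprn_ge0 ?ler0n.
Qed.

Lemma gmom0 v : gmom 0 v = 1.
Proof. by rewrite /gmom /= !expr0 mulr1 mul1r divr1. Qed.

Lemma gmom_double a v :
  gmom a.*2 v = (a.*2)`!%:R / (2 ^+ a * a`!%:R) * v ^+ a.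
Proof. by rewrite /gmom odd_double doubleK. Qed.

Lemma sum_even (a : nat) (F : nat -> R) : (forall i, odd i -> F i = 0) ->
  \sum_(i < a.*2.+1) F i = \sum_(b < a.+1) F b.*2.
Proof.
move=> F0; elim: a => [|a IH]; first by rewrite !big_ord1.
rewrite doubleS [LHS]big_ord_recr /= [X in X + _]big_ord_recr /= IH.
by rewrite F0 /= ?odd_double // addr0 [RHS]big_ord_recr.
Qed.

(** The l-th moment of a sum of independent N(0, v) and N(0, w) variables. Only even indices
    survive, and the factorials turn the sum into the binomial expansion of (v + w)^(l/2). *)
Lemma gmom_conv l v w :
  \sum_(i < l.+1) 'C(l, i)%:R * (gmom i v * gmom (l - i) w) = gmom l (v + w).
Proof.
have [ol|el] := boolP (odd l).
  have -> : gmom l (v + w) = 0 by rewrite /gmom ol.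
  rewrite big1 // => i _; rewrite /gmom.
  have il : (i <= l)%N by rewrite -ltnS.
  by rewrite [odd (l - i)]oddB // ol; case: (odd i); rewrite /= ?mul0r ?mulr0.
rewrite -[l]odd_double_half (negbTE el) add0n; set a := l./2.
rewrite (sum_even _ (F := fun i => 'C(a.*2, i)%:R * (gmom i v * gmom (a.*2 - i) w))); last first.
  by move=> i oi; rewrite /gmom oi mul0r mulr0.
rewrite gmom_double (addrC v w) (exprDn w v) mulr_sumr; apply: eq_bigr => b _.
have ba : (b <= a)%N by rewrite -ltnS.
have f0 (n : nat) : n`!%:R != 0 :> R by rewrite pnatr_eq0 -lt0n fact_gt0.
rewrite -doubleB !gmom_double -mulr_natr.
have e1 : (a.*2)`!%:R = 'C(a.*2, b.*2)%:R * ((b.*2)`!%:R * ((a - b).*2)`!%:R) :> R.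
  by rewrite -!natrM doubleB bin_fact // leq_double.
have e2 : a`!%:R = 'C(a, b)%:R * (b`!%:R * (a - b)`!%:R) :> R.
  by rewrite -!natrM bin_fact.
have e3 : 2 ^+ a = 2 ^+ b * 2 ^+ (a - b) :> R by rewrite -exprD subnKC.
have C0 : 'C(a, b)%:R != 0 :> R by rewrite pnatr_eq0 -lt0n bin_gt0.
rewrite e1 e2 e3; field.
by rewrite !f0 C0 !expf_neq0 // pnatr_eq0.
Qed.

(** Every even moment of a random sign is 1, so signs are dominated by N(0, 1). *)
Lemma gmom_even_ge1 a : 1 <= gmom a.*2 (1 : R).
Proof.
rewrite gmom_double expr1n mulr1 -natrX -natrM.
rewrite ler_pdivlMr ?ltr0n ?muln_gt0 ?expn_gt0 ?fact_gt0 // mul1r ler_nat.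
elim: a => [//|a IH]; rewrite doubleS !factS expnS.
have -> : (2 * 2 ^ a * (a.+1 * a`!) = a.*2.+2 * (2 ^ a * a`!))%N by rewrite -doubleS -mul2n; ring.
by rewrite leq_mul2l /=; apply: (leq_trans IH); rewrite leq_pmull.
Qed.

(** 1/2 is every even moment of positive order of the variable that is 0, 1, -1 with probabilities
    1/2, 1/4, 1/4. Its variance is 1/2, so it is compared with N(0, 1/2). *)
Lemma gmom_even_half_ge a : (0 < a)%N -> 2^-1 <= gmom a.*2 (2^-1 : R).
Proof.
case: a => // a _; rewrite gmom_double exprVn -natrX -natrM -mulrA -invfM -natrM.
rewrite -[leLHS]mul1r ler_pdivrMr // mulrAC ler_pdivlMr; last first.
  by rewrite ltr0n !muln_gt0 !expn_gt0 fact_gt0.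
rewrite mul1r -natrM ler_nat.
elim: a => [//|a IH].
have -> : (2 ^ a.+2 * (a.+2)`! * 2 ^ a.+2 = 4 * a.+2 * (2 ^ a.+1 * (a.+1)`! * 2 ^ a.+1))%N.
  by rewrite factS !(expnS 2 a.+1); ring.
rewrite [a.+2.*2]doubleS !factS.
have -> : (a.+1.*2.+2 * (a.+1.*2.+1 * (a.+1.*2)`!) * 2 = a.+1.*2.+2 * a.+1.*2.+1 * ((a.+1.*2)`! * 2))%N by ring.
apply: leq_mul => //.
rewrite -!addnn; nia.
Qed.

Section MomentBound.
Variables (Om : Type) (E : (Om -> R) -> R).
Hypothesis E_ext : forall f g, f =1 g -> E f = E g.
Hypothesis E_sum : forall (I : finType) (f : I -> Om -> R),
  E (fun w => \sum_i f i w) = \sum_i E (f i).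
Hypothesis E_scale : forall c f, E (fun w => c * f w) = c * E f.
Variables (Z : nat -> Om -> R) (N L : nat) (s2 : R) (b : nat -> R).
Hypotheses (s2_ge0 : 0 <= s2) (b0 : b 0 = 1).
Hypotheses (b_ge0 : forall j, 0 <= b j) (b_le : forall j, b j <= gmom j s2).

Definition psum n (w : Om) : R := \sum_(t < n) Z t w.

Hypothesis E_indep : forall (s : seq nat) (c : nat -> nat), uniq s ->
  all (fun t => t < N)%N s -> (size s < L)%N ->
  E (fun w => \prod_(t <- s) Z t w ^+ c t) = \prod_(t <- s) b (c t).

Lemma psum_exp n l w : psum n w ^+ l =
  \sum_(f : {ffun 'I_l -> 'I_n}) \prod_(t <- undup [seq val (f i) | i : 'I_l])
     Z t w ^+ count_mem t [seq val (f i) | i : 'I_l].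
Proof.
rewrite -[l in LHS]card_ord -prodr_const /psum bigA_distr_bigA /=.
apply: eq_bigr => f _; by rewrite prodr_undup_exp_count big_image.
Qed.

Lemma E_mul_psum n j l : (n < N)%N -> (l.+1 < L)%N ->
  E (fun w => Z n w ^+ j * psum n w ^+ l) = b j * E (fun w => psum n w ^+ l).
Proof.
move=> nN lL.
have mem (f : {ffun 'I_l -> 'I_n}) t :
    t \in undup [seq val (f i) | i : 'I_l] -> (t < n)%N.
  by rewrite mem_undup => /imageP[i _ ->]; exact: ltn_ord.
have sz (f : {ffun 'I_l -> 'I_n}) : (size (undup [seq val (f i) | i : 'I_l]) <= l)%N.
  by apply: leq_trans (size_undup _) _; rewrite size_map -cardE card_ord.
have all1 (f : {ffun 'I_l -> 'I_n}) :
    all (fun t => t < N)%N (undup [seq val (f i) | i : 'I_l]).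
  by apply/allP => t /mem tn; rewrite (ltn_trans tn).
rewrite (E_ext (fun w => psum_exp n l w)) E_sum mulr_sumr.
under E_ext => w do rewrite psum_exp mulr_sumr.
rewrite E_sum; apply: eq_bigr => f _.
set r := [seq val (f i) | i : 'I_l].
have nr : n \notin undup r by apply/negP => /mem; rewrite ltnn.
rewrite [in RHS]E_indep ?undup_uniq ?all1 //; last first.
  by rewrite (leq_ltn_trans (sz f)) // ltnW.
pose c t := if t == n then j else count_mem t r.
have cE F : \prod_(t <- undup r) F t (c t) = \prod_(t <- undup r) F t (count_mem t r) :> R.
  rewrite big_seq [RHS]big_seq; apply: eq_bigr => t tr; rewrite /c.
  by case: eqP => // tn; move: nr; rewrite -tn tr.
transitivity (E (fun w => \prod_(t <- n :: undup r) Z t w ^+ c t)).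
  by apply: E_ext => w; rewrite big_cons (cE (fun t m => Z t w ^+ m)) /c eqxx.
rewrite E_indep /= ?nr ?undup_uniq ?nN ?all1 //; last first.
  by apply: leq_ltn_trans lL; rewrite ltnS sz.
by rewrite big_cons (cE (fun _ => b)) /c eqxx.
Qed.

(** Expanding in the last variable gives the convolution of [gmom_conv], once each single moment is
    bounded by [b_le]. The functional E is abstract because the bound serves both [Exp] and [Em]. *)
Lemma moment_bound n l : (n <= N)%N -> (l < L)%N ->
  E (fun w => psum n w ^+ l) <= gmom l (n%:R * s2).
Proof.
elim: n l => [|n IH] l nN lL.
  under E_ext => w do rewrite /psum big_ord0.
  rewrite mul0r; case: l lL => [|l] lL.
    rewrite gmom0 -[leRHS](big_nil 1 *%R xpredT (fun t : nat => b 0)).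
    rewrite -(@E_indep [::] (fun=> 0%N)) // le_eqVlt; apply/orP; left; apply/eqP.
    by apply: E_ext => w; rewrite big_nil.
  rewrite (E_ext (g := fun w => 0 * 0)); last by move=> w; rewrite expr0n mul0r.
  by rewrite E_scale mul0r gmom_ge0.
have -> : n.+1%:R * s2 = s2 + n%:R * s2 by rewrite -natr1 mulrDl mul1r addrC.
rewrite -gmom_conv.
under E_ext => w do rewrite /psum big_ord_recr /= exprDn.
rewrite E_sum; apply: ler_sum => i _.
have il : (i <= l)%N by rewrite -ltnS.
have -> : E (fun w => psum n w ^+ (l - i) * Z n w ^+ i *+ 'C(l, i)) =
    'C(l, i)%:R * (b i * E (fun w => psum n w ^+ (l - i))).
  (* i = 0 is apart: [E_mul_psum] spends one of the fewer than L indices on n, and with exponent l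
     there may be none to spare. *)
  have [->|i0] := posnP i.
    rewrite b0 bin0 !mul1r subn0; apply: E_ext => w.
    by rewrite expr0 mulr1.
  rewrite -E_mul_psum //; last by apply: leq_ltn_trans lL; rewrite ltn_subrL i0 (leq_trans i0).
  by rewrite -!E_scale; apply: E_ext => w; rewrite mulr_natl mulrC.
rewrite ler_wpM2l //; apply: le_trans (ler_wpM2l (b_ge0 i) (IH _ _ _)) _.
- exact: ltnW.
- by apply: leq_ltn_trans lL; rewrite leq_subr.
- by rewrite ler_wpM2r ?gmom_ge0 // mulr_ge0.
Qed.
End MomentBound.
End Moments.

(** * Moments of sums over windows of a block *)

Section BlockMoments.
Variables (R : rcfType) (k : nat).
Notation K := k.+1.
Hypotheses (k_odd : odd k) (k5 : (5 <= k)%N).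
Local Notation conf := (conf k).
Local Notation leaf := (@leaf R k _).
Local Notation tot := (@tot R k _).
Local Notation chi := (@chi R k _).
Implicit Types th : R.

(** A leaf squares to 1, so only positions of odd multiplicity count in a character. *)
Definition odd_part (s : seq nat) : seq nat :=
  [seq u <- undup s | odd (count_mem u s)].

Lemma odd_part_sub s u : u \in odd_part s -> u \in s.
Proof. by rewrite mem_filter mem_undup => /andP[]. Qed.

Lemma odd_part_size s : (size (odd_part s) <= size s)%N.
Proof. by rewrite (leq_trans _ (size_undup s)) // size_filter count_size. Qed.

Lemma leaf_exp j (y : conf j) u c : leaf y u ^+ c = if odd c then leaf y u else 1.
Proof.
rewrite -[c in LHS]odd_double_half -muln2 mulnC exprD exprM leaf_sqr expr1n mulr1.
by case: odd; rewrite ?expr1 ?expr0.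
Qed.

Lemma prod_leaf_exp j (y : conf j) (s : seq nat) (c : nat -> nat) :
  \prod_(u <- s) leaf y u ^+ c u = chi [seq u <- s | odd (c u)] y.
Proof.
rewrite /chi big_filter [RHS]big_mkcond; apply: eq_bigr => u _.
exact: leaf_exp.
Qed.

Lemma chi_odd_part j (y : conf j) s : chi s y = chi (odd_part s) y.
Proof. by rewrite -prod_leaf_exp prodr_undup_exp_count. Qed.

Lemma Exp_leaf_indep th j (s : seq nat) (c : nat -> nat) : 0 <= th -> th <= 1 ->
  uniq s -> all (fun u => u < K ^ j)%N s -> (th == 0) || (size s < K)%N ->
  Exp th (fun y : conf j => \prod_(u <- s) leaf y u ^+ c u) =
  \prod_(u <- s) (~~ odd (c u))%:R.
Proof.
move=> th0 th1 us sN sK.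
under eq_Exp => y do rewrite prod_leaf_exp.
have [ho|hn] := boolP (has (fun u => odd (c u)) s).
  rewrite Exp_chi0 ?filter_uniq //.
  - apply/esym/eqP; rewrite prodf_seq_eq0; case/hasP: ho => u us' oc.
    by apply/hasP; exists u; rewrite //= oc.
  - by apply/allP => w; rewrite mem_filter => /andP[_ /(allP sN)].
  - by rewrite size_filter -has_count.
  - case/orP: sK => [->//|sK]; rewrite size_filter.
    by rewrite (leq_ltn_trans (count_size _ _) sK) orbT.
move: (hn); rewrite has_filter negbK => /eqP ->; rewrite Exp_chi_nil // big_seq big1 // => u us'.
by have /hasPn/(_ _ us') -> := hn.
Qed.

Lemma gmom_b j : 0 <= ((~~ odd j)%:R : R) /\ (~~ odd j)%:R <= gmom j (1 : R).
Proof.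
split; first exact: ler0n.
have [oj|ej] := boolP (odd j); first by rewrite gmom_ge0.
have := @gmom_even_ge1 R j./2.
by rewrite [j./2.*2](_ : _ = j) // -[RHS]odd_double_half (negbTE ej).
Qed.

(** Since 4 < K, any four leaves are independent, and the moments of a sign are at most those of
    N(0, 1). The bound is the fourth moment of N(0, K^j). *)
Lemma Exp_tot4 th j : 0 <= th -> th <= 1 ->
  Exp th (fun y : conf j => tot y ^+ 4) <= 3 * (K ^ j)%:R ^+ 2.
Proof.
move=> th0 th1.
have E4 : gmom 4 (K ^ j)%:R = 3 * (K ^ j)%:R ^+ 2 :> R.
  by rewrite /gmom /=; congr (_ * _); rewrite !factS fact0 /=; field.
rewrite -E4 -[(K ^ j)%:R]mulr1.
apply: (@moment_bound R (conf j) (@Exp R k th j) (@eq_Exp R k th j) _ _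
  (fun t (y : conf j) => leaf y t) (K ^ j) K 1 (fun i => (~~ odd i)%:R)
  _ _ _ _ _ (K ^ j) 4) => //.
- by move=> I f; rewrite Exp_sum.
- by move=> c f; rewrite ExpZ.
- by move=> i; case: (gmom_b i).
- by move=> s c us sN sK; rewrite Exp_leaf_indep // sK orbT.
- by rewrite ltnS (leq_trans _ k5).
Qed.

Lemma Exp_tot2 th j : 0 <= th -> th <= 1 ->
  Exp th (fun y : conf j => tot y ^+ 2) = (K ^ j)%:R.
Proof.
move=> th0 th1.
rewrite -[in RHS](card_ord (K ^ j)) -sumr_const.
under eq_Exp => y do rewrite expr2 {1}/tot mulr_suml.
rewrite Exp_sum; apply: eq_bigr => u _.
under eq_Exp => y do rewrite /tot mulr_sumr.
rewrite Exp_sum (bigD1 u) //= big1 ?addr0.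
  by rewrite -[RHS](Exp1 th k_odd j); apply: eq_Exp => y; rewrite -expr2 leaf_sqr.
move=> u' u'u; rewrite -(@Exp_chi0 R k th k_odd j [:: val u; val u']) //=.
- by apply: eq_Exp => y; rewrite /chi !big_cons big_nil mulr1.
- by rewrite !ltn_ord.
- by rewrite inE eq_sym u'u.
- by rewrite ltnS (leq_trans _ k5) ?orbT.
Qed.

(* The tangent-type bound [t >= (3 t^2 - t^4)/2] at [t = |x|/a] with [a^2 = 3 K^j]
   turns second and fourth moments into a first moment. *)
Lemma Exp_abs_tot th j : 0 <= th -> th <= 1 ->
  (K ^ j)%:R / 3 <= Exp th (fun y : conf j => `|tot y|) ^+ 2.
Proof.
move=> th0 th1; set N : R := (K ^ j)%:R.
have N0 : 0 < N by rewrite ltr0n expn_gt0.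
pose a := Num.sqrt (3 * N).
have a2 : a ^+ 2 = 3 * N by rewrite sqr_sqrtr // mulr_ge0 // ltW.
have a0 : 0 < a by rewrite sqrtr_gt0 mulr_gt0.
have tb (x : R) : 3 / (2 * a) * x ^+ 2 + (- (2 * a ^+ 3)^-1) * x ^+ 4 <= `|x|.
  have -> : x ^+ 2 = `|x| ^+ 2 by rewrite real_normK ?num_real.
  have -> : x ^+ 4 = `|x| ^+ 4.
    by rewrite -[4%N]/(2 * 2)%N !exprM real_normK ?num_real.
  move: (normr_ge0 x); move: `|x| => {}x x0; rewrite -subr_ge0.
  have -> : x - (3 / (2 * a) * x ^+ 2 + - (2 * a ^+ 3)^-1 * x ^+ 4) =
    x * (x - a) ^+ 2 * (x + 2 * a) / (2 * a ^+ 3) by field; rewrite gt_eqF.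
  have a0' := ltW a0.
  apply: divr_ge0; last by rewrite mulr_ge0 ?exprn_ge0.
  apply: mulr_ge0; last by rewrite addr_ge0 // mulr_ge0.
  by apply: mulr_ge0 => //; exact: sqr_ge0.
have L : a / 3 <= Exp th (fun y : conf j => `|tot y|).
  apply: le_trans (@le_Exp R k th th0 th1 j _ _ (fun y => tb (tot y))).
  rewrite ExpD !ExpZ Exp_tot2 //.
  have h4 := @Exp_tot4 th j th0 th1; rewrite -/N in h4 *.
  have c0 : 0 <= (2 * a ^+ 3)^-1 by rewrite invr_ge0 mulr_ge0 ?exprn_ge0 // ltW.
  have := ler_wpM2l c0 h4.
  have -> : 3 * N ^+ 2 = a ^+ 4 / 3 by rewrite -[4%N]/(2 * 2)%N exprM a2; field.
  have -> : N = a ^+ 2 / 3 by rewrite a2; field.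
  have -> : (2 * a ^+ 3)^-1 * (a ^+ 4 / 3) = a / 6 by field; rewrite gt_eqF.
  have -> : 3 / (2 * a) * (a ^+ 2 / 3) = a / 2 by field; rewrite gt_eqF.
  rewrite mulNr; lra.
have -> : N / 3 = (a / 3) ^+ 2 by rewrite expr_div_n a2; field.
by rewrite lerXn2r ?nnegrE ?divr_ge0 ?(ltW a0) // (le_trans _ L) // divr_ge0 // ltW.
Qed.

Lemma Exp_abs_totK j : ((K ^ j)%:R / 3) ^+ K./2 <= Exp 1 (fun y : conf j => `|tot y|) ^+ K.
Proof.
have eK : (2 * K./2)%N = K by rewrite -[RHS]odd_double_half /= k_odd mul2n.
rewrite -[X in _ <= _ ^+ X]eK exprM lerXn2r ?nnegrE ?sqr_ge0 ?divr_ge0 ?ler0n //.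
exact: Exp_abs_tot.
Qed.

(** Positions of even multiplicity cancel. If none remain both sides are 1; if K remain
    [Exp_chi_le0] applies and the right side is 0; otherwise both sides are 0. *)
Lemma Exp_chi_le j s : all (fun u => u < K ^ j)%N s -> (size s <= K)%N ->
  Exp 1 (fun y : conf j => chi s y) <= Exp 0 (fun y : conf j => chi s y).
Proof.
move=> sN sK.
under eq_Exp => y do rewrite chi_odd_part.
under [leRHS]eq_Exp => y do rewrite chi_odd_part.
set r := odd_part s.
have ur : uniq r by rewrite filter_uniq // undup_uniq.
have rN : all (fun u => u < K ^ j)%N r.
  by apply/allP => u /odd_part_sub /(allP sN).
have [/size0nil -> |r0] := posnP (size r); first by rewrite !Exp_chi_nil.
have := leq_trans (odd_part_size s) sK; rewrite -/r leq_eqVlt => /orP[/eqP rK|rK].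
  rewrite [leRHS]Exp_chi0 ?eqxx //; exact: Exp_chi_le0.
by rewrite !Exp_chi0 ?rK ?orbT.
Qed.

(** The terms off the image of h are nonpositive, so dropping them can only raise the sum. *)
Lemma ler_sum_inj (A B : finType) (F : A -> R) (h : B -> A) : injective h ->
  (forall a, F a <= 0) -> \sum_a F a <= \sum_b F (h b).
Proof.
move=> hi F0; have <- : \sum_(a in h @: [set: B]) F a = \sum_b F (h b).
  rewrite big_imset /=; last by move=> x y _ _ /hi.
  by apply: eq_bigl => b; rewrite inE.
rewrite (bigID (mem (h @: [set: B]))) /= gerDl.
by rewrite sumr_le0.
Qed.

Lemma Exp_window_pow th j (Z : nat) (pos : nat -> nat) :
  Exp th (fun y : conf j => (\sum_(r < Z) leaf y (pos r)) ^+ K) =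
  \sum_(f : {ffun 'I_K -> 'I_Z}) Exp th (fun y : conf j =>
    chi [seq pos (f a) | a : 'I_K] y).
Proof.
rewrite -Exp_sum; apply: eq_Exp => y.
rewrite -[X in _ ^+ X](card_ord K) -prodr_const bigA_distr_bigA /=.
by apply: eq_bigr => f _; rewrite /chi big_image.
Qed.

Lemma Exp_window_term_le j (Z : nat) (pos : nat -> nat) (f : {ffun 'I_K -> 'I_Z}) :
  (forall r, r < Z -> pos r < K ^ j)%N ->
  Exp 1 (fun y : conf j => chi [seq pos (f a) | a : 'I_K] y) <=
  Exp 0 (fun y : conf j => chi [seq pos (f a) | a : 'I_K] y).
Proof.
move=> posN; apply: Exp_chi_le; first by apply/allP => _ /imageP[a _ ->]; apply: posN.
by rewrite size_map -cardE card_ord.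
Qed.

Lemma Exp_window_le j (Z : nat) (pos : nat -> nat) :
  (forall r, r < Z -> pos r < K ^ j)%N ->
  Exp 1 (fun y : conf j => (\sum_(r < Z) leaf y (pos r)) ^+ K) <=
  Exp 0 (fun y : conf j => (\sum_(r < Z) leaf y (pos r)) ^+ K).
Proof.
move=> posN; rewrite !Exp_window_pow; apply: ler_sum => f _.
exact: Exp_window_term_le.
Qed.

(* Only the monomials with one factor in each child of a block are kept. *)
Lemma Exp_window_gap d l (Z : nat) (pos : nat -> nat) (b r0 : nat) :
  (forall r, r < Z -> pos r < K ^ (d + l.+1))%N ->
  (b < K ^ d)%N -> (r0 + K ^ l.+1 <= Z)%N ->
  (forall u, u < K ^ l.+1 -> pos (r0 + u) = b * K ^ l.+1 + u)%N ->
  Exp 1 (fun y : conf (d + l.+1) => (\sum_(r < Z) leaf y (pos r)) ^+ K) <=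
  Exp 0 (fun y : conf (d + l.+1) => (\sum_(r < Z) leaf y (pos r)) ^+ K)
  - ((K ^ l)%:R / 3) ^+ K./2.
Proof.
move=> posN bd r0Z posE; rewrite !Exp_window_pow addrC -lerBlDr -sumrB.
have ltu (g : {ffun 'I_K -> 'I_(K ^ l)}) (a : 'I_K) : (a * K ^ l + g a < K ^ l.+1)%N.
  rewrite expnS; apply: (@leq_trans (a.+1 * K ^ l)).
    by rewrite mulSn addnC ltn_add2r.
  by rewrite leq_mul2r ltn_ord orbT.
have ltZ (g : {ffun 'I_K -> 'I_(K ^ l)}) (a : 'I_K) : (r0 + (a * K ^ l + g a) < Z)%N.
  by apply: leq_trans r0Z; rewrite ltn_add2l ltu.
(* [h g] selects the monomial whose a-th factor is leaf [g a] of child a in the b-th block of level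
   l + 1. *)
pose h (g : {ffun 'I_K -> 'I_(K ^ l)}) : {ffun 'I_K -> 'I_Z} :=
  [ffun a => Ordinal (ltZ g a)].
have hi : injective h.
  move=> g g' /ffunP hg; apply/ffunP => a; apply: val_inj.
  by have := congr1 val (hg a); rewrite !ffunE /= => /eqP; rewrite !eqn_add2l => /eqP.
apply: le_trans (ler_sum_inj hi _) _ => [f|].
  by rewrite subr_le0 Exp_window_term_le.
have E (th : R) g : Exp th (fun y : conf (d + l.+1) => chi [seq pos (h g a) | a : 'I_K] y) =
    Exp th (fun y : conf l.+1 => \prod_(a < K) leaf y (a * K ^ l + g a)%N).
  rewrite -[RHS](Exp_sub th k_odd k5 d b); apply: eq_Exp => y.
  rewrite /chi big_image; apply: eq_bigr => a _.
  by rewrite ffunE /= posE ?ltu // leaf_sub ?ltu.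
under eq_bigr => g _ do rewrite !E.
rewrite sumrB !sum_Exp_transversal // oppr0 mul0r subr0 mulN1r lerN2.
exact: Exp_abs_totK.
Qed.

End BlockMoments.

(** * The finite model: random walk in a block *)

Section Coins.
Variable R : rcfType.
Implicit Types (f g : seq bool -> R) (m n : nat).

Fixpoint Ec m f : R :=
  if m is m'.+1 then (Ec m' (fun s => f (true :: s)) + Ec m' (fun s => f (false :: s))) / 2
  else f [::].

Lemma eq_Ec m f g : (forall s, size s = m -> f s = g s) -> Ec m f = Ec m g.
Proof.
elim: m f g => [|m IH] f g fg /=; first exact: fg.
by congr ((_ + _) / 2); apply: IH => s sm; apply: fg; rewrite /= sm.
Qed.

Lemma EcD m f g : Ec m (fun s => f s + g s) = Ec m f + Ec m g.
Proof. by elim: m f g => [|m IH] f g //=; rewrite !IH; field. Qed.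

Lemma EcZ m c f : Ec m (fun s => c * f s) = c * Ec m f.
Proof. by elim: m f => [|m IH] f //=; rewrite !IH; field. Qed.

Lemma EcC m c : Ec m (fun _ => c) = c.
Proof. by elim: m => [|m IH] //=; rewrite !IH; field. Qed.

Lemma EcB m f g : Ec m (fun s => f s - g s) = Ec m f - Ec m g.
Proof.
rewrite EcD; congr (_ + _); rewrite -mulN1r -EcZ.
by apply: eq_Ec => s _; rewrite mulN1r.
Qed.

Lemma Ec_sum m (I : Type) (r : seq I) (P : pred I) (f : I -> seq bool -> R) :
  Ec m (fun s => \sum_(i <- r | P i) f i s) = \sum_(i <- r | P i) Ec m (f i).
Proof.
elim: m f => [|m IH] f //=.
by rewrite !IH -big_split /= mulr_suml.
Qed.

Lemma le_Ec m f g : (forall s, size s = m -> f s <= g s) -> Ec m f <= Ec m g.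
Proof.
elim: m f g => [|m IH] f g fg /=; first exact: fg.
rewrite ler_pM2r ?invr_gt0 //.
by apply: lerD; apply: IH => s sm; apply: fg; rewrite /= sm.
Qed.

Lemma Ec_cat m n f : Ec (m + n) f = Ec m (fun s1 => Ec n (fun s2 => f (s1 ++ s2))).
Proof. by elim: m f => [|m IH] f //=; rewrite !IH. Qed.

Lemma Ec_negb m f : Ec m f = Ec m (fun s => f (map negb s)).
Proof. by elim: m f => [|m IH] f //=; rewrite addrC; congr ((_ + _) / 2); rewrite IH. Qed.

Lemma Ec_norm m f g : (forall s, size s = m -> `|f s| <= g s) -> `|Ec m f| <= Ec m g.
Proof.
move=> fg; rewrite ler_norml -mulN1r -EcZ.
apply/andP; split; apply: le_Ec => s /fg; rewrite ler_norml => /andP[] //.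
by rewrite mulN1r.
Qed.

Lemma Ec_norm_le m f (c : R) : (forall s, size s = m -> `|f s| <= c) -> `|Ec m f| <= c.
Proof. by move=> fc; rewrite -[leRHS](EcC m); exact: Ec_norm. Qed.

Lemma Ec_prod_ord m (h : nat -> bool -> R) :
  Ec m (fun s => \prod_(t < m) h t (nth false s t)) =
  \prod_(t < m) ((h t true + h t false) / 2).
Proof.
elim: m h => [|m IH] h /=; first by rewrite !big_ord0.
rewrite (@eq_Ec m _ (fun s => h 0 true * \prod_(t < m) h t.+1 (nth false s t))); last first.
  by move=> s _; rewrite big_ord_recl.
rewrite (@eq_Ec m (fun s => \prod_(t < m.+1) h t (nth false (false :: s) t))
  (fun s => h 0 false * \prod_(t < m) h t.+1 (nth false s t))); last first.
  by move=> s _; rewrite big_ord_recl.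
by rewrite !EcZ (IH (fun t => h t.+1)) big_ord_recl /=; field.
Qed.

Lemma big_uniq_ord m (s : seq nat) (F : nat -> R) : uniq s -> all (fun t => t < m)%N s ->
  \prod_(t <- s) F t = \prod_(t < m) (if val t \in s then F t else 1).
Proof.
move=> us sm; rewrite -(big_mkord xpredT (fun t => if t \in s then F t else 1)).
rewrite -big_mkcond /= -[RHS]big_filter; apply: perm_big.
apply: uniq_perm => //; first by rewrite filter_uniq // iota_uniq.
move=> t; rewrite mem_filter mem_index_iota /=.
by case: (boolP (t \in s)) => // ts; rewrite (allP sm).
Qed.

Lemma Ec_prod m (s : seq nat) (h : nat -> bool -> R) : uniq s -> all (fun t => t < m)%N s ->
  Ec m (fun x => \prod_(t <- s) h t (nth false x t)) =
  \prod_(t <- s) ((h t true + h t false) / 2).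
Proof.
move=> us sm; rewrite (big_uniq_ord _ us sm).
pose h' t b := if t \in s then h t b else 1.
rewrite (@eq_Ec m _ (fun x => \prod_(t < m) h' t (nth false x t))); last first.
  by move=> x _; rewrite (big_uniq_ord _ us sm).
rewrite Ec_prod_ord; apply: eq_bigr => t _; rewrite /h'; case: ifP => // _.
by field.
Qed.

Definition heads (s : seq bool) : nat := count id s.

(** A word or its complement has at least half heads, and the two are equally likely. *)
Lemma heads_half m : 2^-1 <= Ec m (fun s => (m <= (heads s).*2)%N%:R).
Proof.
set f := fun s => _; suff : 1 <= Ec m f + Ec m f by lra.
rewrite {2}Ec_negb -EcD -[leLHS](EcC m); apply: le_Ec => s sm.
rewrite /f -natrD (ler_nat _ 1) addn_gt0 !lt0b.
have -> : heads (map negb s) = (m - heads s)%N.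
  by rewrite /heads count_map -sm -(count_predC id s) addKn.
by have := count_size id s; rewrite -/(heads s) sm; lia.
Qed.

Lemma heads_pow m : Ec m (fun s => 2^-1 ^+ heads s) = (3 / 4) ^+ m.
Proof.
elim: m => [|m IH] /=; first by rewrite !expr0.
rewrite (@eq_Ec m _ (fun s => 2^-1 * 2^-1 ^+ heads s)); last by move=> s _; rewrite /heads /= exprS.
by rewrite EcZ !IH exprS; field.
Qed.

(** Markov's inequality for 2^-heads, whose mean is (3/4)^m. *)
Lemma heads_small m c : Ec m (fun s => (heads s < c)%N%:R) <= 2 ^+ c * (3 / 4) ^+ m.
Proof.
rewrite -heads_pow -EcZ; apply: le_Ec => s _.
case: ltnP => hc; last by rewrite mulr_ge0 ?exprn_ge0 ?invr_ge0.
rewrite -[c](subnK (ltnW hc)) exprD -mulrA -exprMn divff ?pnatr_eq0 // expr1n mulr1.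
by rewrite exprn_ege1 // ler1n.
Qed.

Section Equidistribution.
Variables (N : nat) (h : nat -> R).
Hypotheses (N0 : (0 < N)%N) (hper : forall w, h (w + N)%N = h w).

Lemma h_mod w : h (w %% N)%N = h w.
Proof.
rewrite {2}(divn_eq w N) addnC; elim: (w %/ N)%N => [|q IH]; first by rewrite addn0.
by rewrite mulSn addnCA addnC hper.
Qed.

Lemma sum_shift c : \sum_(w < N) h (w + c)%N = \sum_(w < N) h w.
Proof.
elim: c => [|c IH]; first by under eq_bigr do rewrite addn0.
rewrite -IH -(big_mkord xpredT (fun w => h (w + c.+1)%N)).
rewrite -(big_mkord xpredT (fun w => h (w + c)%N)).
case: N N0 hper => // n _ hp.
rewrite big_nat_recr //= [RHS]big_nat_recl //= addrC; congr (_ + _).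
  by rewrite -[RHS]hp; congr h; lia.
by apply: eq_bigr => i _; congr h; lia.
Qed.

Definition havg : R := (\sum_(w < N) h w) / N%:R.

(* After N flips every residue class has been reached with probability at
   least 2^-N, which contracts the oscillation of h. *)
Lemma Ec_osc_step (lo hi : R) : (forall w, lo <= h w <= hi) ->
  exists lo', forall w, lo' <= Ec N (fun s => h (w + heads s)%N)
      <= lo' + (1 - 2^-1 ^+ N) * (hi - lo).
Proof.
(* From w, a word of length N with c heads leads to a multiple of N, where h takes the value [h 0].
   This word has probability 2^-N, which bounds the mean below by lo + 2^-N (h 0 - lo) and above by
   hi - 2^-N (hi - h 0); the two differ by (1 - 2^-N) (hi - lo). *)
move=> hb; exists (lo + 2^-1 ^+ N * (h 0%N - lo)) => w.
have reach : forall c, (c <= N)%N -> forall f : seq bool -> R, (forall s, 0 <= f s) ->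
    exists s, size s = N /\ heads s = c /\ 2^-1 ^+ N * f s <= Ec N f.
  elim: N => [|n IH] c cn f f0.
    by exists [::]; rewrite expr0 mul1r; case: c cn.
  rewrite /=; case: c cn => [|c] cn.
    have [s [sn [sc sf]]] := IH 0%N (leq0n _) (fun s => f (false :: s)) (fun s => f0 _).
    exists (false :: s); split; [by rewrite /= sn|split => //].
    have : 0 <= Ec n (fun s => f (true :: s)).
      by rewrite -(EcC n 0); apply: le_Ec.
    rewrite exprS; lra.
  have [s [sn [sc sf]]] := IH c cn (fun s => f (true :: s)) (fun s => f0 _).
  exists (true :: s); split; [by rewrite /= sn|split; first by rewrite /heads /= -sc].
  have : 0 <= Ec n (fun s => f (false :: s)).
    by rewrite -(EcC n 0); apply: le_Ec.
  rewrite exprS; lra.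
pose c := ((N - w %% N) %% N)%N.
have cN : (c <= N)%N by rewrite ltnW // ltn_pmod.
have hc : h (w + c)%N = h 0%N.
  rewrite -h_mod -[RHS]h_mod; congr h; rewrite mod0n.
  have := ltn_pmod w N0 => wN.
  by rewrite /c modnDmr -modnDml subnKC ?modnn // ltnW.
apply/andP; split.
  have [s [_ [sc sf]]] := reach c cN (fun s => h (w + heads s)%N - lo)
    (fun s => ltac:(by rewrite subr_ge0; case/andP: (hb (w + heads s)%N))).
  by move: sf; rewrite EcB EcC sc hc; lra.
have [s [_ [sc sf]]] := reach c cN (fun s => hi - h (w + heads s)%N)
    (fun s => ltac:(by rewrite subr_ge0; case/andP: (hb (w + heads s)%N))).
by move: sf; rewrite EcB EcC sc hc; lra.
Qed.

End Equidistribution.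

Lemma Ec_osc (N : nat) (h : nat -> R) (r : nat) : (0 < N)%N ->
  (forall w, h (w + N)%N = h w) -> (forall w, `|h w| <= 1) ->
  exists lo, forall w, lo <= Ec (r * N) (fun s => h (w + heads s)%N)
      <= lo + 2 * (1 - 2^-1 ^+ N) ^+ r.
Proof.
move=> N0 hper h1; elim: r => [|r [lo IH]].
  exists (- 1) => w; rewrite mul0n /= addn0 expr0 mulr1.
  by have := h1 w; rewrite ler_norml; lra.
pose h' w := Ec (r * N) (fun s => h (w + heads s)%N).
have hper' w : h' (w + N)%N = h' w.
  by apply: eq_Ec => s _; rewrite addnAC hper.
have [lo' IH'] := Ec_osc_step N0 hper' IH.
exists lo' => w; rewrite mulSn Ec_cat exprS.
have := IH' w; rewrite (_ : lo + _ - lo = 2 * (1 - 2^-1 ^+ N) ^+ r); last by ring.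
rewrite mulrCA /h'.
under [X in _ <= X <= _ -> _]eq_Ec => s _ do under eq_Ec => s' _ do rewrite -addnA.
by under [X in _ -> _ <= X <= _]eq_Ec => s _ do under eq_Ec => s' _ do rewrite /heads count_cat.
Qed.

Lemma Ec_equidistribution (N : nat) (h : nat -> R) (m w : nat) : (0 < N)%N ->
  (forall w, h (w + N)%N = h w) -> (forall w, `|h w| <= 1) ->
  `|Ec m (fun s => h (w + heads s)%N) - havg N h| <= 2 * (1 - 2^-1 ^+ N) ^+ (m %/ N).
Proof.
move=> N0 hper h1; set r := (m %/ N)%N.
have [lo IH] := Ec_osc r N0 hper h1.
set e := 2 * _ in IH *.
pose h' w := Ec (r * N) (fun s => h (w + heads s)%N).
(* Shifting by the heads permutes the residues, so h and [h'] have the same average over a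
   period. *)
have A : lo <= havg N h <= lo + e.
  have -> : havg N h = havg N h'.
    rewrite /havg /h' -Ec_sum; congr (_ / _).
    rewrite -[LHS](EcC (r * N)); apply: eq_Ec => s _.
    by rewrite sum_shift.
  rewrite /havg ler_pdivlMr ?ltr0n // ler_pdivrMr ?ltr0n //.
  have cst c : c * N%:R = \sum_(i < N) c by rewrite sumr_const card_ord mulr_natr.
  rewrite !cst.
  by apply/andP; split; apply: ler_sum => i _; case/andP: (IH i).
have B : lo <= Ec m (fun s => h (w + heads s)%N) <= lo + e.
  (* The m mod N surplus flips are put first; they only change the starting point, in which the
     bounds are uniform. *)
  rewrite (divn_eq m N) addnC Ec_cat.
  rewrite (@eq_Ec _ _ (fun s1 => h' (w + heads s1)%N)); last first.
    by move=> s _; apply: eq_Ec => s' _; rewrite /heads count_cat addnA.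
  by apply/andP; split; [rewrite -[leLHS](EcC (m %% N))|rewrite -[leRHS](EcC (m %% N))];
     apply: le_Ec => s _; case/andP: (IH (w + heads s)%N).
move: A B; rewrite ler_norml; lra.
Qed.

End Coins.

(** * The process seen by the reader *)

Section Model.
Variables (R : rcfType) (k : nat).
Notation K := k.+1.
Hypotheses (k_odd : odd k) (k5 : (5 <= k)%N).
Local Notation conf := (conf k).
Local Notation leaf := (@leaf R k _).
Local Notation chi := (@chi R k _).
Implicit Types th : R.

(** The product expands into characters, and r collects the leaves already picked. The positions are
    distinct and, unless th = 0, fewer than K, so only the empty character has nonzero mean. *)
Lemma Exp_affine th j (s : seq nat) (a b : nat -> R) (p : nat -> nat) (q : pred nat)
    (r : seq nat) :
  uniq (r ++ [seq p t | t <- s & q t]) ->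
  all (fun u => u < K ^ j)%N (r ++ [seq p t | t <- s & q t]) ->
  (th == 0) || (size r + size s < K)%N ->
  Exp th (fun y : conf j => chi r y *
     \prod_(t <- s) (a t + (if q t then b t * leaf y (p t) else 0))) =
  if r == [::] then \prod_(t <- s) a t else 0.
Proof.
elim: s r => [|t s IH] r /=.
  rewrite cats0 addn0 big_nil => ur rN rK.
  under eq_Exp => y do rewrite big_nil mulr1.
  case: eqP => [->|/eqP r0]; first exact: Exp_chi_nil.
  by rewrite Exp_chi0 // lt0n size_eq0.
move=> ur rN rK.
under eq_Exp => y do rewrite big_cons mulrDl mulrDr mulrCA [X in _ + X]mulrCA.
rewrite ExpD ExpZ big_cons.
have rK' : (th == 0) || (size r + size s < K)%N.
  by case/orP: rK => [->//|h]; rewrite (leq_ltn_trans _ h) ?orbT // leq_add2l.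
have [qt|qt] := boolP (q t); last first.
  move: ur rN; rewrite (negbTE qt) => ur rN.
  under [X in _ + X]eq_Exp => y do rewrite mul0r.
  rewrite ExpC // addr0 IH //; case: ifP => // _; exact: mulr0.
move: ur rN; rewrite qt /= => ur rN.
have pe : perm_eq (r ++ p t :: [seq p t | t <- s & q t]) (p t :: r ++ [seq p t | t <- s & q t]).
  by rewrite -cat1s perm_catCA.
rewrite (perm_uniq pe) in ur; rewrite (perm_all _ pe) in rN.
rewrite IH //; last 2 first.
- by case/andP: ur.
- by case/andP: rN.
rewrite (@eq_Exp _ _ _ _ _ (fun y : conf j => b t * (chi (p t :: r) y *
     \prod_(t <- s) (a t + (if q t then b t * leaf y (p t) else 0))))).
  rewrite ExpZ IH //=.
  - by rewrite mulr0 addr0; case: ifP => // _; rewrite mulr0.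
  - by case/orP: rK => [->//|]; rewrite addnS => ->; rewrite orbT.
move=> y; rewrite /chi big_cons; ring.
Qed.

Lemma heads_takeS (s : seq bool) t :
  heads (take t.+1 s) = (heads (take t s) + nth false s t)%N.
Proof.
rewrite /heads; have [ts|ts] := ltnP t (size s).
  by rewrite (take_nth false) // -cats1 count_cat /= addn0.
by rewrite !take_oversize ?(leqW ts) // nth_default // addn0.
Qed.

Lemma heads_take_le (s : seq bool) t d :
  (heads (take t s) <= heads (take (t + d) s) <= heads (take t s) + d)%N.
Proof.
elim: d => [|d /andP[IH1 IH2]]; first by rewrite !addn0 !leqnn.
rewrite !addnS heads_takeS (leq_trans IH1) ?leq_addr //=.
by case: nth; rewrite ?addn1 ?addn0 ?ltnS // leqW.
Qed.

Definition pos j (v : nat) (s : seq bool) (t : nat) : nat :=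
  ((v + heads (take t s)) %% K ^ j)%N.

Lemma pos_lt j v s t : (pos j v s t < K ^ j)%N.
Proof. by rewrite ltn_pmod // expn_gt0. Qed.

(** After reading a leaf at a head the reader moves on, and in fewer than K^j steps it cannot have
    come round again. *)
Lemma pos_neq j v s t t' : (t < t' < K ^ j)%N -> nth false s t ->
  pos j v s t != pos j v s t'.
Proof.
move=> /andP[tt' t'N] st; rewrite /pos.
have := heads_take_le s t.+1 (t' - t.+1); rewrite subnKC // heads_takeS st.
set a := heads _; set b := heads _ => /andP[ab ba].
have e : b = (a + (b - a))%N by lia.
rewrite e addnA -{1}[(v + a)%N]addn0 eqn_modDl mod0n modn_small; lia.
Qed.

Definition path j (v : nat) (s : seq bool) (y : conf j) (t : nat) : R :=
  (nth false s t)%:R * leaf y (pos j v s t).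

Definition Em th j m (G : (nat -> R) -> R) : R :=
  (\sum_(v < K ^ j) Ec m (fun s => Exp th (fun y : conf j => G (path v s y)))) /
  (K ^ j)%:R.

Lemma KX_neq0 j : (K ^ j)%:R != 0 :> R.
Proof. by rewrite pnatr_eq0 -lt0n expn_gt0. Qed.

Lemma avg_const j c : (\sum_(v < K ^ j) c) / (K ^ j)%:R = c :> R.
Proof. by rewrite sumr_const card_ord -[c *+ _]mulr_natr mulfK ?KX_neq0. Qed.

Lemma eq_Em_path th j m (G H : (nat -> R) -> R) :
  (forall v s (y : conf j), size s = m -> G (path v s y) = H (path v s y)) ->
  Em th j m G = Em th j m H.
Proof.
move=> GH; congr (_ / _); apply: eq_bigr => v _; apply: eq_Ec => s sm.
by apply: eq_Exp => y; rewrite GH.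
Qed.

Lemma eq_Em th j m (G H : (nat -> R) -> R) : G =1 H -> Em th j m G = Em th j m H.
Proof. by move=> GH; apply: eq_Em_path => v s y _; rewrite GH. Qed.

Lemma EmD th j m G H : Em th j m (fun x => G x + H x) = Em th j m G + Em th j m H.
Proof.
rewrite /Em -mulrDl -big_split /=; congr (_ / _); apply: eq_bigr => v _.
by rewrite -EcD; apply: eq_Ec => s _; rewrite ExpD.
Qed.

Lemma EmZ th j m c G : Em th j m (fun x => c * G x) = c * Em th j m G.
Proof.
rewrite /Em mulrA mulr_sumr; congr (_ / _); apply: eq_bigr => v _.
by rewrite -EcZ; apply: eq_Ec => s _; rewrite ExpZ.
Qed.

Lemma Em_sum th j m (I : finType) (G : I -> (nat -> R) -> R) :
  Em th j m (fun x => \sum_i G i x) = \sum_i Em th j m (G i).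
Proof.
rewrite /Em -mulr_suml exchange_big /=; congr (_ / _); apply: eq_bigr => v _.
by rewrite -Ec_sum; apply: eq_Ec => s _; rewrite Exp_sum.
Qed.

Lemma EmC th j m c : Em th j m (fun _ => c) = c.
Proof.
rewrite /Em; under eq_bigr => v _.
  under eq_Ec => s _ do rewrite ExpC //.
  rewrite EcC; over.
exact: avg_const.
Qed.

Lemma le_Em th j m (G H : (nat -> R) -> R) : 0 <= th -> th <= 1 ->
  (forall v s (y : conf j), size s = m -> G (path v s y) <= H (path v s y)) ->
  Em th j m G <= Em th j m H.
Proof.
move=> th0 th1 GH; rewrite ler_pM2r ?invr_gt0 ?ltr0n ?expn_gt0 //.
apply: ler_sum => v _; apply: le_Ec => s sm; apply: le_Exp => // y.
exact: GH.
Qed.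

Lemma path_val j v s (y : conf j) t :
  [\/ path v s y t = 0, path v s y t = 1 | path v s y t = -1].
Proof.
rewrite /path; case: nth; rewrite ?mul0r ?mul1r; last by constructor 1.
have := leaf_sqr R y (pos j v s t) => /eqP; rewrite sqrf_eq1 => /orP[]/eqP ->.
  by constructor 2.
by constructor 3.
Qed.

(* Here and below, g t 0 / 2 + (g t 1 + g t (-1)) / 4 is the mean of g t under
   the law of one variable. *)
Lemma Em_indep th j m (s : seq nat) (g : nat -> R -> R) : (m <= K ^ j)%N ->
  uniq s -> all (fun t => t < m)%N s -> (th == 0) || (size s < K)%N ->
  Em th j m (fun x => \prod_(t <- s) g t (x t)) =
  \prod_(t <- s) (g t 0 / 2 + (g t 1 + g t (-1)) / 4).
Proof.
move=> mN us sm sK.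
pose a t (b : bool) := if b then (g t 1 + g t (-1)) / 2 else g t 0.
have key v (xi : seq bool) : Exp th (fun y : conf j => \prod_(t <- s) g t (path v xi y t)) =
    \prod_(t <- s) a t (nth false xi t).
  (* At a head, g is a + b at 1 and a - b at -1, an affine function of the leaf as [Exp_affine]
     wants it. *)
  pose b t := (g t 1 - g t (-1)) / 2.
  rewrite (@eq_Exp _ _ _ _ _ (fun y : conf j => chi [::] y * \prod_(t <- s)
     (a t (nth false xi t) + (if nth false xi t then b t * leaf y (pos j v xi t) else 0)))).
    rewrite Exp_affine //=.
    - rewrite map_inj_in_uniq ?filter_uniq // => t t'.
      rewrite !mem_filter => /andP[xt ts] /andP[xt' ts'] /eqP.
      have tN : (t < K ^ j)%N by rewrite (leq_trans _ mN) ?(allP sm).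
      have tN' : (t' < K ^ j)%N by rewrite (leq_trans _ mN) ?(allP sm).
      case: (ltngtP t t') => // tt'.
        by apply: contraTeq => _; apply: pos_neq; rewrite ?tt'.
      by rewrite eq_sym; apply: contraTeq => _; apply: pos_neq; rewrite ?tt'.
    - by apply/allP => _ /mapP[t _ ->]; apply: pos_lt.
  move=> y; rewrite chi_nil mul1r; apply: eq_bigr => t _.
  rewrite /path /a /b; case: nth; last by rewrite mul0r addr0.
  rewrite mul1r; have := leaf_sqr R y (pos j v xi t) => /eqP.
  by rewrite sqrf_eq1 => /orP[]/eqP ->; field.
rewrite -[RHS](avg_const j); congr (_ / _); apply: eq_bigr => v _.
transitivity (\prod_(t <- s) ((a t true + a t false) / 2)); last first.
  by apply: eq_bigr => t _; rewrite /a; field.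
by rewrite -(@Ec_prod _ m) //; apply: eq_Ec => xi _; rewrite key.
Qed.

Lemma norm_path j v s (y : conf j) t : `|path v s y t| = (nth false s t)%:R.
Proof.
rewrite normrM ger0_norm ?ler0n //; have := leaf_sqr R y (pos j v s t) => /eqP.
by rewrite sqrf_eq1 => /orP[]/eqP ->; rewrite ?normrN normr1 mulr1.
Qed.

Lemma Em_abs_indep th j m (s : seq nat) (g : nat -> R -> R) :
  uniq s -> all (fun t => t < m)%N s ->
  Em th j m (fun x => \prod_(t <- s) g t `|x t|) =
  \prod_(t <- s) ((g t 1 + g t 0) / 2).
Proof.
move=> us sm; rewrite -[RHS](avg_const j); congr (_ / _); apply: eq_bigr => v _.
rewrite -(@Ec_prod _ m _ (fun t (b : bool) => g t b%:R)) //; apply: eq_Ec => xi _.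
rewrite -[RHS](ExpC th k_odd j); apply: eq_Exp => y.
by apply: eq_bigr => t _; rewrite norm_path.
Qed.

Definition depends_on (a : nat) (G : (nat -> R) -> R) :=
  forall x x', (forall t, (t < a)%N -> x t = x' t) -> G x = G x'.

Lemma path_cat j v s1 s2 s3 (y : conf j) t : (t < size s2)%N ->
  path v (s1 ++ s2 ++ s3) y (size s1 + t) = path (v + heads s1) s2 y t.
Proof.
move=> ts; rewrite /path /pos nth_cat ltnNge leq_addr /= addKn nth_cat ts.
rewrite takeD take_size_cat // drop_size_cat // take_cat ts.
by rewrite /heads count_cat addnA.
Qed.

Lemma path_per j v s (y : conf j) t : path (v + K ^ j) s y t = path v s y t.
Proof. by rewrite /path /pos addnAC modnDr. Qed.

Lemma path_mod j v s (y : conf j) t : path (v %% K ^ j) s y t = path v s y t.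
Proof. by rewrite /path /pos modnDml. Qed.

(** Stationarity of the model: in t0 flips the reader moves by a number of heads independent of its
    uniform start, so its position is again uniform on the cycle of length K^j. *)
Lemma Em_shift th j m t0 a (G : (nat -> R) -> R) : depends_on a G ->
  (t0 + a <= m)%N -> Em th j m (fun x => G (fun t => x (t0 + t)%N)) = Em th j a G.
Proof.
move=> Ga t0a; rewrite -(subnKC t0a) -addnA.
pose H v := Ec a (fun s => Exp th (fun y : conf j => G (path v s y))).
transitivity ((\sum_(v < K ^ j) Ec t0 (fun s1 => H (v + heads s1)%N)) / (K ^ j)%:R).
  congr (_ / _); apply: eq_bigr => v _; rewrite Ec_cat; apply: eq_Ec => s1 s1t.
  rewrite Ec_cat; apply: eq_Ec => s2 s2t.
  rewrite -[RHS](EcC (m - (t0 + a))); apply: eq_Ec => s3 _.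
  apply: eq_Exp => y; apply: Ga => t ta.
  by rewrite -s1t path_cat // s2t.
rewrite -Ec_sum; congr (_ / _); rewrite -[RHS](EcC t0); apply: eq_Ec => s1 _.
apply: sum_shift => [|w]; first by rewrite expn_gt0.
apply: eq_Ec => s _; apply: eq_Exp => y; apply: Ga => t _; exact: path_per.
Qed.

End Model.

(** * Moments of partial sums in the finite model *)

Section ModelMoments.
Variables (R : rcfType) (k : nat).
Notation K := k.+1.
Hypotheses (k_odd : odd k) (k5 : (5 <= k)%N).
Local Notation conf := (conf k).
Local Notation leaf := (@leaf R k _).
Local Notation path := (@path R k _).
Local Notation Em := (@Em R k).
Implicit Types th : R.

Definition xsum (n : nat) (x : nat -> R) : R := \sum_(t < n) x t.

Definition bmom (c : nat) : R := if c == 0%N then 1 else if odd c then 0 else 2^-1.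

(** Tails contribute 0 and leave the reader in place, so the sum runs over a cyclic interval of
    leaves whose length is the number of heads. *)
Lemma xsum_path j n v s (y : conf j) :
  xsum n (path v s y) = \sum_(r < heads (take n s)) leaf y ((v + r) %% K ^ j).
Proof.
rewrite /xsum; elim: n => [|n IH]; first by rewrite take0 !big_ord0.
rewrite big_ord_recr /= IH heads_takeS /path /pos.
by case: nth; rewrite ?addn1 ?addn0 ?mul0r ?addr0 // mul1r big_ord_recr.
Qed.

Lemma bmom_ge0 c : 0 <= bmom c.
Proof. by rewrite /bmom; case: eqP => // _; case: odd; rewrite ?invr_ge0. Qed.

Lemma bmom_le c : bmom c <= gmom c 2^-1.
Proof.
rewrite /bmom; case: eqP => [->|/eqP c0]; first by rewrite gmom0.
have [oc|ec] := boolP (odd c); first by rewrite gmom_ge0 ?invr_ge0.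
have := @gmom_even_half_ge R c./2; rewrite [c./2.*2](_ : _ = c).
  by apply; rewrite -double_gt0 [c./2.*2](_ : _ = c) ?lt0n // -[RHS]odd_double_half (negbTE ec).
by rewrite -[RHS]odd_double_half (negbTE ec).
Qed.

Lemma Em_moment th j n l L : (n <= K ^ j)%N -> (l < L)%N -> (th == 0) || (L <= K)%N ->
  Em th j n (fun x => xsum n x ^+ l) <= gmom l (n%:R * 2^-1).
Proof.
move=> nN lL hL.
apply: (@moment_bound R (nat -> R) (Em th j n) (@eq_Em R k th j n) _ _
  (fun t x => x t) n L 2^-1 bmom _ _ _ _ _ n l) => //.
- by move=> I f; rewrite Em_sum.
- by move=> c f; rewrite EmZ.
- by rewrite invr_ge0.
- exact: bmom_ge0.
- exact: bmom_le.
move=> s c us sn sL; rewrite (@Em_indep R k k_odd k5 th j n s (fun t x => x ^+ c t)) //.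
  apply: eq_bigr => t _; rewrite /bmom expr1n.
  have [-> |c0] := eqVneq (c t) 0%N; first by rewrite !expr0; field.
  rewrite expr0n (negbTE c0) /= -signr_odd; by case: odd; rewrite ?expr1 ?expr0; field.
by case/orP: hL => [->//|LK]; rewrite (leq_trans sL LK) orbT.
Qed.

(** At least n/2 heads, an event of probability at least 1/2, give a window of at least 2 K^(l+1)
    leaves: fewer than K^(l+1) of them lead to the next multiple of K^(l+1), and then a whole block
    follows. Hence the factors 4 and 1/2. *)
Lemma Em_gap d l n : (n <= K ^ (d + l.+1))%N -> (4 * K ^ l.+1 <= n)%N ->
  Em 1 (d + l.+1) n (fun x => xsum n x ^+ K) <=
  Em 0 (d + l.+1) n (fun x => xsum n x ^+ K) - 2^-1 * ((K ^ l)%:R / 3) ^+ K./2.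
Proof.
move=> nN ln; set gap := _ ^+ K./2; set j := (d + l.+1)%N.
have gap0 : 0 <= gap by rewrite exprn_ge0 // divr_ge0 ?ler0n.
pose h s : R := (n <= (heads s).*2)%N%:R.
have key v s : size s = n -> Exp 1 (fun y : conf j => xsum n (path v s y) ^+ K) <=
    Exp 0 (fun y : conf j => xsum n (path v s y) ^+ K) - h s * gap.
  move=> sn.
  rewrite (eq_Exp 1 (fun y => congr1 (fun z => z ^+ K) (xsum_path n v s y))).
  rewrite (eq_Exp 0 (fun y => congr1 (fun z => z ^+ K) (xsum_path n v s y))).
  rewrite take_oversize ?sn // /h; case: leqP => hn; last first.
    rewrite mul0r subr0; apply: (@Exp_window_le R k k_odd k5 j (heads s) (fun r => (v + r) %% K ^ j)%N) => r _.
    by rewrite ltn_pmod // expn_gt0.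
  rewrite mul1r.
  have N0 : (0 < K ^ l.+1)%N by rewrite expn_gt0.
  pose r0 := ((K ^ l.+1 - v %% K ^ l.+1) %% K ^ l.+1)%N.
  have r0N : (r0 < K ^ l.+1)%N by rewrite ltn_pmod.
  pose c := ((v + r0) %/ K ^ l.+1)%N.
  have cE : (v + r0 = c * K ^ l.+1)%N.
    apply/esym/eqP; rewrite /c -dvdn_eq /dvdn /r0 modnDmr -modnDml subnKC ?modnn //.
    by rewrite ltnW // ltn_pmod.
  (* The reading is cyclic, so the block reached after r0 leaves is number c modulo K^d. *)
  apply: (@Exp_window_gap R k k_odd k5 d l (heads s) (fun r => (v + r) %% K ^ j)%N (c %% K ^ d) r0).
  - by move=> r _; rewrite ltn_pmod // expn_gt0.
  - by rewrite ltn_pmod // expn_gt0.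
  - by move: hn ln r0N; rewrite -addnn; set q := (K ^ l.+1)%N; lia.
  - move=> u uN; rewrite addnA cE {1}(divn_eq c (K ^ d)) mulnDl -mulnA -addnA /j expnD modnMDl.
    rewrite modn_small //; apply: (@leq_trans ((c %% K ^ d).+1 * K ^ l.+1)).
      by rewrite mulSn addnC ltn_add2r.
    by rewrite leq_mul2r ltn_pmod ?orbT // expn_gt0.
have -> : Em 1 j n (fun x => xsum n x ^+ K) = (\sum_(v < K ^ j) Ec n (fun s =>
    Exp 1 (fun y : conf j => xsum n (path v s y) ^+ K))) / (K ^ j)%:R by [].
have -> : Em 0 j n (fun x => xsum n x ^+ K) - 2^-1 * gap = (\sum_(v < K ^ j) (Ec n (fun s =>
    Exp 0 (fun y : conf j => xsum n (path v s y) ^+ K)) - 2^-1 * gap)) / (K ^ j)%:R.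
  by rewrite sumrB mulrBl avg_const.
rewrite ler_pM2r ?invr_gt0 ?ltr0n ?expn_gt0 //; apply: ler_sum => v _.
apply: (@le_trans _ _ (Ec n (fun s =>
  Exp 0 (fun y : conf j => xsum n (path v s y) ^+ K) - gap * h s))).
  by apply: le_Ec => s /key; rewrite mulrC; apply.
rewrite EcB EcZ lerB // mulrC ler_wpM2l //; exact: heads_half.
Qed.

Lemma Em_moment_gap d l n : (n <= K ^ (d + l.+1))%N -> (4 * K ^ l.+1 <= n)%N ->
  Em 1 (d + l.+1) n (fun x => xsum n x ^+ K) <=
  gmom K (n%:R * 2^-1) - 2^-1 * ((K ^ l)%:R / 3) ^+ K./2.
Proof.
move=> nN ln; apply: le_trans (Em_gap nN ln) _; rewrite lerD2r.
by apply: (@Em_moment 0 _ _ _ K.+1); rewrite ?eqxx.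
Qed.

End ModelMoments.

(** * Mixing of the finite model *)

Section ModelMixing.
Variables (R : rcfType) (k : nat) (th : R).
Notation K := k.+1.
Hypotheses (k_odd : odd k) (k5 : (5 <= k)%N) (th0 : 0 <= th) (th1 : th <= 1).
Local Notation conf := (conf k).
Local Notation path := (@path R k _).
Local Notation Em := (@Em R k th).
Local Notation Exp := (Exp th).

Definition avg (N : nat) (f : nat -> R) : R := (\sum_(v < N) f v) / N%:R.

Lemma avg_norm_le N f g : (forall v, (v < N)%N -> `|f v| <= g v) -> `|avg N f| <= avg N g.
Proof.
move=> fg; rewrite normrM [X in _ * X]ger0_norm ?invr_ge0 ?ler0n //.
rewrite ler_wpM2r ?invr_ge0 ?ler0n //; apply: le_trans (ler_norm_sum _ _ _) _.
by apply: ler_sum => v _; exact: fg.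
Qed.

Lemma avgB N f g : avg N (fun v => f v - g v) = avg N f - avg N g.
Proof. by rewrite /avg sumrB mulrBl. Qed.

Lemma avgD N f g : avg N (fun v => f v + g v) = avg N f + avg N g.
Proof. by rewrite /avg big_split /= mulrDl. Qed.

Lemma avgZ N c f : avg N (fun v => c * f v) = c * avg N f.
Proof. by rewrite /avg -mulr_sumr mulrA. Qed.

Lemma sum_periodic D P (f : nat -> R) : (forall w, f (w + P)%N = f w) ->
  \sum_(v < D * P) f v = D%:R * \sum_(w < P) f w.
Proof.
move=> fP; elim: D => [|D IH]; first by rewrite mul0n big_ord0 mul0r.
rewrite mulSn big_split_ord /= -natr1 mulrDl mul1r addrC; congr (_ + _).
by rewrite -IH; apply: eq_bigr => i _; rewrite addnC fP.
Qed.

Lemma avg_periodic D P (f : nat -> R) : (0 < D)%N -> (forall w, f (w + P)%N = f w) ->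
  avg (D * P) f = avg P f.
Proof.
move=> D0 fP; rewrite /avg sum_periodic // natrM invfM mulrACA divff ?mul1r //.
by rewrite pnatr_eq0 -lt0n.
Qed.

Lemma avg_overflow P a : avg P (fun v => (P < v %% P + a)%N%:R) <= a%:R / P%:R.
Proof.
rewrite /avg ler_wpM2r ?invr_ge0 ?ler0n // -natr_sum ler_nat.
rewrite (eq_bigr (fun v : 'I_P => (P < v + a)%N : nat)); last first.
  by move=> v _; rewrite modn_small.
rewrite -(big_mkord xpredT (fun v => (P < v + a)%N : nat)).
rewrite (@big_cat_nat _ _ _ (P - a)) ?leq_subr //= [X in (X + _)%N]big1_seq ?add0n.
  apply: (@leq_trans (\sum_(P - a <= i < P) 1)%N).
    by apply: leq_sum => i _; exact: leq_b1.
  by rewrite sum_nat_const_nat muln1; lia.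
move=> v /andP[_]; rewrite mem_index_iota => /andP[_ vP].
by apply/eqP; rewrite eqb0 -leqNgt; lia.
Qed.

Lemma avg_overflowX d J a :
  avg (K ^ (d + J)) (fun v => (K ^ J < v %% K ^ J + a)%N%:R) <= a%:R / (K ^ J)%:R.
Proof.
apply: le_trans (avg_overflow _ a); rewrite expnD avg_periodic ?expn_gt0 // => w.
by rewrite modnDr.
Qed.

Lemma path_sub d J v s (y : conf (d + J)) t : (v < K ^ (d + J))%N ->
  (v %% K ^ J + t < K ^ J)%N ->
  path v s y t = path v s (sub y (v %/ K ^ J)) t.
Proof.
move=> vN vt; rewrite /path /pos; congr (_ * _).
have J0 : (0 < K ^ J)%N by rewrite expn_gt0.
have ht := heads_take_le s 0 t; rewrite take0 add0n in ht.
have {}ht : (v %% K ^ J + heads (take t s) < K ^ J)%N.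
  by case/andP: ht => _ ht; apply: leq_ltn_trans vt; rewrite leq_add2l.
have bd : (v %/ K ^ J < K ^ d)%N by rewrite ltn_divLR // -expnD.
rewrite /pos -[in RHS]modnDml [in RHS](modn_small ht) -leaf_sub //.
rewrite addnA -divn_eq modn_small // expnD.
rewrite {1}(divn_eq v (K ^ J)) -addnA.
apply: (@leq_trans ((v %/ K ^ J).+1 * K ^ J)); last by rewrite leq_mul2r bd orbT.
by rewrite mulSn addnC ltn_add2r.
Qed.

Section OneObservable.
Variables (d J a : nat) (G : (nat -> R) -> R).
Hypotheses (Ga : depends_on a G) (G1 : forall x, `|G x| <= 1).
Notation N0 := (K ^ J)%N.
Notation N := (K ^ (d + J))%N.

(** The mean for a reader confined to one block of level J, read cyclically; it depends on w only
    modulo K^J, which is what equidistribution needs. *)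
Definition local_mean (w : nat) (s : seq bool) : R :=
  Exp (fun z : conf J => G (path w s z)).

Lemma Exp_norm_le j (f : conf j -> R) (c : R) : (forall y, `|f y| <= c) -> `|Exp f| <= c.
Proof.
move=> fc; rewrite ler_norml; apply/andP; split.
  rewrite -(ExpC th k_odd j (- c)); apply: le_Exp => // y.
  by have := fc y; rewrite ler_norml => /andP[].
rewrite -[leRHS](ExpC th k_odd j); apply: le_Exp => // y.
by have := fc y; rewrite ler_norml => /andP[].
Qed.

Lemma local_mean_le1 w s : `|local_mean w s| <= 1.
Proof. exact: Exp_norm_le. Qed.

Lemma local_mean_per w s : local_mean (w + N0) s = local_mean w s.
Proof. by apply: eq_Exp => z; apply: Ga => t _; rewrite path_per. Qed.

Lemma G_sub v s (y : conf (d + J)) : (v < N)%N -> ~~ (N0 < v %% N0 + a)%N ->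
  G (path v s y) = G (path v s (sub y (v %/ N0))).
Proof.
rewrite -leqNgt => vN va; apply: Ga => t ta; apply: path_sub => //.
by apply: leq_trans va; rewrite ltn_add2l.
Qed.

Definition mean : R := avg N (fun v => Ec a (local_mean v)).

(** Unless the start is within a of the end of a block of level J, the a steps stay in that block,
    whose law is given by [Exp_sub]. The exceptional starts have proportion at most a / K^J. *)
Lemma Em_mean : `|Em (d + J) a G - mean| <= 2 * (a%:R / N0%:R).
Proof.
have N00 : (0 < N0)%N by rewrite expn_gt0.
have -> : Em (d + J) a G = avg N (fun v => Ec a (fun s =>
  Exp (fun y : conf (d + J) => G (path v s y)))) by [].
rewrite /mean -avgB.
apply: (@le_trans _ _ (avg N (fun v => 2 * (N0 < v %% N0 + a)%N%:R))).
  apply: avg_norm_le => v vN; rewrite -EcB; apply: Ec_norm_le => s sa.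
  case: (boolP (N0 < v %% N0 + a)%N) => hv; last first.
    rewrite mulr0 normr_le0 subr_eq0; apply/eqP.
    rewrite -[RHS](Exp_sub th k_odd k5 d (v %/ N0)).
    by apply: eq_Exp => y; exact: G_sub.
  rewrite mulr1; apply: le_trans (ler_normB _ _) _.
  by rewrite -[2]/(1 + 1) lerD // ?local_mean_le1 // Exp_norm_le.
by rewrite avgZ ler_wpM2l // avg_overflowX.
Qed.

End OneObservable.

Section TwoObservables.
Variables (d J a b n : nat) (G H : (nat -> R) -> R).
Hypotheses (Ga : depends_on a G) (G1 : forall x, `|G x| <= 1).
Hypotheses (Hb : depends_on b H) (H1 : forall x, `|H x| <= 1).
Notation N0 := (K ^ J)%N.
Notation N := (K ^ (d + J))%N.
Hypotheses (an : (a <= n)%N) (nN : (n + N0 <= N)%N).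

Let hb (w : nat) : R := Ec b (local_mean J H w).

(** Counts three bad events: the first window may cross the end of a block of level J, the second
    may, or the reader moves so little that both windows may lie in one block. *)
Definition bad (v : nat) (s : seq bool) : R :=
  (N0 < v %% N0 + a)%N%:R + (N0 < (v + heads s) %% N0 + b)%N%:R + (heads s < N0)%N%:R.

Lemma bad_ge0 v s : 0 <= bad v s.
Proof. by rewrite !addr_ge0 ?ler0n. Qed.

Lemma N0_gt0 : (0 < N0)%N. Proof. by rewrite expn_gt0. Qed.

Lemma Exp_product v s s' : (v < N)%N -> size s = n -> size s' = b ->
  `|Exp (fun y : conf (d + J) => G (path v (s ++ s') y) *
        H (fun t => path v (s ++ s') y (n + t)%N)) -
    local_mean J G v (take a s) * local_mean J H (v + heads s) s'| <= 2 * bad v s.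
Proof.
move=> vN sn sb.
have HE (y : conf (d + J)) : H (fun t => path v (s ++ s') y (n + t)%N) =
    H (path ((v + heads s) %% N) s' y).
  apply: Hb => t tb; rewrite path_mod.
  by have := @path_cat R k (d + J) v s s' [::] y t; rewrite cats0 sn sb; apply.
have GE j (y : conf j) : G (path v (s ++ s') y) = G (path v (take a s) y).
  apply: Ga => t ta.
  have := @path_cat R k j v [::] (take a s) (drop a s ++ s') y t.
  rewrite /= catA cat_take_drop /heads /= addn0; apply.
  by rewrite size_takel // sn.
have [hbad|hgood] := boolP [|| N0 < v %% N0 + a, N0 < (v + heads s) %% N0 + b | heads s < N0]%N.
  apply: (@le_trans _ _ (2 * 1)); last first.
    rewrite ler_wpM2l // /bad -!natrD (ler_nat _ 1).
    by case/or3P: hbad => ->; rewrite ?addn1 // addn_gt0 ?addn_gt0 ?orbT.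
  rewrite mulr1; apply: le_trans (ler_normB _ _) _.
  rewrite -[2]/(1 + 1) lerD //.
    apply: Exp_norm_le => y; rewrite normrM -[leRHS]mulr1.
    by rewrite ler_pM ?normr_ge0.
  by rewrite normrM -[leRHS]mulr1 ler_pM ?normr_ge0 // local_mean_le1.
apply: le_trans (_ : 0 <= _); last by rewrite mulr_ge0 ?bad_ge0.
move: hgood; rewrite !negb_or => /and3P[g1 g2 g3].
rewrite normr_le0 subr_eq0; apply/eqP.
set v' := ((v + heads s) %% N)%N in HE.
have v'N : (v' < N)%N by rewrite ltn_pmod // expn_gt0.
have v'E : (v' %% N0 = (v + heads s) %% N0)%N.
  by rewrite /v' modn_dvdm // expnD dvdn_mull.
rewrite (@eq_Exp _ _ _ _ _ (fun y : conf (d + J) =>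
  G (path v (take a s) (sub y (v %/ N0))) * H (path v' s' (sub y (v' %/ N0))))); last first.
  move=> y; rewrite HE GE; congr (_ * _).
    by apply: (G_sub Ga).
  by apply: (G_sub Hb) => //; rewrite v'E.
have lt w : (w < N)%N -> (w %/ N0 < K ^ d)%N by rewrite ltn_divLR ?N0_gt0 // -expnD.
rewrite (Exp_sub2 th k_odd k5 (fun z => G (path v (take a s) z)) (fun z => H (path v' s' z))) ?lt //.
  congr (_ * _); apply: eq_Exp => z; apply: Hb => t _.
  by rewrite -path_mod v'E path_mod.
rewrite -leqNgt in g3.
have hn : (heads s <= n)%N by rewrite -sn count_size.
have [h|h] := ltnP (v + heads s) N.
  rewrite /v' modn_small // neq_ltn (leq_trans _ (leq_div2r N0 (leq_add (leqnn v) g3))) //.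
  by rewrite divnDr // divnn N0_gt0 addn1.
(* After wrapping around, the reader is still at least K^J short of its start, since n + K^J <= K^(d
   + J). *)
have -> : v' = (v + heads s - N)%N.
  rewrite /v' -{1}(subnK h) modnDr modn_small //; lia.
rewrite eq_sym neq_ltn (@leq_trans ((v + heads s - N + N0) %/ N0)) //.
  by rewrite divnDr // divnn N0_gt0 addn1.
by apply: leq_div2r; lia.
Qed.

(** Three errors: windows crossing the end of a block of level J (in the joint mean and again in the
    two separate means, hence the 4), fewer than K^J heads in n flips, and imperfect
    equidistribution of the reader modulo K^J. *)
Lemma Em_mixing :
  `|Em (d + J) (n + b) (fun x => G x * H (fun t => x (n + t)%N)) -
    Em (d + J) a G * Em (d + J) b H| <=
  4 * ((a + b)%:R / N0%:R) + 2 * (2 ^+ N0 * (3 / 4) ^+ n) +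
  2 * (1 - 2^-1 ^+ N0) ^+ ((n - a) %/ N0).
Proof.
set eps := _ ^+ ((n - a) %/ N0); set tail := 2 ^+ N0 * _.
pose A1 := avg N (fun v => Ec n (fun s => local_mean J G v (take a s) * hb (v + heads s))).
have hper w : hb (w + N0)%N = hb w by apply: eq_Ec => s _; exact: (local_mean_per J Hb).
have hb1 w : `|hb w| <= 1.
  by apply: Ec_norm_le => s _; exact: (local_mean_le1 J H1).
have S1 : `|Em (d + J) (n + b) (fun x => G x * H (fun t => x (n + t)%N)) - A1| <=
    2 * (a%:R / N0%:R + b%:R / N0%:R + tail).
  rewrite -[Em _ _ _]/(avg N (fun v => Ec (n + b) (fun s =>
    Exp (fun y : conf (d + J) => G (path v s y) * H (fun t => path v s y (n + t)%N))))).
  rewrite /A1 -avgB.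
  apply: (@le_trans _ _ (avg N (fun v => 2 * Ec n (bad v)))).
    apply: avg_norm_le => v vN; rewrite Ec_cat -EcB -EcZ.
    apply: Ec_norm => s sn; rewrite /hb -EcZ -EcB.
    by apply: Ec_norm_le => s' sb; exact: Exp_product.
  rewrite avgZ ler_wpM2l //.
  have -> : avg N (fun v => Ec n (bad v)) =
      avg N (fun v => (N0 < v %% N0 + a)%N%:R) +
      avg N (fun v => Ec n (fun s => (N0 < (v + heads s) %% N0 + b)%N%:R)) +
      avg N (fun v => Ec n (fun s => (heads s < N0)%N%:R)).
    rewrite -!avgD /avg; congr (_ / _); apply: eq_bigr => v _.
    by rewrite /bad !EcD EcC.
  apply: lerD; first apply: lerD.
  - exact: avg_overflowX.
  - apply: le_trans (avg_overflowX d J b).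
    rewrite le_eqVlt; apply/orP; left; apply/eqP.
    rewrite /avg -Ec_sum; congr (_ / _); rewrite -[RHS](EcC n); apply: eq_Ec => s _.
    apply: (@sum_shift R N (fun v => (N0 < v %% N0 + b)%N%:R)); first by rewrite expn_gt0.
    by move=> w; rewrite expnD [(w + _)%N]addnC modnMDl.
  - rewrite /avg avg_const; exact: heads_small.
(* The first factor uses the first a flips only; the n - a flips after them make the reader nearly
   uniform modulo K^J, wherever the first ones left it. *)
have S2 : `|A1 - mean d J a G * mean d J b H| <= 2 * eps.
  have -> : A1 = avg N (fun v => Ec a (fun s1 => local_mean J G v s1 *
      Ec (n - a) (fun s2 => hb (v + heads s1 + heads s2)%N))).
    rewrite /A1 /avg; congr (_ / _); apply: eq_bigr => v _.
    rewrite -{1}(subnKC an) Ec_cat; apply: eq_Ec => s1 s1a; rewrite -EcZ.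
    by apply: eq_Ec => s2 _; rewrite take_size_cat // /heads count_cat addnA.
  have mH : mean d J b H = havg N0 hb.
    by rewrite /mean expnD avg_periodic ?expn_gt0 // => w; exact: hper.
  rewrite mH mulrC -avgZ -avgB; apply: le_trans (avg_norm_le (g := fun _ => 2 * eps) _) _.
    move=> v vN; rewrite -EcZ -EcB; apply: Ec_norm_le => s1 s1a.
    rewrite [havg _ _ * _]mulrC -mulrBr normrM -[leRHS]mul1r.
    apply: ler_pM; rewrite ?normr_ge0 ?(local_mean_le1 J G1) //.
    exact: Ec_equidistribution N0_gt0 hper hb1.
  by rewrite /avg avg_const.
have GE := Em_mean d J Ga G1; have HE := Em_mean d J Hb H1.
have avg_le1 (f : nat -> R) : (forall v, `|f v| <= 1) -> `|avg N f| <= 1.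
  move=> f1; apply: le_trans (avg_norm_le (g := fun=> 1) _) _ => [v _|]; first exact: f1.
  by rewrite /avg avg_const.
have mG1 : `|mean d J a G| <= 1.
  by apply: avg_le1 => v; apply: Ec_norm_le => s _; exact: (local_mean_le1 J G1).
have EH1 : `|Em (d + J) b H| <= 1.
  apply: (avg_le1 (fun v => Ec b (fun s => Exp (fun y : conf (d + J) => H (path v s y))))).
  by move=> v; apply: Ec_norm_le => s _; exact: Exp_norm_le.
set X := Em _ _ _ in S1 *; set EG := Em _ a G in GE *; set EH := Em _ b H in HE EH1 *.
set mG := mean _ _ a G in S2 GE mG1; set mH := mean _ _ b H in S2 HE.
have -> : X - EG * EH = (X - A1) + (A1 - mG * mH) + (- mG * (EH - mH) + - EH * (EG - mG)) by ring.
have S3 : `|- mG * (EH - mH)| <= 2 * (b%:R / N0%:R).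
  by rewrite normrM normrN -[leRHS]mul1r ler_pM.
have S4 : `|- EH * (EG - mG)| <= 2 * (a%:R / N0%:R).
  by rewrite normrM normrN -[leRHS]mul1r ler_pM.
rewrite natrD mulrDl.
apply: le_trans (ler_normD _ _) _; have := ler_normD (X - A1) (A1 - mG * mH).
have := ler_normD (- mG * (EH - mH)) (- EH * (EG - mG)); lra.
Qed.

End TwoObservables.
End ModelMixing.

Section ModelFirstMoments.
Variables (R : rcfType) (k : nat).
Hypotheses (k_odd : odd k) (k5 : (5 <= k)%N).
Local Notation K := k.+1.
Local Notation Em := (@Em R k 1).

Lemma Em_prod2 j n t t' : (n <= K ^ j)%N -> (t < n)%N -> (t' < n)%N ->
  Em j n (fun x => x t * x t') = (t == t')%:R / 2.
Proof.
move=> nN tn t'n; have [<-|tt'] := eqVneq t t'.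
  have := @Em_indep R k k_odd k5 1 j n [:: t] (fun _ r => r * r) nN.
  under eq_Em do rewrite big_seq1.
  rewrite big_seq1 => -> //=; [by field|by rewrite tn|by rewrite orbC ltnS (leq_trans _ k5)].
have := @Em_indep R k k_odd k5 1 j n [:: t; t'] (fun _ r => r) nN.
under eq_Em do rewrite big_cons big_seq1.
rewrite big_cons big_seq1 => -> //=; first by field.
- by rewrite inE tt'.
- by rewrite tn t'n.
- by rewrite orbC ltnS (leq_trans _ k5).
Qed.

Lemma Em_mean1 j n t : (n <= K ^ j)%N -> (t < n)%N -> Em j n (fun x => x t) = 0.
Proof.
move=> nN tn; have := @Em_indep R k k_odd k5 1 j n [:: t] (fun _ r => r) nN.
under eq_Em do rewrite big_seq1.
rewrite big_seq1 => -> //=; [by field|by rewrite tn|by rewrite orbC ltnS (leq_trans _ k5)].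
Qed.

Lemma Em_xsum_mean j n : (n <= K ^ j)%N -> Em j n (xsum n) = 0.
Proof. by move=> nN; rewrite /xsum Em_sum big1 // => t _; exact: Em_mean1. Qed.

Lemma Em_xsum_sqr j n : (n <= K ^ j)%N -> Em j n (fun x => xsum n x ^+ 2) = n%:R / 2.
Proof.
move=> nN; under eq_Em => x do rewrite expr2 /xsum mulr_suml.
rewrite Em_sum (eq_bigr (fun _ => 2^-1)) => [|t _].
  by rewrite sumr_const card_ord -[LHS]mulr_natl.
under eq_Em => x do rewrite mulr_sumr.
rewrite Em_sum (bigD1 t) //= Em_prod2 // eqxx mul1r big1 ?addr0 // => t' tt'.
by rewrite Em_prod2 // eq_sym (inj_eq val_inj) (negbTE tt') mul0r.
Qed.

End ModelFirstMoments.

From mathcomp Require Import all_classical all_reals all_analysis.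
From mathcomp Require Import measurable_realfun normal_distribution.
Import numFieldTopology.Exports.
Local Open Scope classical_set_scope.
Local Open Scope ring_scope.

(** * Helly's theorem *)

Section UltraLimit.
Context {R : realType}.

(** The limit is the supremum of the x that lie below u n for U-almost all n. *)
Lemma ultra_limit (U : set_system nat) (u : nat -> R) (a b : R) : UltraFilter U ->
  (forall n, a <= u n <= b) ->
  exists l, forall e, 0 < e -> U [set n | `|u n - l| < e].
Proof.
move=> ultraU ub; pose S := [set x | U [set n | x <= u n]].
have Sa : S a by apply: filterS (filterT : U setT) => n _; case/andP: (ub n).
have Sb x : S x -> x <= b.
  by move=> /filter_ex[n] /= /le_trans; apply; case/andP: (ub n).
have hS : has_sup S by split; [exists a|exists b => x /Sb].
exists (sup S) => e e0.
have [x Sx xl] := sup_adherent e0 hS.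
have : ~ S (sup S + e / 2).
  move=> h; have := sup_upper_bound hS h; lra.
have [//|hc] := in_ultra_setVsetC [set n | sup S + e / 2 <= u n] ultraU.
move=> _; apply: filterS2 hc Sx => n /= /negP; rewrite -ltNge => un xn.
by rewrite ltr_norml; lra.
Qed.

Lemma ultra_infinite (Q : set nat) : infinite_set Q ->
  exists U : set_system nat, [/\ UltraFilter U, U Q & forall N, U [set n | (N <= n)%N]].
Proof.
move=> Qinf; pose F := [set A : set nat | \forall n \near \oo, Q n -> A n].
have FP : ProperFilter F.
  apply: Build_ProperFilter.
    move=> [N _ hN]; apply: Qinf; apply: (@sub_finite_set _ _ `I_N); last exact: finite_II.
    by move=> n Qn /=; rewrite ltnNge; apply/negP => /hN /(_ Qn).
  split.
  - exact: nearW.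
  - move=> A B [N _ hN] [M _ hM]; exists (maxn N M) => // n /=.
    by rewrite geq_max => /andP[Nn Mn] Qn; split; [exact: hN|exact: hM].
  - by move=> A B AB [N _ hN]; exists N => // n Nn Qn; apply: AB; exact: hN.
have [U [ultraU FU]] := ultraFilterLemma FP.
exists U; split => //.
  by apply: FU; exact: nearW.
by move=> N; apply: FU; exists N => // n Nn _.
Qed.

End UltraLimit.

Section Averaging.
Context {R : realType}.
Implicit Types (f g : R -> R) (I : (R -> R) -> R).

Definition bounded_measurable f :=
  measurable_fun setT f /\ exists C, forall x, `|f x| <= C.

(* The common features of the expectation of a function of a random variable in
   a finite model and in a probability space. *)
Definition averaging I := [/\
  forall a f g, bounded_measurable f -> bounded_measurable g ->
    I (fun x => a * f x + g x) = a * I f + I g,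
  forall f g, bounded_measurable f -> bounded_measurable g ->
    (forall x, f x <= g x) -> I f <= I g &
  I (fun=> 1) = 1].

Definition halfline (t x : R) : R := (x <= t)%R%:R.

Lemma bm_cst c : bounded_measurable (fun=> c).
Proof. by split; [exact: measurable_cst|exists `|c|]. Qed.

Lemma bm_halfline t : bounded_measurable (halfline t).
Proof.
split; last by exists 1 => x; rewrite /halfline ger0_norm ?ler0n // lern1 leq_b1.
have -> : halfline t = \1_(`]-oo, t]).
  by apply/funext => x; rewrite /halfline indicE mem_setE in_itv.
exact: measurable_indic.
Qed.

Lemma bm_lin a f g : bounded_measurable f -> bounded_measurable g ->
  bounded_measurable (fun x => a * f x + g x).
Proof.
move=> [mf [C fC]] [mg [D gD]]; split.
  by apply: measurable_funD => //; apply: measurable_funM.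
exists (`|a| * C + D) => x; apply: le_trans (ler_normD _ _) _.
by rewrite lerD // normrM ler_wpM2l.
Qed.

Lemma bm_continuous f : continuous f -> (exists C, forall x, `|f x| <= C) ->
  bounded_measurable f.
Proof. by move=> cf bf; split => //; exact: continuous_measurable_fun. Qed.

Lemma bm_sum n (F : 'I_n -> R -> R) : (forall i, bounded_measurable (F i)) ->
  bounded_measurable (fun x => \sum_i F i x).
Proof.
elim: n F => [|n IH] F bF.
  under eq_fun do rewrite big_ord0; exact: bm_cst.
under eq_fun do rewrite big_ord_recl -[F _ _]mul1r.
by apply: bm_lin => //; exact: (IH (fun i => F (lift ord0 i))).
Qed.

Section Theory.
Variable I : (R -> R) -> R.
Hypothesis avI : averaging I.

Lemma av_lin a f g : bounded_measurable f -> bounded_measurable g ->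
  I (fun x => a * f x + g x) = a * I f + I g.
Proof. by case: avI => + _ _; apply. Qed.

Lemma av_le f g : bounded_measurable f -> bounded_measurable g ->
  (forall x, f x <= g x) -> I f <= I g.
Proof. by case: avI => _ + _; apply. Qed.

Lemma av_cst c : I (fun=> c) = c.
Proof.
have [_ _ I1] := avI.
have I0 : I (fun=> 0) = 0.
  have -> : (fun=> 0) = (fun _ : R => -1 * 1 + 1) :> (R -> R).
    by apply/funext => x; rewrite mulr1 addNr.
  by rewrite (av_lin _ (bm_cst 1) (bm_cst 1)) I1 mulr1 addNr.
have -> : (fun=> c) = (fun _ : R => c * 1 + 0) :> (R -> R).
  by apply/funext => x; rewrite mulr1 addr0.
by rewrite (av_lin _ (bm_cst 1) (bm_cst 0)) I1 I0 mulr1 addr0.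
Qed.

Lemma avD f g : bounded_measurable f -> bounded_measurable g ->
  I (fun x => f x + g x) = I f + I g.
Proof.
move=> bf bg; have := av_lin 1 bf bg; rewrite mul1r => <-.
by congr I; apply/funext => x; rewrite mul1r.
Qed.

Lemma avZ c f : bounded_measurable f -> I (fun x => c * f x) = c * I f.
Proof.
move=> bf; have := av_lin c bf (bm_cst 0); rewrite av_cst addr0 => <-.
by congr I; apply/funext => x; rewrite addr0.
Qed.

Lemma avB f g : bounded_measurable f -> bounded_measurable g ->
  I (fun x => f x - g x) = I f - I g.
Proof.
move=> bf bg; have := av_lin (- 1) bg bf; rewrite mulN1r addrC => <-.
by congr I; apply/funext => x; rewrite mulN1r addrC.
Qed.

Lemma av_sum n (F : 'I_n -> R -> R) : (forall i, bounded_measurable (F i)) ->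
  I (fun x => \sum_i F i x) = \sum_i I (F i).
Proof.
elim: n F => [|n IH] F bF.
  by rewrite big_ord0 -[RHS](av_cst 0); congr I; apply/funext => x; rewrite big_ord0.
rewrite big_ord_recl -(IH (fun i => F (lift ord0 i))) // -avD //.
  by congr I; apply/funext => x; rewrite big_ord_recl.
exact: bm_sum.
Qed.

Lemma av_norm_le f g : bounded_measurable f -> bounded_measurable g ->
  (forall x, `|f x| <= g x) -> `|I f| <= I g.
Proof.
move=> bf bg fg; rewrite ler_norml; apply/andP; split.
  rewrite -mulN1r -avZ //; apply: av_le => //.
    by have := bm_lin (- 1) bg (bm_cst 0); under eq_fun do rewrite addr0.
  by move=> x; rewrite mulN1r; have := fg x; rewrite ler_norml => /andP[].
by apply: av_le => // x; have := fg x; rewrite ler_norml => /andP[].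
Qed.

Definition avcdf t := I (halfline t).

Lemma avcdf_bound t : 0 <= avcdf t <= 1.
Proof.
apply/andP; split.
  by rewrite -(av_cst 0); apply: av_le (bm_cst _) (bm_halfline _) _ => x; exact: ler0n.
rewrite -(av_cst 1); apply: av_le (bm_halfline _) (bm_cst _) _ => x.
by rewrite /halfline lern1 leq_b1.
Qed.

Lemma avcdf_nd s t : s <= t -> avcdf s <= avcdf t.
Proof.
move=> st; apply: av_le; [exact: bm_halfline|exact: bm_halfline|move=> x].
rewrite /halfline ler_nat; case: (leP x s) => //= xs.
by rewrite (le_trans xs st).
Qed.

End Theory.
End Averaging.

Section Selection.
Context {R : realType}.

(** Three natural parameters make the points countable through [pickle]; for fixed a and p,
    increasing b gives a partition of mesh 1 / (p + 1) starting at -a. *)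
Definition grid (a b p : nat) : R := b%:R / p.+1%:R - a%:R.

Variables (I : nat -> (R -> R) -> R) (Q : set nat).
Hypotheses (avI : forall n, averaging (I n)) (Qinf : infinite_set Q).
Hypothesis tight : forall e, 0 < e -> exists M : nat, forall n, Q n ->
  1 - e <= avcdf (I n) M%:R - avcdf (I n) (- M%:R).

(* A pointwise limit of the distribution functions along an ultrafilter is a limit
   on a countable set of points along a genuine subsequence. *)
Lemma helly_selection : exists (Tset : set nat) (G : R -> R),
  [/\ Tset `<=` Q, infinite_set Tset, {homo G : s t / s <= t},
      (forall t, 0 <= G t <= 1) &
      (forall e, 0 < e -> exists M : nat, 1 - e <= G M%:R - G (- M%:R)) /\
      (forall a b p e, 0 < e -> exists N, forall n, (N <= n)%N -> Tset n ->
        `|avcdf (I n) (grid a b p) - G (grid a b p)| < e)].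
Proof.
have [U [ultraU UQ UN]] := ultra_infinite Qinf.
have /boolp.choice[G GU] t : exists l, forall e, 0 < e ->
    U [set n | `|avcdf (I n) t - l| < e].
  by apply: (@ultra_limit _ _ _ 0 1) => n; exact: avcdf_bound.
have PU : ProperFilter U := @ultra_proper _ _ ultraU.
have UI (A B : set nat) : U A -> U B -> exists n, A n /\ B n.
  by move=> UA UB; have [n [An Bn]] := filter_ex (filterI UA UB); exists n.
have Gnd s t : s <= t -> G s <= G t.
  move=> st; rewrite leNgt; apply/negP => h.
  have e0 : 0 < (G s - G t) / 2 by lra.
  have [n /= [h1 h2]] := UI _ _ (GU s _ e0) (GU t _ e0).
  have := avcdf_nd (avI n) st; move: h1 h2; rewrite !ltr_norml; lra.
have G01 t : 0 <= G t <= 1.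
  apply/andP; split; rewrite leNgt; apply/negP => h.
    have e0 : 0 < - G t by lra.
    have [n /= [h1 _]] := UI _ _ (GU t _ e0) UQ.
    have := avcdf_bound (avI n) t; move: h1; rewrite ltr_norml; lra.
  have e0 : 0 < G t - 1 by lra.
  have [n /= [h1 _]] := UI _ _ (GU t _ e0) UQ.
  have := avcdf_bound (avI n) t; move: h1; rewrite ltr_norml; lra.
pose r k : R := oapp (fun t : nat * nat * nat => grid t.1.1 t.1.2 t.2) 0 (unpickle k).
have GK K e : 0 < e -> U [set n | forall i, (i < K)%N -> `|avcdf (I n) (r i) - G (r i)| < e].
  move=> e0; elim: K => [|K IH]; first by apply: filterS (filterT : U setT).
  apply: filterS2 IH (GU (r K) _ e0) => n h1 h2 i.
  by rewrite ltnS leq_eqVlt => /orP[/eqP -> //|]; exact: h1.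
have : forall K, exists n, [/\ Q n, (K <= n)%N &
    forall i, (i < K)%N -> `|avcdf (I n) (r i) - G (r i)| < K.+1%:R^-1].
  move=> K; have K0 : 0 < K.+1%:R^-1 :> R by rewrite invr_gt0.
  have [n [[? ?] ?]] := UI _ _ (filterI UQ (UN K)) (GK K _ K0).
  by exists n.
move=> /boolp.choice[sel selP].
(* [sel] need not be increasing. Its range is infinite because K <= sel K, and a member of the range
   that exceeds all early values of [sel] has a large index. *)
exists (range sel), G; split => //.
- by move=> _ [K _ <-]; case: (selP K).
- move=> /finite_fsetP[X XE]; pose K := (\max_(x <- finmap.enum_fset X) x).+1.
  have [_ Kn _] := selP K.
  have : range sel (sel K) by exists K.
  rewrite XE /= => sX; move: Kn; rewrite ltnNge.
  by rewrite (leq_bigmax_seq (F := id)).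
- split.
  + move=> e e0; have e20 : 0 < e / 2 by lra.
    have e40 : 0 < e / 4 by lra.
    have [M hM] := tight e20; exists M.
    have [n [[/= h1 h2] /hM h3]] := UI _ _ (filterI (GU M%:R _ e40) (GU (- M%:R) _ e40)) UQ.
    by move: h1 h2; rewrite !ltr_norml; lra.
  + move=> a b p e e0.
    pose i := pickle (a, b, p).
    have ri : r i = grid a b p by rewrite /r /i pickleK.
    have [K0 hK0] : exists K, K.+1%:R^-1 < e.
      exists (Num.bound e^-1); rewrite invf_plt ?posrE //.
      have ei0 : 0 <= e^-1 by rewrite invr_ge0 ltW.
      by apply: lt_le_trans (archi_boundP ei0) _; rewrite ler_nat.
    exists (\max_(j < (maxn K0 i).+1) (sel j)).+1 => n hn [K _ Kn].
    have KK : (maxn K0 i < K)%N.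
      rewrite ltnNge; apply/negP => hK; move: hn; rewrite -Kn ltnNge.
      by rewrite (leq_bigmax (Ordinal (hK : (K < (maxn K0 i).+1)%N))).
    move: KK; rewrite gtn_max => /andP[K0K iK].
    have [_ _ /(_ i iK)] := selP K; rewrite ri Kn => h.
    apply: lt_trans h _; apply: le_lt_trans hK0.
    by rewrite lef_pV2 ?posrE ?ltr0n // ler_nat ltnS ltnW.
Qed.

End Selection.

Section Regularization.
Context {R : realType} (G : R -> R).
Hypotheses (Gnd : {homo G : s t / s <= t}) (G01 : forall t, 0 <= G t <= 1).
Hypothesis Gtight : forall e, 0 < e -> exists M : nat, 1 - e <= G M%:R - G (- M%:R).

Let F (t : R) : R := inf [set G s | s in [set s | t < s]].

Let has_inf_G t : has_inf [set G s | s in [set s | t < s]].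
Proof.
split; first by exists (G (t + 1)), (t + 1) => //=; rewrite ltrDl.
by exists 0 => _ [s _ <-]; case/andP: (G01 s).
Qed.

Let F_le t s : t < s -> F t <= G s.
Proof. by move=> ts; apply: ge_inf; [case: (has_inf_G t)|exists s]. Qed.

Let F_ge t : G t <= F t.
Proof.
apply: lb_le_inf; first by case: (has_inf_G t).
by move=> _ [s /= ts <-]; apply: Gnd; exact: ltW.
Qed.

Let F_nd : nondecreasing F.
Proof.
move=> s t st; apply: lb_le_inf; first by case: (has_inf_G t).
by move=> _ [r /= tr <-]; apply: F_le; exact: le_lt_trans tr.
Qed.

Let F_rc : right_continuous F.
Proof.
move=> t; apply/cvgrPdist_lt => e e0.
have [_ [s /= ts <-] hs] := inf_adherent e0 (has_inf_G t).
near=> r; have tr : t <= r by apply: ltW; near: r; exact: nbhs_right_gt.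
have rs : r < s by near: r; exact: nbhs_right_lt.
have := F_nd tr; have := F_le rs; rewrite distrC ger0_norm ?subr_ge0 ?F_nd //.
move=> h1 h2; move: hs; rewrite -/(F t); lra.
Unshelve. all: by end_near. Qed.

#[local] HB.instance Definition _ := isCumulative.Build R _ R F F_nd F_rc.

Let F_Ny : F @ -oo --> (0 : R).
Proof.
apply/cvgrPdist_lt => e e0; have e20 : 0 < e / 2 by lra.
have [M hM] := Gtight e20.
near=> r; have rM : r < - M%:R by near: r; exact: nbhs_ninfty_lt.
have := F_le rM; have := F_ge r; have := G01 r; have := G01 M%:R.
by rewrite ltr_norml; lra.
Unshelve. all: by end_near. Qed.

Let F_y : F @ +oo --> (1 : R).
Proof.
apply/cvgrPdist_lt => e e0; have e20 : 0 < e / 2 by lra.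
have [M hM] := Gtight e20.
near=> r; have rM : M%:R <= r by near: r; exact: nbhs_pinfty_ge.
have := Gnd rM; have := F_ge r; have := G01 (- M%:R); have := G01 (r + 1).
have : F r <= G (r + 1) by apply: F_le; rewrite ltrDl.
by rewrite ltr_norml; lra.
Unshelve. all: by end_near. Qed.

#[local] HB.instance Definition _ := isCumulativeBounded.Build R 0 1 F F_Ny F_y.

(** The identity carries the Stieltjes measure from [measurableTypeR R] to the measurable structure
    of R in the statement. *)
Let idTR : measurableTypeR R -> R := idfun.

#[local] HB.instance Definition _ :=
  @isMeasurableFun.Build _ _ _ _ idTR (@measurable_id _ _ setT).

(** A limit G of distribution functions need not be right continuous, so H is its right limit, an
    infimum over s > t. The two inequalities let [helly] pass between H and G. *)
Lemma cdf_regularization : exists (mu : probability R R) (H : R -> R),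
  [/\ forall t, mu `]-oo, t]%classic = (H t)%:E, forall t, G t <= H t &
      forall t s, t < s -> H t <= G s].
Proof.
exists (distribution (lebesgue_stieltjes_measure F) (idTR : {RV (lebesgue_stieltjes_measure F) >-> R})), F.
split => // t; exact: cdf_lebesgue_stieltjes_id.
Qed.

End Regularization.

Section Riemann.
Context {R : realType}.
Implicit Types (f : R -> R) (t : nat -> R).

Lemma Abel_sum m (a b : nat -> R) :
  \sum_(i < m) a i * (b i.+1 - b i) =
  \sum_(i < m) (a i - a i.+1) * b i.+1 + (a m * b m - a 0%N * b 0%N).
Proof.
elim: m => [|m IH]; first by rewrite !big_ord0 subrr addr0.
by rewrite !big_ord_recr /= IH; ring.
Qed.

Lemma telescope m (b : nat -> R) : \sum_(i < m) (b i.+1 - b i) = b m - b 0%N.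
Proof.
elim: m => [|m IH]; first by rewrite big_ord0 subrr.
by rewrite big_ord_recr /= IH; ring.
Qed.

(** The step function has the value of f at t i on ]t i, t (i+1)] and vanishes off ]t 0, t m], where
    the error is at most C. *)
Lemma step_approx_pointwise f t m C e x : (forall y, `|f y| <= C) -> 0 <= e ->
  (forall i, t i <= t i.+1) ->
  (forall i, (i < m)%N -> t i < x -> x <= t i.+1 -> `|f x - f (t i)| <= e) ->
  `|f x - \sum_(i < m) f (t i) * (halfline (t i.+1) x - halfline (t i) x)| <=
  e + C * (1 - halfline (t m) x + halfline (t 0%N) x).
Proof.
move=> fC e0 tnd osc.
have C0 : 0 <= C := le_trans (normr_ge0 _) (fC 0).
pose g n := \sum_(i < n) f (t i) * (halfline (t i.+1) x - halfline (t i) x).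
have tmono n : t 0%N <= t n by elim: n => // n IH; exact: le_trans (tnd n).
have key n : (n <= m)%N -> [/\ x <= t 0%N -> g n = 0, t n < x -> g n = 0 &
    t 0%N < x -> x <= t n -> `|f x - g n| <= e].
  elim: n => [|n IH] nm.
    by rewrite /g big_ord0; split => // h1 h2; lra.
  have [g1 g2 g3] := IH (ltnW nm).
  have tn := tnd n.
  split; rewrite /g big_ord_recr /= -/(g n).
  - move=> h; rewrite g1 // /halfline !(le_trans h) ?tmono // subrr mulr0 addr0 //.
  - move=> h; rewrite g2 ?(le_lt_trans tn) // /halfline.
    by rewrite !leNgt h (le_lt_trans tn h) /= subrr mulr0 addr0.
  - move=> h1 h2; rewrite /halfline h2; have [h3|h3] := leP x (t n).
      by rewrite subrr mulr0 addr0; exact: g3.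
    by rewrite g2 // add0r subr0 mulr1; exact: osc.
have [g1 g2 g3] := key m (leqnn m).
rewrite -/(g m); have [h0|h0] := leP x (t 0%N).
  rewrite g1 // subr0 /halfline h0 (le_trans h0 (tmono m)) subrr add0r mulr1.
  by have := fC x; lra.
have [hm|hm] := leP x (t m).
  by rewrite (le_trans (g3 h0 hm)) ?lerDl ?mulr_ge0 // /halfline hm subrr add0r ler0n.
rewrite g2 // subr0 /halfline !leNgt hm h0 /= subr0 addr0 mulr1.
by have := fC x; lra.
Qed.

Lemma step_approx (I : (R -> R) -> R) f t m C e : averaging I -> bounded_measurable f ->
  (forall y, `|f y| <= C) -> 0 <= e -> (forall i, t i <= t i.+1) ->
  (forall i x, (i < m)%N -> t i < x -> x <= t i.+1 -> `|f x - f (t i)| <= e) ->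
  `|I f - \sum_(i < m) f (t i) * (avcdf I (t i.+1) - avcdf I (t i))| <=
  e + C * (1 - avcdf I (t m) + avcdf I (t 0%N)).
Proof.
move=> avI bf fC e0 tnd osc.
have bD i : bounded_measurable (fun x => halfline (t i.+1) x - halfline (t i) x).
  have := bm_lin (- 1) (bm_halfline (t i)) (bm_halfline (t i.+1)).
  by congr bounded_measurable; apply/funext => x; rewrite mulN1r addrC.
have bF (i : 'I_m) :
    bounded_measurable (fun x => f (t i) * (halfline (t i.+1) x - halfline (t i) x)).
  have := bm_lin (f (t i)) (bD i) (bm_cst 0).
  by congr bounded_measurable; apply/funext => x; rewrite addr0.
have -> : \sum_(i < m) f (t i) * (avcdf I (t i.+1) - avcdf I (t i)) =
    I (fun x => \sum_(i < m) f (t i) * (halfline (t i.+1) x - halfline (t i) x)).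
  rewrite av_sum //; apply: eq_bigr => i _; rewrite avZ ?avB //.
  - exact: bm_halfline.
  - exact: bm_halfline.
rewrite -avB //; last exact: bm_sum.
pose g0 x : R := C * (1 - halfline (t m) x + halfline (t 0%N) x) + e.
have b1 : bounded_measurable (fun x => 1 - halfline (t m) x).
  have := bm_lin (- 1) (bm_halfline (t m)) (bm_cst 1).
  by congr bounded_measurable; apply/funext => x; rewrite mulN1r addrC.
have b2 : bounded_measurable (fun x => 1 - halfline (t m) x + halfline (t 0%N) x).
  have := bm_lin 1 b1 (bm_halfline (t 0%N)).
  by congr bounded_measurable; apply/funext => x; rewrite mul1r.
have bg : bounded_measurable g0 by apply: bm_lin => //; exact: bm_cst.
have -> : e + C * (1 - avcdf I (t m) + avcdf I (t 0%N)) = I g0.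
  have E1 : I (fun x => 1 - halfline (t m) x) = 1 - avcdf I (t m).
    by rewrite (avB avI (bm_cst 1) (bm_halfline _)) av_cst.
  rewrite [LHS]addrC /g0 (av_lin avI _ b2 (bm_cst e)) av_cst //.
  by rewrite (avD avI b1 (bm_halfline _)) E1.
apply: av_norm_le => //.
  have := bm_lin (- 1) (bm_sum bF) bf.
  by congr bounded_measurable; apply/funext => x; rewrite mulN1r addrC.
move=> x; rewrite /g0 [X in _ <= X]addrC; apply: step_approx_pointwise => //.
by move=> i im; exact: osc.
Qed.

(** A sequence of counterexamples would have a limit along an ultrafilter, and f could not be
    continuous there. *)
Lemma uniform_continuity_segment f (a b e : R) : continuous f -> 0 < e ->
  exists p : nat, forall x y, a <= x <= b -> a <= y <= b ->
    `|x - y| <= p.+1%:R^-1 -> `|f x - f y| <= e.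
Proof.
move=> cf e0; apply: contrapT => /forallNP h.
have /boolp.choice[xy xyP] p : exists xy : R * R, [/\ a <= xy.1 <= b, a <= xy.2 <= b,
    `|xy.1 - xy.2| <= p.+1%:R^-1 & e < `|f xy.1 - f xy.2|].
  have /existsNP[x /existsNP[y]] := h p.
  move=> /not_implyP[h1 /not_implyP[h2 /not_implyP[h3 /negP h4]]].
  by exists (x, y); split => //=; rewrite ltNge.
have [U [ultraU _ UN]] := ultra_infinite infinite_nat.
have PU : ProperFilter U := @ultra_proper _ _ ultraU.
have [l hl] := @ultra_limit R U (fun n => (xy n).1) a b ultraU
  (fun n => let: And4 h1 _ _ _ := xyP n in h1).
have e20 : 0 < e / 2 by lra.
have /cvgrPdist_lt/(_ _ e20)/nbhs_ballP[d /= d0 hd] := cf l.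
have d20 : 0 < d / 2 by lra.
have [N hN] : exists N : nat, N.+1%:R^-1 < d / 2.
  exists (Num.bound (d / 2)^-1); rewrite invf_plt ?posrE //.
  have d20' : 0 <= (d / 2)^-1 by rewrite invr_ge0 ltW.
  by apply: lt_le_trans (archi_boundP d20') _; rewrite ler_nat.
have [n [/= h1 h2]] := filter_ex (filterI (hl _ d20) (UN N)).
have [_ _ h3 h4] := xyP n.
have n1 : n.+1%:R^-1 <= N.+1%:R^-1 :> R by rewrite lef_pV2 ?posrE ?ltr0n // ler_nat.
have b1 : `|f l - f (xy n).1| < e / 2.
  apply: hd; rewrite /ball /= distrC; lra.
have b2 : `|f l - f (xy n).2| < e / 2.
  apply: hd; rewrite /ball /=.
  have {}h3 : `|(xy n).1 - (xy n).2| < d / 2 by apply: le_lt_trans h3 (le_lt_trans n1 hN).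
  by move: h1 h3; rewrite !ltr_norml; lra.
move: h4; have := ler_distD (f l) (f (xy n).1) (f (xy n).2).
rewrite (distrC (f (xy n).1) (f l)); lra.
Qed.

End Riemann.

Section Helly.
Context {R : realType}.

Lemma bounded_integrable d (T : measurableType d) (P : probability T R) (g : T -> R) (C : R) :
  measurable_fun setT g -> (forall w, `|g w| <= C) -> P.-integrable setT (EFin \o g).
Proof.
move=> mg gC; apply: measurable_bounded_integrable => //.
  by rewrite (le_lt_trans (probability_le1 _ _)) ?ltry.
by exists C; split; [exact: num_real|move=> M CM w _; exact: le_trans (gC w) (ltW CM)].
Qed.

Lemma Rintegral_cst_probability d (T : measurableType d) (P : probability T R) (c : R) :
  \int[P]_w c = c.
Proof.
rewrite Rintegral_cst // -[RHS]mulr1; congr (_ * _).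
by rewrite -[RHS]/(fine 1%E); congr fine; exact: probability_setT.
Qed.

Lemma averaging_integral d (T : measurableType d) (P : probability T R) (Y : T -> R) :
  measurable_fun setT Y -> averaging (fun f => \int[P]_w f (Y w)).
Proof.
move=> mY.
have int f : bounded_measurable f -> P.-integrable setT (EFin \o (f \o Y)).
  move=> [mf [C fC]]; apply: (@bounded_integrable _ _ _ _ C) => [|w].
    exact: measurableT_comp.
  exact: fC.
split.
- move=> a f g bf bg.
  rewrite RintegralD //; last exact: int.
    by rewrite RintegralZl //; exact: int.
  have := int _ (bm_lin a bf (bm_cst 0)).
  by apply: eq_integrable => // w _ /=; rewrite addr0.
- by move=> f g bf bg fg; apply: le_Rintegral => //; exact: int.
- exact: Rintegral_cst_probability.
Qed.

Lemma avcdf_integral (mu : probability R R) t :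
  avcdf (fun f => \int[mu]_x f x) t = fine (mu `]-oo, t]%classic).
Proof.
rewrite /avcdf /Rintegral; congr fine.
rewrite -[`]-oo, t]%classic]setIT -integral_indic //; apply: eq_integral => x _.
by rewrite /halfline indicE mem_setE in_itv.
Qed.

Variables (I : nat -> (R -> R) -> R) (Q : set nat).
Hypotheses (avI : forall n, averaging (I n)) (Qinf : infinite_set Q).
Hypothesis tight : forall e, 0 < e -> exists M : nat, forall n, Q n ->
  1 - e <= avcdf (I n) M%:R - avcdf (I n) (- M%:R).

Theorem helly : exists (Tset : set nat) (mu : probability R R),
  [/\ Tset `<=` Q, infinite_set Tset &
   forall f : R -> R, continuous f -> (exists C, forall x, `|f x| <= C) ->
   forall e, 0 < e -> exists N, forall n, (N <= n)%N -> Tset n ->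
     `|I n f - \int[mu]_x f x| < e].
Proof.
have [Tset [G [TQ Tinf Gnd G01 [Gt GT]]]] := helly_selection avI Qinf tight.
have [mu [H [muH GH HG]]] := cdf_regularization Gnd G01 Gt.
exists Tset, mu; split => // f cf [C0 fC0] e e0.
pose C := `|C0|.
have fC x : `|f x| <= C by rewrite (le_trans (fC0 x)) // ler_norm.
have Cge0 : 0 <= C by exact: normr_ge0.
have bf : bounded_measurable f by apply: bm_continuous => //; exists C.
(* The errors S1 to S4 below add up to 3 e1 + 8 C e1, which is less than 8 (C + 1) e1 = e. *)
pose e1 := e / (8 * (C + 1)).
have C1 : 0 < C + 1 by lra.
have e10 : 0 < e1 by rewrite divr_gt0 // mulr_gt0.
have e1C : e1 * (C + 1) = e / 8 by rewrite /e1; field; rewrite gt_eqF.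
have [M1 hM1] := tight e10; have [M2 hM2] := Gt _ e10.
(* The extra unit gives -M < -M2, a strict inequality as [HG] asks for. *)
pose M := (maxn M1 M2).+1.
have M1M : M1%:R <= M%:R :> R by rewrite ler_nat ltnW // ltnS leq_maxl.
have M2M : M2%:R <= M%:R - 1 :> R by rewrite lerBrDr natr1 ler_nat ltnS leq_maxr.
have [p hp] := uniform_continuity_segment (- M%:R) (M%:R + 1) cf e10.
pose t i : R := grid M i p.
have p0 : 0 < p.+1%:R :> R by rewrite ltr0n.
have tS i : t i.+1 = t i + p.+1%:R^-1 by rewrite /t /grid -[i.+1%:R]natr1 mulrDl mul1r; ring.
have p1 : p.+1%:R^-1 <= 1 :> R by rewrite invf_le1 // ler1n.
have pi0 : 0 < p.+1%:R^-1 :> R by rewrite invr_gt0.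
have tnd i : t i <= t i.+1 by rewrite tS lerDl ltW.
have tmono i j : (i <= j)%N -> t i <= t j.
  by move=> ij; rewrite /t /grid lerD2r ler_pM2r // ler_nat.
pose m := (2 * M * p.+1)%N.
have t0 : t 0%N = - M%:R by rewrite /t /grid mul0r add0r.
have tm : t m = M%:R.
  by rewrite /t /grid /m natrM mulfK ?gt_eqF // natrM; ring.
have osc i x : (i < m)%N -> t i <= x -> x <= t i.+1 -> `|f x - f (t i)| <= e1.
  move=> im h1 h2; have := tmono _ _ (leq0n i); have := tmono _ _ im.
  by rewrite t0 tm => h4 h3; apply: hp; rewrite ?ler_norml; move: h2 h4 pi0 p1; rewrite tS; move: (p.+1%:R^-1) => q *; lra.
have osc' i x : (i < m)%N -> t i < x -> x <= t i.+1 -> `|f x - f (t i)| <= e1.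
  by move=> im /ltW; exact: osc.
pose muI (g : R -> R) := \int[mu]_x g x.
have avmu : averaging muI by apply: averaging_integral; exact: measurable_id.
have cdfmu s : avcdf muI s = H s by rewrite avcdf_integral muH.
pose Fn n i := avcdf (I n) (t i).
pose dG := \sum_(i < m) f (t i) * (G (t i.+1) - G (t i)).
have S2 : `|muI f - \sum_(i < m) f (t i) * (H (t i.+1) - H (t i))| <= e1 + C * (e1 + e1).
  have := @step_approx R muI f t m C e1 avmu bf fC (ltW e10) tnd osc'.
  under eq_bigr do rewrite !cdfmu.
  move=> h; apply: le_trans h _; rewrite !cdfmu lerD2l ler_wpM2l // t0 tm.
  have := GH M%:R; have : H (- M%:R) <= G (- M2%:R) by apply: HG; lra.
  have : G M2%:R <= G M%:R by apply: Gnd; lra.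
  have := G01 (- M2%:R); have := G01 M2%:R; lra.
(* H and G may differ at grid points where G jumps. Summation by parts moves the difference onto the
   increments of f, at most e1 each; the differences H - G are bounded by increments of G, which
   telescope to at most 1. *)
have S4 : `|\sum_(i < m) f (t i) * (H (t i.+1) - H (t i)) - dG| <= e1 + C * (e1 + e1).
  pose b i := H (t i) - G (t i).
  have b0 i : 0 <= b i by rewrite subr_ge0.
  have -> : \sum_(i < m) f (t i) * (H (t i.+1) - H (t i)) - dG =
      \sum_(i < m) f (t i) * (b i.+1 - b i).
    by rewrite /dG -sumrB; apply: eq_bigr => i _; rewrite /b; ring.
  rewrite (Abel_sum m (fun i => f (t i)) b); apply: le_trans (ler_normD _ _) _.
  apply: lerD.
    apply: le_trans (ler_norm_sum _ _ _) _.
    apply: (@le_trans _ _ (\sum_(i < m) e1 * (G (t i.+2) - G (t i.+1)))).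
      apply: ler_sum => i _; rewrite normrM [`|b _|]ger0_norm //.
      apply: ler_pM => //; first by rewrite distrC osc // tnd.
      by rewrite lerD2r HG // [t i.+2]tS ltrDl.
    rewrite -mulr_sumr (telescope m (fun i => G (t i.+1))) -[leRHS]mulr1.
    apply: ler_wpM2l; first exact: ltW.
    rewrite /=; have := G01 (t m.+1); have := G01 (t 1%N); lra.
  have Hm : b m <= e1.
    rewrite /b tm.
    have : H M%:R <= G (M%:R + 1) by apply: HG; lra.
    have : G M2%:R <= G M%:R by apply: Gnd; lra.
    have := G01 (M%:R + 1); have := G01 (- M2%:R); lra.
  have H0 : b 0%N <= e1.
    rewrite /b t0.
    have : H (- M%:R) <= G (- M2%:R) by apply: HG; lra.
    have := G01 (- M%:R); have := G01 M2%:R; lra.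
  have B i : b i <= e1 -> `|f (t i) * b i| <= C * e1.
    by move=> bi; rewrite normrM [`|b i|]ger0_norm // ler_pM.
  rewrite [leRHS]mulrDr; apply: le_trans (ler_normB _ _) _.
  exact: lerD (B _ Hm) (B _ H0).
(* Each of the m terms in S3 contributes an error of at most 2 C eta. *)
pose eta := e1 / m.+1%:R.
have m0 : 0 < m.+1%:R :> R by rewrite ltr0n.
have eta0 : 0 < eta by rewrite divr_gt0.
have /boolp.choice[N NP] i := GT M i p eta eta0.
exists (\max_(i < m.+1) N i) => n hn Tn.
have close i : (i <= m)%N -> `|Fn n i - G (t i)| < eta.
  move=> im; apply: NP => //; apply: leq_trans hn.
  exact: (leq_bigmax (Ordinal (im : (i < m.+1)%N))).
have S1 : `|I n f - \sum_(i < m) f (t i) * (Fn n i.+1 - Fn n i)| <= e1 + C * (e1 + e1).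
  have := @step_approx R (I n) f t m C e1 (avI n) bf fC (ltW e10) tnd osc'.
  move=> h; apply: le_trans h _; rewrite lerD2l ler_wpM2l // t0 tm.
  have := hM1 n (TQ n Tn).
  have : avcdf (I n) (- M%:R) <= avcdf (I n) (- M1%:R) by apply: avcdf_nd; rewrite // lerN2.
  have : avcdf (I n) M1%:R <= avcdf (I n) M%:R by apply: avcdf_nd.
  lra.
have S3 : `|\sum_(i < m) f (t i) * (Fn n i.+1 - Fn n i) - dG| <= C * (e1 + e1).
  rewrite /dG -sumrB; apply: le_trans (ler_norm_sum _ _ _) _.
  apply: (@le_trans _ _ (\sum_(i < m) C * (eta + eta))).
    apply: ler_sum => i _; rewrite -mulrBr normrM ler_pM //.
    have -> : Fn n i.+1 - Fn n i - (G (t i.+1) - G (t i)) =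
      (Fn n i.+1 - G (t i.+1)) - (Fn n i - G (t i)) by ring.
    apply: le_trans (ler_normB _ _) _; apply: lerD; apply: ltW; apply: close => //.
    exact: ltnW.
  rewrite sumr_const card_ord -mulrnAr; apply: ler_wpM2l => //; rewrite mulrnDl.
  have : eta *+ m <= e1.
    rewrite -mulr_natr /eta mulrAC -mulrA ger_pMr // ler_pdivrMr // mul1r ler_nat //.
  by move=> h; apply: lerD.
have -> : I n f - muI f =
  (I n f - \sum_(i < m) f (t i) * (Fn n i.+1 - Fn n i)) +
  (\sum_(i < m) f (t i) * (Fn n i.+1 - Fn n i) - dG) -
  (\sum_(i < m) f (t i) * (H (t i.+1) - H (t i)) - dG) -
  (muI f - \sum_(i < m) f (t i) * (H (t i.+1) - H (t i))) by ring.
move: S1 S2 S3 S4; set x1 := (I n f - _); set x2 := (muI f - _).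
set x3 := _ - dG; set x4 := _ - dG; move=> S1 S2 S3 S4.
have tri : `|x1 + x3 - x4 - x2| <= `|x1| + `|x3| + `|x4| + `|x2|.
  have := ler_normB (x1 + x3 - x4) x2; have := ler_normB (x1 + x3) x4.
  by have := ler_normD x1 x3; lra.
apply: le_lt_trans tri _.
have : e1 * C = e / 8 - e1 by lra.
nra.
Qed.

End Helly.

(** * Coding paths by real numbers *)

Section Digits.
Context {R : realType}.
Implicit Types (e : nat -> R) (w : R).

Fixpoint code n e : R :=
  if n is n'.+1 then (e 0%N + code n' (fun i => e i.+1)) / 8 else 0.

Definition clamp (u : R) : R := Num.min 1 (Num.max 0 u).
(** Equal to 0 up to 1/2, to 1 on [1, 3/2] and to 2 from 2 on. In base 8 with digits at most 2 the
    remainder after a digit is at most 2/7 < 1/2, so this rounds correctly and is continuous. *)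
Definition stepf (u : R) : R := clamp (2 * u - 1) + clamp (2 * u - 3).

(* a continuous function which reads the i-th base 8 digit of a number whose
   digits are all in {0, 1, 2} *)
Fixpoint dig i w : R :=
  if i is i'.+1 then dig i' (8 * w - stepf (8 * w)) else stepf (8 * w).

Lemma clamp_continuous : continuous clamp.
Proof.
move=> u; apply: (@continuous_min R R (fun=> 1) (fun u => Num.max 0 u)); first exact: cvg_cst.
by apply: (@continuous_max R R (fun=> 0) id); [exact: cvg_cst|exact: cvg_id].
Qed.

Lemma clamp_bound u : 0 <= clamp u <= 1.
Proof. by rewrite /clamp /Num.min /Num.max; do 2 case: ifP; lra. Qed.

Lemma clamp0 u : u <= 0 -> clamp u = 0.
Proof. by rewrite /clamp /Num.min /Num.max; do 2 case: ifP; lra. Qed.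

Lemma clamp1 u : 1 <= u -> clamp u = 1.
Proof. by rewrite /clamp /Num.min /Num.max; do 2 case: ifP; lra. Qed.

Lemma affine_continuous (a b : R) : continuous (fun u : R => a * u - b).
Proof.
move=> u; apply: cvgB; last exact: cvg_cst.
by apply: cvgM; [exact: cvg_cst|exact: cvg_id].
Qed.

Lemma comp_continuous (f g : R -> R) : continuous f -> continuous g ->
  continuous (fun u => g (f u)).
Proof. by move=> cf cg u; apply: (continuous_comp (f := f) (g := g)); [exact: cf|exact: cg]. Qed.

Lemma stepf_continuous : continuous stepf.
Proof.
have c1 := comp_continuous (@affine_continuous 2 1) clamp_continuous.
have c2 := comp_continuous (@affine_continuous 2 3) clamp_continuous.
by move=> u; apply: cvgD; [exact: c1|exact: c2].
Qed.

Lemma dig_continuous i : continuous (dig i).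
Proof.
have c8 : continuous (fun w : R => 8 * w).
  by move=> w; apply: cvgM; [exact: cvg_cst|exact: cvg_id].
have cs := comp_continuous c8 stepf_continuous.
elim: i => [|i IH] //=; apply: comp_continuous (IH) => w.
by apply: cvgB; [exact: c8|exact: cs].
Qed.

Lemma dig_bound i w : 0 <= dig i w <= 2.
Proof.
elim: i w => [|i IH] w //=.
have := clamp_bound (2 * (8 * w) - 1); have := clamp_bound (2 * (8 * w) - 3).
rewrite /stepf; lra.
Qed.

Definition digits e := forall i, [\/ e i = 0, e i = 1 | e i = 2].

Lemma code_bound n e : digits e -> 0 <= code n e <= 2 / 7.
Proof.
elim: n e => [|n IH] e de /=; first lra.
have := IH (fun i => e i.+1) (fun i => de i.+1).
by case: (de 0%N) => ->; lra.
Qed.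

Lemma stepf_digit (d u : R) : [\/ d = 0, d = 1 | d = 2] -> 0 <= u <= 2 / 7 ->
  stepf (d + u) = d.
Proof.
rewrite /stepf => -[->|->|->] hu.
- by rewrite !clamp0; lra.
- by rewrite clamp1 ?clamp0; lra.
- by rewrite !clamp1; lra.
Qed.

Lemma dig_code n e i : digits e -> (i < n)%N -> dig i (code n e) = e i.
Proof.
elim: i n e => [|i IH] [|n] e de //= iN.
  rewrite mulrC divfK ?pnatr_eq0 // stepf_digit //.
  by apply: code_bound => i; exact: de.
have d' : digits (fun i => e i.+1) by move=> l; exact: de.
rewrite mulrC divfK ?pnatr_eq0 // stepf_digit //; last exact: code_bound.
by rewrite addrC addKr (IH n _ d').
Qed.

End Digits.

Section LimitProcess.
Context {R : realType}.
Variable k : nat.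
Notation K := k.+1.
Hypotheses (k_odd : odd k) (k5 : (5 <= k)%N).
Local Notation Em := (@Em R k 1).
Local Notation path := (@path R k _).
Implicit Types (F : (int -> R) -> R) (x : nat -> R).

(** Time 0 is placed in the middle of the j flips, so that any fixed window around it lies inside
    them for large j. *)
Definition time (j : nat) (l : int) : nat := absz (l + (j./2)%:Z).

Definition model_code j x : R :=
  code j (fun i => 1 + x (time j (odflt 0 (unpickle i)))).

(** One index serves as level and as number of flips: j <= K^j, and both grow. *)
Definition model_av j (f : R -> R) : R := Em j j (fun x => f (model_code j x)).

Definition coord (l : int) (w : R) : R := dig (pickle l) w - 1.

Definition window_mean j c F : R :=
  Em j (2 * c).+1 (fun x => F (fun l => x (absz (l + c%:Z)))).

Definition supported (c : nat) F := forall x x' : int -> R,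
  (forall l : int, (absz l <= c)%N -> x l = x' l) -> F x = F x'.

Lemma digits_path j v s (y : conf k j) (g : nat -> nat) :
  digits (fun i => 1 + path v s y (g i)).
Proof.
move=> i; case: (path_val R v s y (g i)) => ->.
- by constructor 2; rewrite addr0.
- by constructor 3.
- by constructor 1; rewrite subrr.
Qed.

Lemma averaging_model j : averaging (model_av j).
Proof.
split.
- by move=> a f g _ _; rewrite /model_av -EmZ -EmD.
- by move=> f g _ _ fg; apply: le_Em => // v s y _; exact: fg.
- by rewrite /model_av EmC.
Qed.

Lemma tight_model e : 0 < e -> exists M : nat, forall j, [set: nat] j ->
  1 - e <= avcdf (model_av j) M%:R - avcdf (model_av j) (- M%:R).
Proof.
move=> e0; exists 1%N => j _.
have h1 : avcdf (model_av j) 1 = 1.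
  rewrite -[RHS](EmC k_odd 1 j j); apply: eq_Em_path => v s y _.
  have := code_bound j (digits_path v s y (fun i => time j (odflt 0 (unpickle i)))).
  by rewrite /halfline -/(model_code j _) => /andP[_ h]; rewrite (le_trans h) //; lra.
have h0 : avcdf (model_av j) (- 1) = 0.
  rewrite -[RHS](EmC k_odd 1 j j); apply: eq_Em_path => v s y _.
  have := code_bound j (digits_path v s y (fun i => time j (odflt 0 (unpickle i)))).
  rewrite /halfline -/(model_code j _) => /andP[h _].
  by case: leP => // h'; move: h h'; lra.
by rewrite h1 h0; lra.
Qed.

(** Times of modulus at most c have their digits among the first j and lie inside the j flips;
    [Em_shift] then moves the window to the start. *)
Lemma model_av_window j c F : supported c F -> (2 * c + 2 <= j)%N ->
  (forall l : int, (absz l <= c)%N -> (pickle l < j)%N) ->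
  model_av j (fun w => F (fun l => coord l w)) = window_mean j c F.
Proof.
move=> Fc cj pj; pose t0 := (j./2 - c)%N.
have cj2 : (c <= j./2)%N by lia.
transitivity (Em j j (fun x => F (fun l => x (t0 + absz (l + c%:Z)%R)%N))).
  apply: eq_Em_path => v s y _; apply: Fc => l lc.
  rewrite /coord /model_code dig_code ?pj //; last exact: digits_path.
  rewrite pickleK /= addrC addKr; congr path; rewrite /time /t0.
  by lia.
rewrite (@Em_shift R k 1 j j t0 (2 * c).+1 (fun x => F (fun l => x (absz (l + c%:Z))))) //.
  by move=> x x' xx'; apply: Fc => l lc; apply: xx'; lia.
by rewrite /t0; lia.
Qed.

Lemma limit_process : exists (Tset : set nat) (mu : probability R R),
  infinite_set Tset /\
  forall c F, supported c F -> continuous (fun w => F (fun l => coord l w)) ->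
    (exists C, forall w, `|F (fun l => coord l w)| <= C) ->
    forall e, 0 < e -> exists N, forall j, (N <= j)%N -> Tset j ->
      `|window_mean j c F - \int[mu]_w F (fun l => coord l w)| < e.
Proof.
have [Tset [mu [_ Tinf Hlim]]] := helly averaging_model infinite_nat tight_model.
exists Tset, mu; split => // c F Fc cF bF e e0.
have [N HN] := Hlim _ cF bF e e0.
pose P := (\max_(i < (2 * c).+1) pickle ((i : nat)%:Z - c%:Z)%R).+1.
exists (maxn N (maxn P (2 * c + 2))) => j; rewrite !geq_max => /and3P[Nj Pj cj] Tj.
rewrite -model_av_window //; first exact: HN.
move=> l lc; apply: leq_trans Pj; rewrite ltnS.
have li : (absz (l + c%:Z)%R < (2 * c).+1)%N by lia.
have := leq_bigmax (F := fun i : 'I_(2 * c).+1 => pickle ((i : nat)%:Z - c%:Z)%R) (Ordinal li).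
by rewrite /= (_ : _ - _ = l) //; lia.
Qed.

End LimitProcess.

Lemma infinite_nat_pick (A : set nat) (N : nat) : infinite_set A ->
  exists2 n, A n & (N <= n)%N.
Proof.
move=> Ainf; apply: contrapT => /forall2NP h; apply: Ainf.
apply: (@sub_finite_set _ _ `I_N); last exact: finite_II.
by move=> n An /=; case: (h n) => // /negP; rewrite -ltnNge.
Qed.

(** * Observables and cylinder events under the limit law *)

Section LimitProperties.
Context {R : realType}.
Variable k : nat.
Notation K := k.+1.
Hypotheses (k_odd : odd k) (k5 : (5 <= k)%N).
Local Notation Em := (@Em R k 1).
Local Notation path := (@path R k _).
Implicit Types (F G : (int -> R) -> R) (B : set R) (s : seq int).

Variables (Tset : set nat) (mu : probability R R).
Hypothesis Tinf : infinite_set Tset.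
Hypothesis lim_mean : forall c F, supported c F ->
  continuous (fun w => F (fun l => coord l w)) ->
  (exists C, forall w, `|F (fun l => coord l w)| <= C) ->
  forall e, 0 < e -> exists N, forall j, (N <= j)%N -> Tset j ->
    `|window_mean k j c F - \int[mu]_w F (fun l => coord l w)| < e.

Lemma coord_continuous l : continuous (@coord R l).
Proof. by move=> w; apply: cvgB; [exact: dig_continuous|exact: cvg_cst]. Qed.

Lemma coord_bound l w : `|@coord R l w| <= 1.
Proof. by rewrite /coord ler_norml; have := dig_bound (pickle l) w; lra. Qed.

Lemma measurable_coord l : measurable_fun setT (@coord R l).
Proof. apply: continuous_measurable_fun; exact: coord_continuous. Qed.

Definition observable c F := [/\ supported c F,
  continuous (fun w => F (fun l => coord l w)) &
  exists C, forall w, `|F (fun l => coord l w)| <= C].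

Lemma observable_cst c a : observable c (fun=> a).
Proof. by split => //; [move=> w; exact: cvg_cst|exists `|a|]. Qed.

Lemma observable_coord c l : (absz l <= c)%N -> observable c (fun x => x l).
Proof.
move=> lc; split; first by move=> x x'; apply.
- exact: coord_continuous.
- by exists 1 => w; exact: coord_bound.
Qed.

Lemma observableD c F G : observable c F -> observable c G ->
  observable c (fun x => F x + G x).
Proof.
move=> [sF cF [C FC]] [sG cG [D GD]]; split.
- by move=> x x' xx'; rewrite (sF x x') // (sG x x').
- by move=> w; apply: cvgD; [exact: cF|exact: cG].
- exists (C + D) => w; apply: le_trans (ler_normD _ _) _.
  by apply: lerD; [exact: FC|exact: GD].
Qed.

Lemma observableM c F G : observable c F -> observable c G ->
  observable c (fun x => F x * G x).
Proof.
move=> [sF cF [C FC]] [sG cG [D GD]]; split.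
- by move=> x x' xx'; rewrite (sF x x') // (sG x x').
- by move=> w; apply: cvgM; [exact: cF|exact: cG].
- exists (C * D) => w; rewrite normrM.
  by apply: ler_pM; [exact: normr_ge0|exact: normr_ge0|exact: FC|exact: GD].
Qed.

Lemma observable_sum c (I : Type) (r : seq I) (f : I -> (int -> R) -> R) :
  (forall i, observable c (f i)) -> observable c (fun x => \sum_(i <- r) f i x).
Proof.
move=> fo; elim: r => [|i r IH].
  by under eq_fun do rewrite big_nil; exact: observable_cst.
by under eq_fun do rewrite big_cons; exact: observableD.
Qed.

Lemma observable_prod c (I : eqType) (r : seq I) (f : I -> (int -> R) -> R) :
  (forall i, i \in r -> observable c (f i)) -> observable c (fun x => \prod_(i <- r) f i x).
Proof.
elim: r => [|i r IH] fo.
  by under eq_fun do rewrite big_nil; exact: observable_cst.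
under eq_fun do rewrite big_cons; apply: observableM; first by apply: fo; rewrite mem_head.
by apply: IH => i' i'r; apply: fo; rewrite inE i'r orbT.
Qed.

Lemma observableX c F n : observable c F -> observable c (fun x => F x ^+ n).
Proof.
move=> oF; elim: n => [|n IH]; first by under eq_fun do rewrite expr0; exact: observable_cst.
by under eq_fun do rewrite exprS; exact: observableM.
Qed.

Local Notation "'E F" := (\int[mu]_w F (fun l => coord l w))
  (at level 10, F at level 8).

Lemma observable_integrable c F : observable c F ->
  mu.-integrable setT (EFin \o (fun w => F (fun l => coord l w))).
Proof.
move=> [_ cF [C FC]]; apply: (@bounded_integrable _ _ _ _ _ C) => //.
exact: continuous_measurable_fun.
Qed.

Lemma mean_close c F v b : observable c F ->
  (exists N, forall j, (N <= j)%N -> `|window_mean k j c F - v| <= b) -> `|'E F - v| <= b.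
Proof.
move=> [sF cF bF] [N HN]; apply/ler_addgt0Pr => e e0.
have [N' HN'] := lim_mean sF cF bF e0.
have [j Tj jN] := infinite_nat_pick (maxn N N') Tinf.
move: jN; rewrite geq_max => /andP[Nj N'j].
have := HN _ Nj; have := HN' _ N'j Tj.
set a := window_mean _ _ _ _; set I := Rintegral _ _ _ => h1 h2.
have := ler_distD a I v; rewrite (distrC I a); lra.
Qed.

Lemma mean_eq c F v : observable c F ->
  (exists N, forall j, (N <= j)%N -> window_mean k j c F = v) -> 'E F = v.
Proof.
move=> oF [N HN]; apply/eqP; rewrite -subr_eq0 -normr_le0.
by apply: mean_close oF _; exists N => j /HN ->; rewrite subrr normr0.
Qed.

Lemma mean_le c F v : observable c F ->
  (exists N, forall j, (N <= j)%N -> window_mean k j c F <= v) -> 'E F <= v.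
Proof.
move=> [sF cF bF] [N HN]; apply/ler_addgt0Pr => e e0.
have [N' HN'] := lim_mean sF cF bF e0.
have [j Tj jN] := infinite_nat_pick (maxn N N') Tinf.
move: jN; rewrite geq_max => /andP[Nj N'j].
have := HN _ Nj; have := HN' _ N'j Tj; rewrite ltr_norml; lra.
Qed.

(** Away from the codes [dig] takes intermediate values. In the model x^3 - x vanishes, so the mean
    of its square is 0, and this passes to the limit. *)
Lemma coord_ae l : {ae mu, forall w, coord l w ^+ 3 - coord l w = 0}.
Proof.
pose F (x : int -> R) := (x l ^+ 3 + (- 1) * x l) ^+ 2.
have oF : observable (absz l) F.
  apply: observableX; apply: observableD; first by apply: observableX; exact: observable_coord.
  by apply: observableM; [exact: observable_cst|exact: observable_coord].
have E0 : 'E F = 0.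
  apply: (mean_eq oF); exists 0%N => j _; rewrite -[RHS](EmC k_odd 1 j (2 * `|l|).+1).
  apply: eq_Em_path => v s y _; rewrite /F.
  by case: (path_val R v s y (absz (l + `|l|%N%:Z))) => ->; ring.
have iF := observable_integrable oF.
have F0 w : 0 <= F (fun l => coord l w) by rewrite sqr_ge0.
have I0 : (\int[mu]_w `|(EFin \o (fun w => F (fun l => coord l w))) w| = 0)%E.
  under eq_integral => w _ do rewrite /= ger0_norm //.
  by rewrite -[LHS]fineK ?(integrable_fin_num _ iF) // -/(Rintegral _ _ _) E0.
have /(ae_eq_integral_abs mu measurableT (measurable_int _ iF)) ae0 := I0.
apply: filterS ae0 => w /= /(_ I) [/eqP].
by rewrite /F sqrf_eq0 mulN1r => /eqP.
Qed.

Lemma ae_seq (T : eqType) (r : seq T) (A : T -> set R) :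
  (forall i, {ae mu, forall w, A i w}) -> {ae mu, forall w, forall i, i \in r -> A i w}.
Proof.
move=> Aae; elim: r => [|i r IH]; first exact: aeW.
apply: filterS2 (Aae i) IH => w Ai Ar i'; rewrite inE => /orP[/eqP ->//|]; exact: Ar.
Qed.

(* the quadratic polynomial which agrees with the indicator of B on {-1, 0, 1} *)
Definition interp B (x : R) : R :=
  \1_B 0 * (1 - x ^+ 2) + \1_B 1 * ((x ^+ 2 + x) / 2) + \1_B (-1) * ((x ^+ 2 - x) / 2).

Lemma interpE B x : [\/ x = 0, x = 1 | x = -1] -> interp B x = \1_B x.
Proof. by rewrite /interp => -[->|->|->]; field. Qed.

Lemma trit (x : R) : x ^+ 3 - x = 0 -> [\/ x = 0, x = 1 | x = -1].
Proof.
have -> : x ^+ 3 - x = x * ((x - 1) * (x + 1)) by ring.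
move=> /eqP; rewrite !mulf_eq0 subr_eq0 addr_eq0 => /or3P[]/eqP ->.
- by constructor 1.
- by constructor 2.
- by constructor 3.
Qed.

Definition cylinder_poly s (B : int -> set R) (x : int -> R) : R :=
  \prod_(l <- s) interp (B l) (x l).

Lemma observable_interp c l B : (absz l <= c)%N -> observable c (fun x => interp B (x l)).
Proof.
move=> lc; have ol := observable_coord lc; have ol2 := observableX 2 ol.
have oc := @observable_cst c.
have H (a b d : R) : observable c (fun x => a * (b * x l ^+ 2 + d * x l) + 0).
  apply: observableD; last exact: oc.
  by apply: observableM; [exact: oc|apply: observableD; apply: observableM].
have := observableD (observableD (observableD (oc (\1_B 0)) (H (\1_B 0) (-1) 0))
  (H (\1_B 1) 2^-1 2^-1)) (H (\1_B (-1)) 2^-1 (- 2^-1)).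
by congr observable; apply/funext => x; rewrite /interp; field.
Qed.

Definition radius s : nat := \max_(l <- s) absz l.

Lemma radiusP s l : l \in s -> (absz l <= radius s)%N.
Proof. by move=> ls; rewrite /radius (leq_bigmax_seq (F := fun l : int => absz l)). Qed.

(** Indices are kept apart from coordinates so that shifted events are covered, and joint events in
    which one coordinate carries two constraints. *)
Definition events (I : eqType) (r : seq I) (p : I -> int) (B : I -> set R) : set R :=
  \bigcap_(i in [set` r]) (@coord R (p i) @^-1` B i).

Definition events_poly (I : eqType) (r : seq I) (p : I -> int) (B : I -> set R)
  (x : int -> R) : R := \prod_(i <- r) interp (B i) (x (p i)).

Lemma observable_events c (I : eqType) (r : seq I) (p : I -> int) (B : I -> set R) :
  (forall i, i \in r -> (absz (p i) <= c)%N) -> observable c (events_poly r p B).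
Proof.
by move=> rc; apply: observable_prod => i ir; apply: observable_interp; exact: rc.
Qed.

Lemma observable_cylinder c s (B : int -> set R) : (radius s <= c)%N ->
  observable c (cylinder_poly s B).
Proof.
move=> sc; apply: (@observable_events c _ s id B) => l ls.
exact: leq_trans (radiusP ls) sc.
Qed.

Lemma measurable_events (I : eqType) (r : seq I) (p : I -> int) (B : I -> set R) :
  (forall i, measurable (B i)) -> measurable (events r p B).
Proof.
move=> mB; apply: fin_bigcap_measurable => [|i _]; first exact: finite_seq.
by rewrite -[X in measurable X]setTI; exact: measurable_coord.
Qed.

(** Almost surely the coordinates are in {-1, 0, 1}, where indicators are polynomials. So the
    probability of a cylinder event is the mean of a continuous observable, which the weak limit
    determines. *)
Lemma events_prob (I : eqType) (r : seq I) (p : I -> int) (B : I -> set R) :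
  (forall i, measurable (B i)) -> mu (events r p B) = ('E (events_poly r p B))%:E.
Proof.
move=> mB; set A := events r p B.
have mA : measurable A by exact: measurable_events.
have oF : observable (radius [seq p i | i <- r]) (events_poly r p B).
  by apply: observable_events => i ir; apply: radiusP; exact: map_f.
have iF := observable_integrable oF.
rewrite [X in X%:E]/Rintegral fineK ?(integrable_fin_num _ iF) //.
rewrite -[A in LHS]setIT -integral_indic //.
apply: ae_eq_integral => //.
- exact/measurable_EFinP/measurable_indic.
- exact: measurable_int iF.
have := ae_seq r (fun i => coord_ae (p i)); apply: filterS => w hw _.
congr EFin; rewrite /events_poly big_seq.
rewrite (eq_bigr (fun i => \1_(B i) (coord (p i) w))); last first.
  by move=> i ir; rewrite interpE //; apply: trit; exact: hw.
rewrite -big_seq indicE; case: (boolP (w \in A)) => [|hA].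
  rewrite inE => wA; rewrite big_seq big1 // => i ir.
  by rewrite indicE mem_set //; exact: wA.
apply/esym/eqP; rewrite prodf_seq_eq0; apply: contraNT hA => /hasPn h.
rewrite inE => i /= ir; have := h i ir; rewrite /= indicE.
by case: (boolP (coord (p i) w \in B i)) => //; rewrite ?inE ?eqxx.
Qed.

End LimitProperties.

Section LimitLaws.
Context {R : realType}.
Variable k : nat.
Notation K := k.+1.
Hypotheses (k_odd : odd k) (k5 : (5 <= k)%N).
Local Notation Em := (@Em R k 1).
Local Notation path := (@path R k _).
Implicit Types (F G : (int -> R) -> R) (s : seq int).

Definition law (B : set R) : R := interp B 0 / 2 + (interp B 1 + interp B (-1)) / 4.

Definition wpos (c : nat) (l : int) : nat := absz (l + c%:Z).

Lemma wpos_inv c l : (absz l <= c)%N -> (wpos c l)%:Z - c%:Z = l.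
Proof. by rewrite /wpos; lia. Qed.

Lemma wpos_uniq c s : (radius s <= c)%N -> uniq s -> uniq [seq wpos c l | l <- s].
Proof.
move=> sc us; rewrite map_inj_in_uniq // => l l' ls ls' e.
have hl := leq_trans (radiusP ls) sc; have hl' := leq_trans (radiusP ls') sc.
by rewrite -(wpos_inv hl) -(wpos_inv hl') e.
Qed.

Lemma wpos_lt c s : (radius s <= c)%N ->
  all (fun t => t < (2 * c).+1)%N [seq wpos c l | l <- s].
Proof.
move=> sc; apply/allP => _ /mapP[l ls ->].
by have := leq_trans (radiusP ls) sc; rewrite /wpos; lia.
Qed.

Lemma prod_wpos c s (f : int -> R -> R) (x : nat -> R) : (radius s <= c)%N ->
  \prod_(l <- s) f l (x (wpos c l)) =
  \prod_(t <- [seq wpos c l | l <- s]) f (t%:Z - c%:Z) (x t).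
Proof.
move=> sc; rewrite big_map big_seq [RHS]big_seq; apply: eq_bigr => l ls.
by rewrite wpos_inv // (leq_trans (radiusP ls) sc).
Qed.

Lemma expK_gt j m : (m <= j)%N -> (m <= K ^ j)%N.
Proof. by move=> mj; apply: leq_trans mj (ltnW (ltn_expl _ _)); rewrite ltnS (leq_trans _ k5). Qed.

Lemma window_mean_indep s (B : int -> set R) c j : (radius s <= c)%N -> uniq s ->
  (size s < K)%N -> ((2 * c).+1 <= j)%N ->
  window_mean k j c (cylinder_poly s B) = \prod_(l <- s) law (B l).
Proof.
move=> sc us sK cj.
rewrite /window_mean /cylinder_poly.
under eq_Em => x do rewrite -/(wpos c _) (prod_wpos (fun l => interp (B l)) x sc).
rewrite (@Em_indep R k k_odd k5 1 j (2 * c).+1 _ (fun t => interp (B (t%:Z - c%:Z)))).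
- rewrite big_map big_seq [RHS]big_seq; apply: eq_bigr => l ls.
  by rewrite wpos_inv // (leq_trans (radiusP ls) sc).
- exact: expK_gt.
- exact: wpos_uniq.
- exact: wpos_lt.
- by rewrite size_map sK orbT.
Qed.

Lemma window_mean_abs s (B : int -> set R) c j : (radius s <= c)%N -> uniq s ->
  window_mean k j c (cylinder_poly s (fun l => Num.norm @^-1` B l)) =
  \prod_(l <- s) law (Num.norm @^-1` B l).
Proof.
move=> sc us; rewrite /window_mean /cylinder_poly.
pose g l (r : R) : R := \1_(B l) r.
rewrite (@eq_Em_path R k 1 j _ _ (fun x =>
   \prod_(t <- [seq wpos c l | l <- s]) g (t%:Z - c%:Z) `|x t|)); last first.
  move=> v xi y _.
  rewrite -(prod_wpos (fun l r => g l `|r|) (fun t => path v xi y t) sc).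
  apply: eq_bigr => l _; rewrite interpE; last exact: path_val.
  by rewrite /g !indicE; congr (_%:R); apply/idP/idP; rewrite !inE.
rewrite (@Em_abs_indep R k k_odd 1 j (2 * c).+1 _ (fun t => g (t%:Z - c%:Z))).
- rewrite big_map big_seq [RHS]big_seq; apply: eq_bigr => l ls.
  rewrite wpos_inv ?(leq_trans (radiusP ls) sc) // /law !interpE; last 3 first.
  + by constructor 3.
  + by constructor 2.
  + by constructor 1.
  have E r : \1_(Num.norm @^-1` B l) r = g l `|r|.
    by rewrite /g !indicE; congr (_%:R); apply/idP/idP; rewrite !inE.
  by rewrite !E normr0 normrN normr1; field.
- exact: wpos_uniq.
- exact: wpos_lt.
Qed.

Lemma window_mean_shift F c c' (n : int) j : supported c F ->
  (c + absz n <= c')%N -> ((2 * c').+1 <= j)%N ->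
  window_mean k j c' (fun x => F (fun l => x (l + n))) = window_mean k j c F.
Proof.
move=> Fc cn cj; pose t0 := absz (n + c'%:Z - c%:Z)%R.
rewrite /window_mean -(@Em_shift R k 1 j (2 * c').+1 t0 (2 * c).+1
  (fun x => F (fun l => x (absz (l + c%:Z))))).
- apply: eq_Em => x; apply: Fc => l lc; congr x; rewrite /t0; lia.
- by move=> x x' xx'; apply: Fc => l lc; apply: xx'; lia.
- by rewrite /t0; lia.
Qed.

Definition mix_err (c J n : nat) : R :=
  4 * (((2 * c).+1 + (2 * c).+1)%:R / (K ^ J)%:R) +
  2 * (2 ^+ (K ^ J) * (3 / 4) ^+ n) +
  2 * (1 - 2^-1 ^+ (K ^ J)) ^+ ((n - (2 * c).+1) %/ (K ^ J)).

Lemma window_mean_mixing F G c n J : supported c F -> supported c G ->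
  (forall x, `|F x| <= 1) -> (forall x, `|G x| <= 1) -> ((2 * c).+1 <= n)%N ->
  exists N, forall j, (N <= j)%N ->
  `|window_mean k j (c + n) (fun x => F x * G (fun l => x (l + n%:Z))) -
    window_mean k j c F * window_mean k j c G| <= mix_err c J n.
Proof.
move=> Fc Gc F1 G1 cn; exists (J + (2 * (c + n)).+1 + K ^ J + n)%N => j jN.
pose F' (x : nat -> R) := F (fun l => x (absz (l + c%:Z))).
pose G' (x : nat -> R) := G (fun l => x (absz (l + c%:Z))).
have dF : depends_on (2 * c).+1 F'.
  by move=> x x' xx'; apply: Fc => l lc; apply: xx'; lia.
have dG : depends_on (2 * c).+1 G'.
  by move=> x x' xx'; apply: Gc => l lc; apply: xx'; lia.
(* Time 0 has index c + n in the large window, so F reads from index n on; a shift by n brings it to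
   the start. *)
have -> : window_mean k j (c + n) (fun x => F x * G (fun l => x (l + n%:Z))) =
    Em j (n + (2 * c).+1) (fun x => F' x * G' (fun t => x (n + t)%N)).
  rewrite -(@Em_shift R k 1 j (2 * (c + n)).+1 n (n + (2 * c).+1)
     (fun x => F' x * G' (fun t => x (n + t)%N))).
  - apply: eq_Em => x; congr (_ * _).
      by apply: Fc => l lc; congr x; lia.
    by apply: Gc => l lc; congr x; lia.
  - move=> x x' xx'; congr (_ * _); [apply: dF => t tc|apply: dG => t tc]; apply: xx'; lia.
  - lia.
rewrite -(subnK (_ : J <= j)%N); last by lia.
apply: (@Em_mixing R k 1 k_odd k5 _ _ (j - J) J (2 * c).+1 (2 * c).+1 n F' G') => //.
- by move=> x; exact: F1.
- by move=> x; exact: G1.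
rewrite subnK; last by lia.
apply: expK_gt; lia.
Qed.

Lemma window_mean_sum j n l c : (n <= c)%N -> (0 < c)%N -> ((2 * c).+1 <= j)%N ->
  window_mean k j c (fun x => (\sum_(1 <= i < n.+1) x i%:Z) ^+ l) =
  Em j n (fun x => xsum n x ^+ l).
Proof.
move=> nc c0 cj; rewrite /window_mean.
(* Time 1 has index c + 1 in the window. *)
rewrite -(@Em_shift R k 1 j (2 * c).+1 c.+1 n (fun x => xsum n x ^+ l)).
- apply: eq_Em => x; congr (_ ^+ _); rewrite big_add1 /= big_mkord /xsum.
  by apply: eq_bigr => i _; congr x; lia.
- by move=> x x' xx'; congr (_ ^+ _); apply: eq_bigr => i _; exact: xx'.
- lia.
Qed.

End LimitLaws.

(** * Stationarity and mixing *)

Section PathSpace.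
Context {R : realType}.
Implicit Types (A : set (int -> R)) (s : seq int) (B : int -> set R).

Definition cylinder s B : set (int -> R) := [set f | forall l, l \in s -> B l (f l)].

Definition cylinders : set (set (int -> R)) :=
  [set C | exists s B, (forall l, measurable (B l)) /\ C = cylinder s B].

Let generators : set (set (int -> R)) := [set C | exists (l : int) (B : set R),
  measurable B /\ C = (fun f : int -> R => f l) @^-1` B].

Lemma cylindersI : setI_closed cylinders.
Proof.
move=> _ _ [s [B [mB ->]]] [s' [B' [mB' ->]]].
exists (s ++ s'), (fun l => (if l \in s then B l else setT) `&` (if l \in s' then B' l else setT)).
split=> [l|].
  by apply: measurableI; case: ifP.
apply/seteqP; split => f /=.
  by move=> [h h'] l; rewrite mem_cat => ls; split; case: ifP => // ?; [exact: h|exact: h'].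
move=> h; split => l ls; have := h l; rewrite mem_cat ls ?orbT => /(_ isT)[];
  by rewrite ?ls.
Qed.

Lemma prodZ_cylinders A : prodZ_measurable A = <<s cylinders >> A.
Proof.
suff E : <<s generators >> = <<s cylinders >> by exact: (congr1 (fun S => S A) E).
have sG := @smallest_sigma_algebra _ setT generators.
have sC := @smallest_sigma_algebra _ setT cylinders.
apply/seteqP; split; apply: smallest_sub => //.
  move=> _ [l [B [mB ->]]]; apply: sub_sigma_algebra.
  exists [:: l], (fun _ => B); split => //.
  apply/seteqP; split => f /=; first by move=> fB l'; rewrite inE => /eqP ->.
  by apply; rewrite mem_head.
pose T' := g_sigma_algebraType generators.
move=> _ [s [B [mB ->]]].
elim: s => [|l s IH].
  rewrite (_ : cylinder _ _ = setT); first exact: (@measurableT _ T').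
  by apply/seteqP; split => // f _ l.
rewrite (_ : cylinder _ _ = ((fun f : int -> R => f l) @^-1` B l) `&` cylinder s B).
  apply: (@measurableI _ T') => //.
  by apply: sub_sigma_algebra; exists l, (B l).
apply/seteqP; split => f /=.
  by move=> h; split; [apply: h; rewrite mem_head|move=> l' ls; apply: h; rewrite inE ls orbT].
by move=> [h1 h2] l'; rewrite inE => /orP[/eqP ->//|]; exact: h2.
Qed.

Lemma prodZ_induction (Pr : set (int -> R) -> Prop) :
  Pr setT ->
  (forall s B, (forall l, measurable (B l)) -> Pr (cylinder s B)) ->
  (forall A, prodZ_measurable A -> Pr A -> Pr (~` A)) ->
  (forall F : nat -> set (int -> R), (forall n, prodZ_measurable (F n)) ->
     trivIset setT F -> (forall n, Pr (F n)) -> Pr (\bigcup_n F n)) ->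
  forall A, prodZ_measurable A -> Pr A.
Proof.
move=> PT Pc PC PU A; rewrite prodZ_cylinders.
apply: (@dynkin_induction _ (g_sigma_algebraType cylinders) cylinders Pr) => //.
- exact: cylindersI.
- by move=> _ [s [B [mB ->]]]; exact: Pc.
- by move=> S mS; apply: PC; rewrite prodZ_cylinders.
- by move=> F mF; apply: PU => n; rewrite prodZ_cylinders; exact: mF.
Qed.

Context d {T : measurableType d} (P : probability T R) (X : int -> T -> R).
Hypothesis mX : forall l, measurable_fun setT (X l).

Definition trace (n : int) A : set T := [set w | A (traj X n w)].

Lemma traceC n A : trace n (~` A) = ~` trace n A. Proof. by []. Qed.

Lemma trace_bigcup n (F : nat -> set (int -> R)) :
  trace n (\bigcup_i F i) = \bigcup_i trace n (F i).
Proof. by apply/seteqP; split => w [i _ h]; exists i. Qed.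

Lemma trace_cylinder n s B :
  trace n (cylinder s B) = \bigcap_(l in [set` s]) (X (l + n) @^-1` B l).
Proof. by []. Qed.

Lemma measurable_trace n A : prodZ_measurable A -> measurable (trace n A).
Proof.
apply: (@prodZ_induction (fun A => measurable (trace n A))) => {A}.
- exact: (@measurableT _ T).
- move=> s B mB; rewrite trace_cylinder.
  apply: fin_bigcap_measurable => [|l _]; first exact: finite_seq.
  by rewrite -[X in measurable X]setTI; exact: mX.
- by move=> A _ mA; rewrite traceC; exact: measurableC.
- by move=> F _ _ mF; rewrite trace_bigcup; exact: bigcup_measurable.
Qed.

Lemma trivIset_trace n (F : nat -> set (int -> R)) :
  trivIset setT F -> trivIset setT (fun i => trace n (F i)).
Proof.
move=> /trivIsetP tF; apply/trivIsetP => i j _ _ ij.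
by apply/seteqP; split => // w [/= h1 h2]; have := tF i j I I ij => /seteqP[+ _] => /(_ (traj X n w)); apply.
Qed.

Lemma stationary_of_cylinders :
  (forall n s B, (forall l, measurable (B l)) ->
     P (trace n (cylinder s B)) = P (trace 0 (cylinder s B))) ->
  strictly_stationary P X.
Proof.
move=> hc n; apply: (@prodZ_induction (fun A => P (trace n A) = P (trace 0 A))) => //.
- by move=> s B mB; exact: hc.
- move=> A mA h; rewrite !traceC !probability_setC ?h //; exact: measurable_trace.
- move=> F mF tF h; rewrite !trace_bigcup !measure_semi_bigcup //.
  + by apply: eq_eseriesr => i _; exact: h.
  + by move=> i; exact: measurable_trace.
  + exact: trivIset_trace.
  + by apply: bigcup_measurable => i _; exact: measurable_trace.
  + by move=> i; exact: measurable_trace.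
  + exact: trivIset_trace.
  + by apply: bigcup_measurable => i _; exact: measurable_trace.
Qed.

(** Dominated convergence for series. In [mixing_closure] the bound m i is the probability of the
    i-th piece, which stationarity makes independent of n. *)
Lemma dominated_series (a : nat -> nat -> R) (A m : nat -> R) (M c : R) :
  (forall n, (fun N => \sum_(i < N) a n i) @ \oo --> A n) ->
  (fun N => \sum_(i < N) m i) @ \oo --> M ->
  (forall n i, 0 <= a n i <= m i) -> 0 <= c <= 1 ->
  (forall i, (fun n => a n i) @ \oo --> m i * c) ->
  A @ \oo --> M * c.
Proof.
move=> aA mM am c01 ac; apply/cvgrPdist_lt => e e0.
have e30 : 0 < e / 3 by lra.
have m_ge0 i : 0 <= m i by case/andP: (am 0%N i) => h1 h2; exact: le_trans h2.
have leM (u : nat -> R) l N : (forall i, 0 <= u i) ->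
    (fun N => \sum_(i < N) u i) @ \oo --> l -> \sum_(i < N) u i <= l.
  move=> u0 ul; have nd : nondecreasing_seq (fun N => \sum_(i < N) u i).
    by apply/nondecreasing_seqP => n; rewrite big_ord_recr /= lerDl.
  have := nondecreasing_cvgn_le nd (cvgP _ ul) N.
  by rewrite (cvg_lim _ ul).
have [N hN] : exists N, M - \sum_(i < N) m i < e / 3.
  have /cvgrPdist_lt/(_ _ e30)[N _ hN] := mM; exists N.
  by have := hN N (leqnn N); rewrite ltr_norml => /andP[].
have hM := leM m M N m_ge0 mM.
have hA n : 0 <= A n - \sum_(i < N) a n i <= M - \sum_(i < N) m i.
  have h1 : \sum_(i < N) a n i <= A n.
    by apply: leM (aA n) => i; case/andP: (am n i).
  have h2 : \sum_(i < N) (m i - a n i) <= M - A n.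
    apply: (leM (fun i => m i - a n i)) => [i|]; first by rewrite subr_ge0; case/andP: (am n i).
    under eq_fun do rewrite sumrB.
    by apply: cvgB; [exact: mM|exact: aA].
  by move: h2; rewrite sumrB; lra.
have cN : (fun n => \sum_(i < N) a n i) @ \oo --> \sum_(i < N) m i * c.
  elim: N {hN hM hA} => [|N IH]; first by under eq_fun do rewrite big_ord0; rewrite big_ord0; exact: cvg_cst.
  under eq_fun do rewrite big_ord_recr /=; rewrite big_ord_recr /=.
  by apply: cvgD; [exact: IH|exact: ac].
have /cvgrPdist_lt/(_ _ e30) := cN; apply: filterS => n hn.
have := hA n; move: hn; rewrite -mulr_suml !ltr_norml.
have : 0 <= (M - \sum_(i < N) m i) * c <= M - \sum_(i < N) m i.
  have h0 : 0 <= M - \sum_(i < N) m i by rewrite subr_ge0.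
  case/andP: c01 => c0 c1; rewrite mulr_ge0 //=.
  by rewrite ler_piMr.
by rewrite mulrBl; lra.
Qed.

Definition pr (E : set T) : R := fine (P E).

Lemma prE E : measurable E -> (pr E)%:E = P E.
Proof. by move=> mE; rewrite fineK ?fin_num_measure. Qed.

Lemma pr_le E E' : measurable E -> measurable E' -> E `<=` E' -> pr E <= pr E'.
Proof. by move=> mE mE' sub; rewrite -lee_fin !prE // le_measure ?inE. Qed.

Lemma pr_ge0 E : 0 <= pr E. Proof. exact: fine_ge0. Qed.

Lemma pr_sigma (E : nat -> set T) : (forall i, measurable (E i)) -> trivIset setT E ->
  (fun N => \sum_(i < N) pr (E i)) @ \oo --> pr (\bigcup_i E i).
Proof.
move=> mE tE; have mU : measurable (\bigcup_i E i) by exact: bigcup_measurable.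
have : (fun N => \sum_(0 <= i < N) P (E i))%E @ \oo --> (pr (\bigcup_i E i))%:E.
  by rewrite prE //; exact: measure_semi_sigma_additive.
move=> /fine_cvg; apply: cvg_trans; apply: near_eq_cvg; apply: nearW => N /=.
rewrite -(big_mkord xpredT (fun i => pr (E i))) /=.
rewrite (eq_bigr (fun i => (pr (E i))%:E)); last by move=> i _; rewrite prE.
by rewrite sumEFin.
Qed.

Hypothesis statX : strictly_stationary P X.

Lemma pr_trace n A : prodZ_measurable A -> pr (trace n A) = pr (trace 0 A).
Proof. by move=> mA; rewrite /pr /trace (statX n mA). Qed.

(** One of the two events is extended from cylinders to all measurable sets while the other, E, is
    held. The time [tau] allows both uses: 0 to extend the fixed event, n to extend the moving
    one. *)
Lemma mixing_closure (tau : nat -> int) (E : nat -> set T) (c : R) :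
  (forall n, measurable (E n)) -> 0 <= c <= 1 -> (fun n => pr (E n)) @ \oo --> c ->
  (forall s B, (forall l, measurable (B l)) ->
    (fun n => pr (trace (tau n) (cylinder s B) `&` E n)) @ \oo -->
      pr (trace 0 (cylinder s B)) * c) ->
  forall A, prodZ_measurable A ->
    (fun n => pr (trace (tau n) A `&` E n)) @ \oo --> pr (trace 0 A) * c.
Proof.
move=> mE c01 Ec hc.
have mI n A : prodZ_measurable A -> measurable (trace (tau n) A `&` E n).
  by move=> mA; apply: measurableI => //; exact: measurable_trace.
apply: prodZ_induction.
- rewrite (_ : pr (trace 0 setT) = 1); last by rewrite /pr (_ : trace _ _ = setT) ?probability_setT.
  by rewrite mul1r; under eq_fun do rewrite (_ : trace _ _ = setT) // setTI.
- exact: hc.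
- move=> A mA IH.
  have mA' n : measurable (trace n A) by exact: measurable_trace.
  have E1 n : pr (trace (tau n) (~` A) `&` E n) = pr (E n) - pr (trace (tau n) A `&` E n).
    apply/eqP; rewrite eq_sym subr_eq; apply/eqP.
    apply: EFin_inj; rewrite EFinD !prE //; last 2 first.
    + exact: mI.
    + by rewrite traceC; apply: measurableI => //; exact: measurableC.
    rewrite -measureU; last 3 first.
    + by rewrite traceC; apply: measurableI => //; exact: measurableC.
    + exact: mI.
    + by rewrite setIACA traceC setICl set0I.
    by rewrite traceC -setIUl setUC setUv setTI.
  under eq_fun do rewrite E1.
  have -> : pr (trace 0 (~` A)) * c = c - pr (trace 0 A) * c.
    by rewrite traceC /pr probability_setC // -prE // -EFinB /= mulrBl mul1r.
  by apply: cvgB.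
- move=> F mF tF IH.
  have tT n : trivIset setT (fun i => trace n (F i)) by exact: trivIset_trace.
  rewrite trace_bigcup.
  apply: (@dominated_series (fun n i => pr (trace (tau n) (F i) `&` E n)) _
     (fun i => pr (trace 0 (F i)))) => //.
  + move=> n; rewrite trace_bigcup setI_bigcupl.
    apply: pr_sigma => [i|]; first exact: mI.
    by apply: trivIset_setIr; exact: tT.
  + by apply: pr_sigma => // i; exact: measurable_trace.
  + move=> n i; rewrite pr_ge0 /= -(pr_trace (tau n)) //.
    by apply: pr_le; [exact: mI|exact: measurable_trace|exact: subIsetl].
Qed.

Lemma mixing_of_cylinders :
  (forall s B s' B', (forall l, measurable (B l)) -> (forall l, measurable (B' l)) ->
    (fun n : nat => pr (trace 0 (cylinder s B) `&` trace n%:Z (cylinder s' B'))) @ \oo -->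
      pr (trace 0 (cylinder s B)) * pr (trace 0 (cylinder s' B'))) ->
  mixing P X.
Proof.
move=> hc A B mA mB.
have mT n C : prodZ_measurable C -> measurable (trace n C) by exact: measurable_trace.
have pr01 C : prodZ_measurable C -> 0 <= pr (trace 0 C) <= 1.
  by move=> mC; rewrite pr_ge0 /= -lee_fin prE ?probability_le1 //; exact: mT.
have mcyl s D : (forall l, measurable (D l)) -> prodZ_measurable (cylinder s D).
  by move=> mD; rewrite prodZ_cylinders; apply: sub_sigma_algebra; exists s, D.
have step1 s D : (forall l, measurable (D l)) ->
    (fun n : nat => pr (trace 0 A `&` trace n%:Z (cylinder s D))) @ \oo -->
      pr (trace 0 A) * pr (trace 0 (cylinder s D)).
  move=> mD; apply: (@mixing_closure (fun=> 0) (fun n => trace n%:Z (cylinder s D))) => //.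
  - by move=> n; apply: mT; exact: mcyl.
  - by apply: pr01; exact: mcyl.
  - have E (n : nat) : pr (trace n%:Z (cylinder s D)) = pr (trace 0 (cylinder s D)).
      by rewrite pr_trace //; exact: mcyl.
    by under eq_fun do rewrite E; exact: cvg_cst.
  - by move=> s' D' mD'; exact: (hc s' D' s D mD' mD).
have step2 : (fun n : nat => pr (trace n%:Z B `&` trace 0 A)) @ \oo -->
    pr (trace 0 B) * pr (trace 0 A).
  apply: (@mixing_closure (fun n => n%:Z) (fun=> trace 0 A)) => //.
  - by move=> n; exact: mT.
  - exact: pr01.
  - exact: cvg_cst.
  - by move=> s D mD; under eq_fun do rewrite setIC; rewrite mulrC; exact: step1.
rewrite -[P [set w | A _]](prE (mT 0 A mA)) -[P [set w | B _]](prE (mT 0 B mB)) -EFinM mulrC.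
have mI n : measurable (trace 0 A `&` trace n%:Z B) by apply: measurableI; exact: mT.
apply: cvg_EFin.
  by apply: nearW => n; exact: (fin_num_measure P _ (mI n)).
by apply: cvg_trans step2; apply: near_eq_cvg; apply: nearW => n /=; rewrite setIC.
Qed.

End PathSpace.

Section PartialSums.
Context {R : realType}.

Definition psumZ (n : nat) (x : int -> R) : R := \sum_(1 <= i < n.+1) x i%:Z.

Lemma observable_psumZ c n : (n <= c)%N -> observable c (psumZ n).
Proof.
move=> nc; have -> : psumZ n = fun x => \sum_(i <- enum 'I_n) x (i.+1)%:Z.
  by apply/funext => x; rewrite /psumZ big_add1 /= big_mkord big_enum.
by apply: observable_sum => i; apply: observable_coord; have := ltn_ord i; lia.
Qed.

End PartialSums.

(** * Moments of a normal law *)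

Lemma gmom_rec (R : rcfType) l (v : R) : gmom l.+2 v = l.+1%:R * v * gmom l v.
Proof.
rewrite /gmom /= negbK; case: ifP => [_|/negbT el]; first by rewrite mulr0.
have le : (l = l./2.*2)%N by rewrite -[LHS]odd_double_half (negbTE el).
move: (l./2) le => a ->; rewrite !factS !natrM !exprS.
have f0 (n : nat) : n`!%:R != 0 :> R by rewrite pnatr_eq0 -lt0n fact_gt0.
have -> : (a.*2).+2%:R = 2 * a.+1%:R :> R by rewrite -natrM mul2n doubleS.
by field; rewrite f0 expf_neq0 ?nat1r ?pnatr_eq0.
Qed.

Section LinearCombinations.
Context {R : realType} {d : measure_display} {T : measurableType d}.
Variables (P : probability T R) (f g : T -> R) (a b : R).
Hypothesis fi : P.-integrable setT (EFin \o f).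
Hypothesis gi : P.-integrable setT (EFin \o g).

Lemma integrable_lin : P.-integrable setT (EFin \o (fun x => a * f x + b * g x)).
Proof.
have := integrableD measurableT (integrableZl measurableT a fi) (integrableZl measurableT b gi).
by apply: eq_integrable => // x _; rewrite /= -!EFinM -EFinD.
Qed.

Lemma Rintegral_lin : \int[P]_x (a * f x + b * g x) = a * \int[P]_x f x + b * \int[P]_x g x.
Proof.
have H (c : R) (h : T -> R) : P.-integrable setT (EFin \o h) ->
    P.-integrable setT (EFin \o (fun x => c * h x)).
  move=> hi; have := integrableZl measurableT c hi.
  by apply: eq_integrable => // x _; rewrite /= -EFinM.
rewrite RintegralD //; [|exact: H|exact: H].
by rewrite RintegralZl // RintegralZl.
Qed.

End LinearCombinations.

Section NormalMoments.
Context {R : realType}.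
Variables (m s : R).
Hypothesis s0 : s != 0.
Local Notation leb := (@lebesgue_measure R).
Local Notation pdf := (normal_pdf m s).
Local Notation nu := (normal_prob m s).

Lemma normal_charge_dominates : charge_of_finite_measure nu `<< leb.
Proof. exact: normal_prob_dominates. Qed.

Lemma normal_density_ae :
  ae_eq leb setT (Radon_Nikodym (charge_of_finite_measure nu) leb) (EFin \o pdf).
Proof.
apply: integral_ae_eq => [//| | |A _ mA].
- exact: Radon_Nikodym_integrable normal_charge_dominates.
- by apply/measurable_EFinP; exact: measurable_normal_pdf.
- by rewrite -Radon_Nikodym_integral //; exact: normal_charge_dominates.
Qed.

Lemma normal_change_of_density (f : measurableTypeR R -> R) (E : set (measurableTypeR R)) :
  measurable E -> nu.-integrable E (EFin \o f) ->
  (\int[nu]_(x in E) (f x)%:E = \int[leb]_(x in E) (f x * pdf x)%:E)%E.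
Proof.
move=> mE fi; have mf := measurable_int _ fi.
rewrite -[LHS](Radon_Nikodym_change_of_variables (normal_prob_dominates m s) mE fi).
apply: ae_eq_integral => //.
- apply: emeasurable_funM => //; apply: measurable_funTS.
  exact: (measurable_int leb (Radon_Nikodym_integrable normal_charge_dominates)).
- apply/measurable_EFinP/measurable_funM; first exact/measurable_EFinP.
  by apply: measurable_funTS; exact: measurable_normal_pdf.
- have := ae_eqe_mul2l (EFin \o f) normal_density_ae.
  apply: filterS => x /= h _; exact: h.
Qed.

Lemma is_derive_normal (x : R) : is_derive x 1 pdf (- ((x - m) / s ^+ 2) * pdf x).
Proof.
rewrite normal_pdfE //.
have h : is_derive x 1 (fun y => - (y - m) ^+ 2 / (s ^+ 2 *+ 2)) (- ((x - m) / s ^+ 2)).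
  by apply: is_derive_eq; rewrite /GRing.scale /= -mulr_natr; field.
have := is_deriveZ (normal_peak s) (is_derive1_comp (is_derive_expR _) h).
by move=> H; apply: is_derive_eq H _; rewrite /GRing.scale /= /normal_fun; ring.
Qed.

(** Stein's operator f' - (x - m) f / s^2 at f = (x - m)^i. Times the density it is the derivative
    of f times the density. *)
Definition stein (i : nat) (x : R) : R := i%:R * (x - m) ^+ i.-1 - (x - m) ^+ i.+1 / s ^+ 2.

Lemma is_derive_stein i (x : R) :
  is_derive x 1 (fun y => (y - m) ^+ i * pdf y) (stein i x * pdf x).
Proof.
have d : is_derive x 1 (fun y : R => y - m) 1 by apply: is_derive_eq; rewrite subr0.
have h : is_derive x 1 (fun y : R => (y - m) ^+ i) (i%:R * (x - m) ^+ i.-1).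
  by have := is_deriveX i d; rewrite exprfctE /GRing.scale /= mulr1.
have := is_deriveM h (is_derive_normal x).
move=> H; apply: is_derive_eq H _; rewrite /GRing.scale /= /stein [(x - m) ^+ i.+1]exprS; ring.
Qed.

(** The bound exp y >= y^(i+1) / (i+1)! at y = n^2 / (2 s^2) leaves n^i / n^(2i+2), which is at most
    1/n. *)
Lemma normal_pdf_decay i : exists C, forall n x, (0 < n)%N -> `|x - m| = n%:R ->
  `|(x - m) ^+ i * pdf x| <= C / n%:R.
Proof.
exists (normal_peak s * (i.+1)`!%:R * (s ^+ 2 *+ 2) ^+ i.+1) => n x n0 xn.
have v0 : 0 < s ^+ 2 *+ 2 by rewrite pmulrn_lgt0 // exprn_even_gt0.
rewrite normrM normrX xn (ger0_norm (normal_pdf_ge0 _ _ _)) normal_pdfE // /normal_fun.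
set v := s ^+ 2 *+ 2 in v0 *; set N : R := n%:R.
have N0 : 0 < N by rewrite ltr0n.
have N1 : 1 <= N by rewrite ler1n.
have -> : (x - m) ^+ 2 = N ^+ 2 by rewrite /N -xn real_normK ?num_real.
rewrite mulNr expRN.
have y0 : 0 <= N ^+ 2 / v by rewrite divr_ge0 ?sqr_ge0 // ltW.
have := expR_ge1Dxn i y0; set E := expR _ => hE.
have f0 : 0 < (i.+1)`!%:R :> R by rewrite ltr0n fact_gt0.
have yi : 0 < (N ^+ 2 / v) ^+ i.+1 / (i.+1)`!%:R.
  by rewrite divr_gt0 // exprn_gt0 // divr_gt0 // exprn_gt0.
have E1 : E^-1 <= ((N ^+ 2 / v) ^+ i.+1 / (i.+1)`!%:R)^-1.
  by rewrite lef_pV2 ?posrE //; lra.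
apply: (@le_trans _ _ (N ^+ i * (normal_peak s * ((N ^+ 2 / v) ^+ i.+1 / (i.+1)`!%:R)^-1))).
  apply: ler_wpM2l; first by rewrite exprn_ge0 // ltW.
  by apply: ler_wpM2l => //; exact: normal_peak_ge0.
have -> : N ^+ i * (normal_peak s * ((N ^+ 2 / v) ^+ i.+1 / (i.+1)`!%:R)^-1) =
    normal_peak s * (i.+1)`!%:R * v ^+ i.+1 * (N ^+ i / (N ^+ 2) ^+ i.+1).
  by rewrite exprMn exprVn; field; rewrite ?gt_eqF ?exprn_gt0.
apply: ler_wpM2l.
  by rewrite !mulr_ge0 ?normal_peak_ge0 ?exprn_ge0 // ltW.
rewrite ler_pdivrMr ?exprn_gt0 // mulrC ler_pdivlMr // -exprSr -exprM.
by apply: ler_weXn2l => //; lia.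
Qed.

Lemma stein_continuous i : continuous (stein i).
Proof.
have c j : continuous (fun x : R => (x - m) ^+ j).
  move=> x; apply: (@continuous_comp _ _ _ (fun x => x - m) (fun x => x ^+ j)).
    by apply: cvgB; [exact: cvg_id|exact: cvg_cst].
  exact: exprn_continuous.
move=> x; apply: cvgB; first by apply: cvgM; [exact: cvg_cst|exact: c].
by apply: cvgM; [exact: c|exact: cvg_cst].
Qed.

Lemma stein_segment i (a b : R) : a < b -> nu.-integrable setT (EFin \o stein i) ->
  (\int[nu]_(x in `[a, b]) (stein i x)%:E =
   ((b - m) ^+ i * pdf b)%:E - ((a - m) ^+ i * pdf a)%:E)%E.
Proof.
move=> ab si; rewrite normal_change_of_density //; last first.
  by apply: integrableS si.
pose F y := (y - m) ^+ i * pdf y.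
have dF x : derivable F x 1 by have h := is_derive_stein i x; exact: ex_derive.
have cF x : {for x, continuous F}.
  by apply: differentiable_continuous; exact/derivable1_diffP.
apply: (@continuous_FTC2 R _ F) => //.
- apply: continuous_subspaceT => x; apply: cvgM; first exact: stein_continuous.
  exact: continuous_normal_pdf.
- split; [by move=> x _; exact: dF|apply: cvg_at_right_filter|apply: cvg_at_left_filter]; exact: cF.
- move=> x _; rewrite derive1E; have h := is_derive_stein i x; exact: derive_val.
Qed.

(** Over [m - n, m + n] the integral is a difference of boundary terms, which tends to 0;
    integrability supplies the domination for the limit on the left. *)
Lemma stein_mean i : nu.-integrable setT (EFin \o stein i) ->
  (\int[nu]_x (stein i x)%:E = 0)%E.
Proof.
move=> si; have [C HC] := normal_pdf_decay i.
pose E n : set (measurableTypeR R) := `[m - n%:R, m + n%:R]%classic.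
have mst : measurable_fun (setT : set (measurableTypeR R)) (stein i).
  by apply: continuous_measurable_fun; exact: stein_continuous.
have mE n : measurable (E n) by exact: measurable_itv.
have [|||||_ _ lim1] := @dominated_convergence _ _ _ nu setT measurableT
  (fun n x => (stein i x * \1_(E n) x)%:E) (EFin \o stein i) (abse \o (EFin \o stein i)).
- move=> n; apply/measurable_EFinP; apply: measurable_funM; first exact: mst.
  exact: measurable_indic.
- exact/measurable_EFinP.
- apply: aeW => x _; apply: cvg_near_cst.
  exists (Num.truncn `|x - m|).+1 => // n /= nx; rewrite indicE mem_set ?mulr1 //.
  have := truncnS_gt `|x - m|; have : (Num.truncn `|x - m|).+1%:R <= n%:R :> R by rewrite ler_nat.
  move=> h1 h2; have := le_lt_trans (lexx _) (lt_le_trans h2 h1).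
  by rewrite /E /= in_itv /= ltr_norml => /andP[h3 h4]; apply/andP; split; lra.
- exact: integrable_abse.
- apply: aeW => x n _; rewrite /= lee_fin normrM indicE.
  by case: (_ \in _); rewrite ?normr1 ?normr0 ?mulr1 ?mulr0.
apply: (cvg_unique _ lim1) => //.
have -> : [sequence (\int[nu]_x (stein i x * \1_(E n) x)%:E)%E]_n =
    fun n : nat => (\int[nu]_(x in E n) (stein i x)%:E)%E.
  apply/funext => n /=; rewrite [RHS]integral_mkcond; apply: eq_integral => x _.
  by rewrite patchE indicE; have [_|_] := boolP (x \in E n); rewrite /= ?mulr1 ?mulr0.
apply/fine_cvgP; split.
  by exists 1%N => // n /= n1; rewrite stein_segment // ltrD2l (lt_trans (y := 0)) ?oppr_lt0 ?ltr0n.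
apply/cvgrPdist_le => e e0.
exists (Num.truncn (2 * `|C| / e)).+1 => // n /= nN.
have n0 : 0 < n%:R :> R by rewrite ltr0n (leq_trans _ nN).
rewrite stein_segment //; last by rewrite ltrD2l (lt_trans (y := 0)) ?oppr_lt0.
rewrite /= sub0r normrN; apply: le_trans (ler_normB _ _) _.
have hC x : `|x - m| = n%:R -> `|(x - m) ^+ i * pdf x| <= `|C| / n%:R.
  move=> xn; apply: le_trans (HC n x _ xn) _; first by rewrite -(ltr0n R).
  by apply: ler_wpM2r; [rewrite invr_ge0 ltW|exact: ler_norm].
have h1 : `|(m + n%:R) - m| = n%:R by rewrite addrC addKr ger0_norm // ltW.
have h2 : `|(m - n%:R) - m| = n%:R by rewrite addrC addKr normrN ger0_norm // ltW.
apply: le_trans (lerD (hC _ h1) (hC _ h2)) _.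
rewrite -mulrDl ler_pdivrMr //; have : 2 * `|C| / e <= n%:R.
  by apply: le_trans (ltW (truncnS_gt _)) _; rewrite ler_nat.
by rewrite ler_pdivrMr //; lra.
Qed.

End NormalMoments.
Section NormalTransfer.
Context {R : realType}.
Variables (nu : probability R R) (m s : R).
Hypothesis s0 : 0 < s.
Hypothesis nuE : forall A : set R, measurable A -> nu A = normal_prob m s A.

(* The two canonical measurable structures on R have different displays. *)
Let idR : R -> measurableTypeR R := idfun.

Let midR : measurable_fun setT idR.
Proof. exact: (@measurable_id _ (measurableTypeR R) setT). Qed.

Lemma integral_normal_transfer (f : R -> \bar R) : nu.-integrable setT f ->
  (normal_prob m s).-integrable setT f /\ (\int[normal_prob m s]_x f x = \int[nu]_x f x)%E.
Proof.
move=> fi; have mf : measurable_fun (setT : set (measurableTypeR R)) f by exact: measurable_int fi.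
have eqP g : (\int[normal_prob m s]_x g x = \int[pushforward nu idR]_x g x)%E.
  by apply: eq_measure_integral => A mA _; exact: esym (nuE mA).
have fi' : (pushforward nu idR).-integrable setT f by exact: integrable_pushforward.
split; last by rewrite eqP integral_pushforward.
apply/integrableP; split => //; rewrite eqP.
by case/integrableP : fi'.
Qed.

Lemma Rintegral_stein i : nu.-integrable setT (EFin \o stein m s i) ->
  \int[nu]_x stein m s i x = 0.
Proof.
move=> si; have [si' E] := integral_normal_transfer si.
by rewrite /Rintegral -E stein_mean ?gt_eqF.
Qed.

(** Stein's identity at i = 0 gives m = 0 from the mean, at i = 1 it gives s^2 = v from the
    variance, and beyond it is the recursion [gmom_rec]. *)
Lemma normal_moments (L : nat) (v : R) : (2 <= L)%N ->
  (forall l, (l <= L)%N -> nu.-integrable setT (fun x : R => (x ^+ l)%:E)) ->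
  \int[nu]_x x = 0 -> \int[nu]_x x ^+ 2 = v ->
  forall l, (l <= L)%N -> \int[nu]_x x ^+ l = gmom l v.
Proof.
move=> L2 Li mean var.
have int1 : \int[nu]_x (1 : R) = 1 by exact: Rintegral_cst_probability.
have i1 : nu.-integrable setT (fun x : R => x%:E).
  by have := Li 1%N (ltnW L2); apply: eq_integrable.
have i0 (c : R) : nu.-integrable setT (fun x : R => c%:E).
  by apply: (@bounded_integrable _ _ _ _ _ `|c|).
have iX l : (l <= L)%N -> nu.-integrable setT (EFin \o (fun x : R => x ^+ l)) by exact: Li.
have v0 : 0 < s ^+ 2 by rewrite exprn_gt0.
have m0 : m = 0.
  have E : stein m s 0 = (fun x => (- s ^- 2) * x + (s ^- 2 * m) * 1).
    by apply/funext => x; rewrite /stein /= expr1; ring.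
  have si : nu.-integrable setT (EFin \o stein m s 0).
    by rewrite E; apply: integrable_lin; [exact: i1|exact: i0].
  have := Rintegral_stein si; rewrite E Rintegral_lin; [|exact: i1|exact: i0].
  rewrite mean int1 mulr0 add0r mulr1 => /eqP; rewrite mulf_eq0 invr_eq0 gt_eqF //=.
  by move/eqP.
pose M l := \int[nu]_x x ^+ l.
have rec i : (i.+1 <= L)%N -> i%:R * M i.-1 = M i.+1 / s ^+ 2.
  move=> iL; have i1L : (i.-1 <= L)%N by lia.
  have E : stein m s i = (fun x => i%:R * x ^+ i.-1 + (- s ^- 2) * x ^+ i.+1).
    by apply/funext => x; rewrite /stein m0 subr0; ring.
  have si : nu.-integrable setT (EFin \o stein m s i).
    by rewrite E; apply: integrable_lin; exact: iX.
  have := Rintegral_stein si; rewrite E Rintegral_lin; [|exact: iX|exact: iX].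
  by rewrite -!/(M _) mulNr => /eqP; rewrite subr_eq0 mulrC => /eqP ->; rewrite mulrC.
have M0 : M 0%N = 1 by rewrite /M -int1; congr Rintegral; apply/funext => x; rewrite expr0.
have M1 : M 1%N = 0 by rewrite /M -mean; congr Rintegral; apply/funext => x; rewrite expr1.
have sv : s ^+ 2 = v.
  have := rec 1%N L2; rewrite /= M0 mulr1 /M var => /(congr1 (fun z => z * s ^+ 2)).
  by rewrite divfK ?gt_eqF // mul1r.
elim/ltn_ind => -[_ _|[_ _|l IH lL]]; first by rewrite -/(M 0%N) M0 gmom0.
  by rewrite -/(M 1%N) M1 /gmom.
have := rec l.+1 lL; rewrite /= /M IH; [|lia|lia].
rewrite sv => /(congr1 (fun z => z * v)); rewrite divfK -?sv ?gt_eqF // => <-.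
by rewrite gmom_rec mulrAC.
Qed.

End NormalTransfer.

(** * Weak limits of the normalized sums *)

Section WeakLimits.
Context {R : realType} {d : measure_display} {T : measurableType d}.
Variables (P : probability T R) (Y : nat -> T -> R).
Hypothesis mY : forall n, measurable_fun setT (Y n).
Hypothesis iY : forall n l, P.-integrable setT (EFin \o (fun w => Y n w ^+ l)).

Lemma Rintegral_close d' (T' : measurableType d') (mu : probability T' R) (f g h : T' -> R) :
  mu.-integrable setT (EFin \o f) -> mu.-integrable setT (EFin \o g) ->
  mu.-integrable setT (EFin \o h) -> (forall x, `|f x - g x| <= h x) ->
  `|\int[mu]_x f x - \int[mu]_x g x| <= \int[mu]_x h x.
Proof.
move=> fi gi hi fgh.
have fgi : mu.-integrable setT (EFin \o (fun x => f x - g x)).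
  by have := integrableB measurableT fi gi; apply: eq_integrable => // x _; rewrite /= -EFinB.
rewrite -RintegralB //; apply: le_trans (le_normr_Rintegral _ _) _ => //.
apply: le_Rintegral => //; have := integrable_norm fgi; exact: eq_integrable.
Qed.

Section Limit.
Variables (Tset : set nat) (nu : probability R R).
Hypothesis Tinf : infinite_set Tset.
Hypothesis weak : forall f : R -> R, continuous f -> (exists C, forall x, `|f x| <= C) ->
  forall e, 0 < e -> exists N, forall n, (N <= n)%N -> Tset n ->
    `|\int[P]_w f (Y n w) - \int[nu]_x f x| < e.

Lemma weak_pick (f : R -> R) (e : R) : continuous f -> (exists C, forall x, `|f x| <= C) ->
  0 < e -> exists2 n, Tset n & `|\int[P]_w f (Y n w) - \int[nu]_x f x| < e.
Proof.
move=> cf bf e0; have [N HN] := weak cf bf e0.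
have [n Tn nN] := infinite_nat_pick N Tinf.
by exists n => //; exact: HN.
Qed.

Lemma bounded_comp_integrable (f : R -> R) n : continuous f -> (exists C, forall x, `|f x| <= C) ->
  P.-integrable setT (EFin \o (fun w => f (Y n w))).
Proof.
move=> cf [C fC]; apply: (@bounded_integrable _ _ _ _ _ C) => //.
by apply: measurableT_comp => //; exact: continuous_measurable_fun.
Qed.

Lemma bounded_continuous_integrable (f : R -> R) : continuous f ->
  (exists C, forall x, `|f x| <= C) -> nu.-integrable setT (EFin \o f).
Proof.
move=> cf [C fC]; apply: (@bounded_integrable _ _ _ _ _ C) => //.
exact: continuous_measurable_fun.
Qed.

(** Cut off at c, the power is bounded and continuous, so its mean passes to the limit; monotone
    convergence in c concludes. *)
Lemma weak_fatou l (B : R) : (forall n, Tset n -> \int[P]_w Y n w ^+ l.*2 <= B) ->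
  nu.-integrable setT (EFin \o (fun x : R => x ^+ l.*2)) /\ \int[nu]_x x ^+ l.*2 <= B.
Proof.
move=> HB; pose g (x : R) := x ^+ l.*2; pose gc (c : nat) x := Num.min (g x) c%:R.
have g0 x : 0 <= g x by rewrite /g exprn_even_ge0 // odd_double.
have cg : continuous g by move=> x; exact: exprn_continuous.
have cgc c : continuous (gc c) by move=> x; apply: continuous_min; [exact: cg|exact: cvg_cst].
have gc0 c x : 0 <= gc c x by rewrite le_min g0 ler0n.
have bgc c : exists C, forall x, `|gc c x| <= C.
  by exists c%:R => x; rewrite ger0_norm // ge_min lexx orbT.
have leB c : \int[nu]_x gc c x <= B.
  apply/ler_addgt0Pr => e e0; have [n Tn] := weak_pick (cgc c) (bgc c) e0.
  have : \int[P]_w gc c (Y n w) <= \int[P]_w Y n w ^+ l.*2.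
    apply: le_Rintegral => //; first exact: bounded_comp_integrable.
    by move=> w _; rewrite /gc ge_min lexx.
  have := HB n Tn; rewrite ltr_norml; lra.
have mc : (\int[nu]_x (gc c x)%:E)%E @[c --> \oo] --> (\int[nu]_x (g x)%:E)%E.
  have H : (fun x => (g x)%:E) = (fun x => limn (fun c => (gc c x)%:E)).
    apply/funext => x; apply/esym/cvg_lim => //; apply: cvg_near_cst.
    exists (Num.truncn (g x)).+1 => // c /= cx; congr EFin; rewrite /gc; apply/min_idPl.
    by apply: le_trans (ltW (truncnS_gt _)) _; rewrite ler_nat.
  rewrite H; apply: cvg_monotone_convergence => //.
  - move=> c; apply/measurable_EFinP; exact: continuous_measurable_fun.
  - by move=> c x _; rewrite lee_fin.
  - move=> x _ c c' cc'; rewrite lee_fin /gc le_min ge_min lexx /= ge_min ler_nat cc' orbT.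
    by [].
have gB : (\int[nu]_x (g x)%:E <= B%:E)%E.
  rewrite -(cvg_lim _ mc) //; apply: lime_le; first by apply/cvg_ex; eexists; exact: mc.
  apply: nearW => c; have := leB c; rewrite /Rintegral -lee_fin fineK //.
  by apply: integrable_fin_num => //; exact: bounded_continuous_integrable.
have gi : nu.-integrable setT (EFin \o g).
  apply/integrableP; split; first by apply/measurable_EFinP; exact: continuous_measurable_fun.
  apply: le_lt_trans (ltry B); apply: le_trans gB.
  by under eq_integral => x _ do rewrite /= ger0_norm //.
by split => //; rewrite -lee_fin fineK //; exact: integrable_fin_num gi.
Qed.

Lemma even_moment_integrable l L : (l <= L.*2)%N ->
  nu.-integrable setT (EFin \o (fun x : R => x ^+ L.*2)) ->
  nu.-integrable setT (EFin \o (fun x : R => x ^+ l)).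
Proof.
move=> lL Li; have i1 : nu.-integrable setT (EFin \o cst (1 : R)).
  by apply: bounded_continuous_integrable; [move=> x; exact: cvg_cst|exists 1 => x; rewrite normr1].
have := integrable_lin 1 1 i1 Li; apply: le_integrable => //.
  by apply/measurable_EFinP; apply: continuous_measurable_fun => x; exact: exprn_continuous.
move=> x _; rewrite /= lee_fin !mul1r normrX.
have -> : x ^+ L.*2 = `|x| ^+ L.*2 by rewrite -normrX ger0_norm // exprn_even_ge0 // odd_double.
have h0 : 0 <= `|x| ^+ L.*2 by rewrite exprn_ge0.
rewrite [leRHS]ger0_norm; last by rewrite addr_ge0.
have [x1|x1] := leP `|x| 1; last by have := ler_weXn2l (ltW x1) lL; lra.
by have := @exprn_ile1 R l `|x| (normr_ge0 x) x1; lra.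
Qed.

(** A bound on the moments of order 2l makes the l-th powers uniformly integrable: truncation at
    level c costs at most B / c before and after the limit. *)
Lemma weak_moment l (a B : R) : (forall n, Tset n -> \int[P]_w Y n w ^+ l = a) ->
  (forall n, Tset n -> \int[P]_w Y n w ^+ l.*2 <= B) -> \int[nu]_x x ^+ l = a.
Proof.
move=> Ha HB; have [gi gB] := weak_fatou HB.
pose f (x : R) := x ^+ l; pose fc (c x : R) := Num.max (- c) (Num.min (f x) c).
have fi : nu.-integrable setT (EFin \o f) by apply: even_moment_integrable gi; rewrite -addnn leq_addr.
have cf : continuous f by move=> x; exact: exprn_continuous.
have cfc c : continuous (fc c).
  move=> x; apply: (@continuous_max R _ (fun=> - c) (fun y => Num.min (f y) c)).
    exact: cvg_cst.
  by apply: (@continuous_min R _ f (fun=> c)); [exact: cf|exact: cvg_cst].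
have bfc c : 0 < c -> exists C, forall x, `|fc c x| <= C.
  move=> c0; exists c => x; rewrite ler_norml /fc le_max lexx /= ge_max ge_min lexx orbT andbT.
  lra.
have trunc (c x : R) : 0 < c -> `|f x - fc c x| <= c^-1 * x ^+ l.*2.
  move=> c0; have -> : x ^+ l.*2 = f x ^+ 2 by rewrite /f -exprM muln2.
  rewrite mulrC ler_pdivlMr // /fc; move: (f x) => y.
  case: (leP y c) => yc; last first.
    rewrite max_r; last by lra.
    by rewrite gtr0_norm ?subr_gt0 //; nra.
  case: (leP (- c) y) => cy; first by rewrite subrr normr0 mul0r sqr_ge0.
  by rewrite ltr0_norm; [nra|lra].
have close (c : R) : 0 < c -> `|\int[nu]_x f x - a| <= 2 * B / c.
  move=> c0; apply/ler_addgt0Pr => e e0.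
  have [n Tn] := weak_pick (cfc c) (bfc c c0) e0.
  have icn : P.-integrable setT (EFin \o (fun w => c^-1 * Y n w ^+ l.*2)).
    have := integrableZl measurableT c^-1 (iY n l.*2).
    by apply: eq_integrable => // w _; rewrite /= -EFinM.
  have icv : nu.-integrable setT (EFin \o (fun x => c^-1 * x ^+ l.*2)).
    have := integrableZl measurableT c^-1 gi.
    by apply: eq_integrable => // w _; rewrite /= -EFinM.
  have := Rintegral_close (iY n l) (bounded_comp_integrable n (cfc c) (bfc c c0)) icn
    (fun w => trunc c (Y n w) c0).
  have := Rintegral_close fi (bounded_continuous_integrable (cfc c) (bfc c c0)) icv
    (fun x => trunc c x c0).
  rewrite (Ha n Tn) RintegralZl // RintegralZl //.
  have hB : c^-1 * \int[P]_w Y n w ^+ l.*2 <= B / c.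
    by rewrite mulrC ler_pM2r ?invr_gt0 //; exact: HB.
  have hB' : c^-1 * \int[nu]_w w ^+ l.*2 <= B / c by rewrite mulrC ler_pM2r ?invr_gt0.
  move: hB hB'; rewrite -!mulrA; set t := B / c.
  rewrite !ler_norml ltr_norml => h1 h2 /andP[h3 h4] /andP[h5 h6] /andP[h7 h8].
  by apply/andP; split; lra.
apply/eqP; rewrite -subr_eq0 -normr_le0; apply/ler_addgt0Pr => e e0; rewrite add0r.
have B0 : 0 <= B.
  apply: le_trans gB; apply: Rintegral_ge0 => x _; by rewrite exprn_even_ge0 ?odd_double.
(* The 1 keeps the truncation level positive when B = 0. *)
have c0 : 0 < (2 * B + 1) / e by rewrite divr_gt0 //; lra.
apply: le_trans (close _ c0) _; rewrite invf_div mulrA ler_pdivrMr; last by lra.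
by rewrite mulrC ler_pM2l //; lra.
Qed.

End Limit.

Lemma weak_limit_exists (Q : set nat) (v : R) : infinite_set Q -> 0 <= v ->
  (forall n, Q n -> \int[P]_w Y n w ^+ 2 = v) ->
  exists (Tset : set nat) (nu : probability R R), [/\ Tset `<=` Q, infinite_set Tset &
   forall f : R -> R, continuous f -> (exists C, forall x, `|f x| <= C) ->
   forall e, 0 < e -> exists N, forall n, (N <= n)%N -> Tset n ->
     `|\int[P]_w f (Y n w) - \int[nu]_x f x| < e].
Proof.
move=> Qinf v0 Hv; apply: (@helly R (fun n f => \int[P]_w f (Y n w)) Q) => // [n|e e0].
  exact: averaging_integral.
have [c [c0 ce]] : exists c : nat, 0 < c%:R :> R /\ v / c%:R ^+ 2 <= e.
  (* c is at least 1 and exceeds v / e, so c^2 exceeds it too. *)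
  exists (Num.truncn (v / e)).+1; split; first by rewrite ltr0n.
  set c : R := _%:R; have c1 : 1 <= c by rewrite ler1n.
  have c0 : 0 < c by lra.
  rewrite ler_pdivrMr ?exprn_gt0 // mulrC -ler_pdivrMr //.
  by apply: le_trans (ltW (truncnS_gt _)) _; rewrite -/c expr2 ler_peMl //; lra.
exists c => n Qn; rewrite /avcdf.
have ih t : P.-integrable setT (EFin \o (fun w => halfline t (Y n w))).
  apply: (@bounded_integrable _ _ _ _ _ 1) => [|w].
    by apply: measurableT_comp => //; case: (bm_halfline t).
  by rewrite /halfline ger0_norm ?lern1 ?leq_b1.
have i1 : P.-integrable setT (EFin \o (fun=> 1 : R)).
  by apply: (@bounded_integrable _ _ _ _ _ 1) => // w; rewrite normr1.
have := Rintegral_lin 1 (- c%:R ^- 2) i1 (iY n 2).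
have := Rintegral_lin 1 (- 1) (ih c%:R) (ih (- c%:R)).
rewrite !mul1r mulN1r Rintegral_cst_probability (Hv n Qn) => <- E.
apply: (@le_trans _ _ (1 - v / c%:R ^+ 2)); first by rewrite lerD2l lerN2.
rewrite (mulrC v) -mulNr -E; apply: le_Rintegral => //.
- by have := integrable_lin 1 (- c%:R ^- 2) i1 (iY n 2); rewrite mul1r.
- exact: integrable_lin.
(* Chebyshev: 1 - y^2 / c^2 is at most the indicator of ]-c, c]. *)
move=> w _; rewrite !mul1r /halfline; move: (Y n w) => y.
have c2 : 0 < c%:R ^+ 2 :> R by rewrite exprn_gt0.
have y2 : 0 <= c%:R ^- 2 * y ^+ 2 by rewrite mulr_ge0 ?sqr_ge0 // invr_ge0 ltW.
case: (leP y c%:R) => yc; case: (leP y (- c%:R)) => cy; rewrite /= ?mulr1 ?mulr0; try lra.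
- have : 1 <= c%:R ^- 2 * y ^+ 2.
    rewrite mulrC ler_pdivlMr // mul1r; nra.
  lra.
- have : 1 <= c%:R ^- 2 * y ^+ 2.
    rewrite mulrC ler_pdivlMr // mul1r; nra.
  lra.
Qed.

End WeakLimits.

(** * The limit process *)

Section LimitTheorems.
Context {R : realType}.
Variable k : nat.
Notation K := k.+1.
Hypotheses (k_odd : odd k) (k5 : (5 <= k)%N).
Local Notation Em := (@Em R k 1).
Local Notation path := (@path R k _).
Implicit Types (F G : (int -> R) -> R) (s : seq int).

Variables (Tset : set nat) (mu : probability R R).
Hypothesis Tinf : infinite_set Tset.
Hypothesis lim_mean : forall c F, supported c F ->
  continuous (fun w => F (fun l => coord l w)) ->
  (exists C, forall w, `|F (fun l => coord l w)| <= C) ->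
  forall e, 0 < e -> exists N, forall j, (N <= j)%N -> Tset j ->
    `|window_mean k j c F - \int[mu]_w F (fun l => coord l w)| < e.

Local Notation "'E F" := (\int[mu]_w F (fun l => coord l w))
  (at level 10, F at level 8).
Local Notation coord := (@coord R).

Lemma cylinder_mean s (B : int -> set R) : uniq s -> (size s < K)%N ->
  'E (cylinder_poly s B) = \prod_(l <- s) law (B l).
Proof.
move=> us sK; apply: (mean_eq Tinf lim_mean (observable_cylinder B (leqnn (radius s)))).
exists (2 * radius s).+1 => j cj; exact: window_mean_indep.
Qed.

Lemma coord_law l (B : set R) : measurable B -> mu (coord l @^-1` B) = (law B)%:E.
Proof.
move=> mB; have := events_prob k_odd Tinf lim_mean [:: l] id (fun _ => mB).
have -> : events [:: l] id (fun _ => B) = coord l @^-1` B.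
  apply/seteqP; split => w /=; first by apply; rewrite /= mem_head.
  by move=> wB i /=; rewrite inE => /eqP ->.
move=> ->; congr EFin; have := @cylinder_mean [:: l] (fun _ => B) isT.
by rewrite big_seq1 => <- //; rewrite ltnS (leq_trans _ k5).
Qed.

Lemma limit_indep s : uniq s -> (size s < K)%N -> indep_family mu coord s.
Proof.
move=> us sK B mB; rewrite (eq_bigr (fun l => (law (B l))%:E)); last first.
  by move=> l _; rewrite coord_law.
rewrite prodEFin -cylinder_mean //.
exact: (events_prob k_odd Tinf lim_mean s id mB).
Qed.

Lemma measurable_norm_preimage (B : set R) : measurable B ->
  measurable ((fun x : R => `|x|) @^-1` B).
Proof. by move=> mB; rewrite -[X in measurable X]setTI; exact: normr_measurable. Qed.

Lemma limit_abs_indep s : uniq s -> indep_family mu (fun l w => `|coord l w|) s.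
Proof.
move=> us B mB; pose B' l := (fun x : R => `|x|) @^-1` B l.
have mB' l : measurable (B' l) by exact: measurable_norm_preimage.
rewrite (eq_bigr (fun l => (law (B' l))%:E)); last first.
  by move=> l _; rewrite -(coord_law l) //.
rewrite prodEFin; have := events_prob k_odd Tinf lim_mean s id mB'.
rewrite -[events _ _ _]/(\bigcap_(l in [set` s]) ((fun w => `|coord l w|) @^-1` B l)) => ->.
congr EFin.
apply: (mean_eq Tinf lim_mean (observable_cylinder B' (leqnn (radius s)))).
exists 0%N => j _; exact: window_mean_abs.
Qed.

Lemma limit_abs_law l (B : set R) : measurable B ->
  mu ((fun w => `|coord l w|) @^-1` B) = mu ((fun w => `|coord 0 w|) @^-1` B).
Proof.
move=> mB; have mB' := measurable_norm_preimage mB.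
by have := coord_law l mB'; rewrite -(coord_law 0 mB').
Qed.

Lemma trace_events n s (B : int -> set R) :
  trace coord n (cylinder s B) = events s (fun l => l + n) B.
Proof. by []. Qed.

Lemma mean_shift F c n : observable c F ->
  observable (c + absz n)%N (fun x => F (fun l => x (l + n))) ->
  'E (fun x => F (fun l => x (l + n))) = 'E F.
Proof.
move=> oF oFn; have oF' : observable (c + absz n)%N F.
  case: oF => sF cF bF; split => // x x' xx'; apply: sF => l lc; apply: xx'; lia.
(* The two window means agree for each large j but may vary with j; [mean_eq] is therefore applied
   to the difference, whose window mean is 0. *)
pose H x := F (fun l => x (l + n)) + (- 1) * F x.
have oH : observable (c + absz n)%N H.
  by apply: observableD => //; apply: observableM => //; exact: observable_cst.
have : 'E H = 0.
  apply: (mean_eq Tinf lim_mean oH); exists (2 * (c + absz n)).+1 => j cj.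
  rewrite /window_mean EmD EmZ -/(window_mean k j _ (fun x => F (fun l => x (l + n)))).
  rewrite -/(window_mean k j _ F) (@window_mean_shift R k k_odd k5 F c) //; last by case: oF.
  have := @window_mean_shift R k k_odd k5 F c (c + absz n)%N 0 j.
  rewrite (_ : (fun x => F (fun l => x (l + 0))) = F); last first.
    by apply/funext => x; congr F; apply/funext => l; rewrite addr0.
  move=> -> //; last 2 first.
  - by case: oF.
  - by rewrite absz0 addn0 leq_addr.
  by rewrite mulN1r subrr.
rewrite /H; under eq_Rintegral do rewrite mulN1r.
rewrite RintegralB //; last 2 first.
- exact: observable_integrable oFn.
- exact: observable_integrable oF.
by move=> /eqP; rewrite subr_eq0 => /eqP.
Qed.

Lemma limit_stationary : strictly_stationary mu coord.
Proof.
apply: stationary_of_cylinders => [l|n s B mB]; first exact: measurable_coord.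
rewrite !trace_events (events_prob k_odd Tinf lim_mean s (fun l => l + n) mB).
rewrite (events_prob k_odd Tinf lim_mean s (fun l => l + 0) mB); congr EFin.
have H m : 'E (events_poly s (fun l => l + m) B) = 'E (cylinder_poly s B).
  apply: (@mean_shift (cylinder_poly s B) (radius s) m).
    exact: observable_cylinder.
  apply: (@observable_events R _ _ s (fun l => l + m) B) => l /radiusP ls.
  by move: ls; set r := radius s => ls; lia.
exact: etrans (H n) (esym (H 0)).
Qed.

(** Agrees with [cylinder_poly] on paths but is bounded by 1 at all points, as [window_mean_mixing]
    demands of its observables. *)
Definition indic_prod s (B : int -> set R) (x : int -> R) : R :=
  \prod_(l <- s) \1_(B l) (x l).

Lemma indic_prod_le1 s (B : int -> set R) x : `|indic_prod s B x| <= 1.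
Proof.
rewrite /indic_prod normr_prod; elim: s => [|l s IH]; first by rewrite big_nil.
rewrite big_cons; apply: mulr_ile1 => //; first by rewrite prodr_ge0.
by rewrite indicE; case: (_ \in _); rewrite ?normr1 ?normr0.
Qed.

Lemma supported_indic_prod c s (B : int -> set R) : (radius s <= c)%N ->
  supported c (indic_prod s B).
Proof.
move=> sc x x' xx'; rewrite /indic_prod big_seq [RHS]big_seq.
by apply: eq_bigr => l ls; rewrite xx' // (leq_trans (radiusP ls) sc).
Qed.

Lemma window_mean_indic j c s (B : int -> set R) :
  window_mean k j c (cylinder_poly s B) = window_mean k j c (indic_prod s B).
Proof.
apply: eq_Em_path => v xi y _; apply: eq_bigr => l _.
by rewrite interpE //; exact: path_val.
Qed.

Lemma lim_mean_near c F e : observable c F -> 0 < e ->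
  exists N, forall j, (N <= j)%N -> Tset j -> `|window_mean k j c F - 'E F| < e.
Proof. by case=> sF cF bF; exact: lim_mean. Qed.

Lemma mean_cylinder_le1 s (B : int -> set R) : (forall l, measurable (B l)) ->
  `|'E (cylinder_poly s B)| <= 1.
Proof.
move=> mB; have E := events_prob k_odd Tinf lim_mean s id mB.
have : ((0 : R)%:E <= ('E (cylinder_poly s B))%:E)%E.
  by rewrite -[X in (_ <= X)%E]E.
have : (('E (cylinder_poly s B))%:E <= (1 : R)%:E)%E.
  by rewrite -[X in (X <= _)%E]E probability_le1 //; exact: measurable_events.
by rewrite !lee_fin => h1 h0; rewrite ger0_norm.
Qed.

(** A disjoint union, because l in s and l' + n with l' in s' may be the same coordinate. *)
Definition joint_index s s' : seq (int + int) := [seq inl l | l <- s] ++ [seq inr l | l <- s'].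
Definition joint_pos (n : nat) (i : int + int) : int :=
  match i with inl l => l | inr l => l + n%:Z end.
Definition joint_set (B B' : int -> set R) (i : int + int) : set R :=
  match i with inl l => B l | inr l => B' l end.

Lemma limit_mix_err c s s' (B B' : int -> set R) (J n : nat) :
  (radius s <= c)%N -> (radius s' <= c)%N -> (2 * c < n)%N ->
  (forall l, measurable (B l)) -> (forall l, measurable (B' l)) ->
  `|'E (events_poly (joint_index s s') (joint_pos n) (joint_set B B')) -
    'E (cylinder_poly s B) * 'E (cylinder_poly s' B')| <= mix_err k c J n.
Proof.
move=> sc sc' cn mB mB'.
have oF := observable_cylinder B sc; have oG := observable_cylinder B' sc'.
set H := events_poly _ _ _.
have oH : observable (c + n) H.
  apply: observable_events => i; rewrite mem_cat => /orP[]/mapP[l ls ->] /=.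
    by have := leq_trans (radiusP ls) sc; lia.
  by have := leq_trans (radiusP ls) sc'; lia.
have [N HN] := @window_mean_mixing R k k_odd k5 (indic_prod s B) (indic_prod s' B') c n J
  (supported_indic_prod B sc) (supported_indic_prod B' sc') (indic_prod_le1 s B)
  (indic_prod_le1 s' B') cn.
have EH j : window_mean k j (c + n) H = window_mean k j (c + n)
    (fun x => indic_prod s B x * indic_prod s' B' (fun l => x (l + n%:Z))).
  apply: eq_Em_path => v xi y _; rewrite /H /events_poly big_cat !big_map /=.
  by congr (_ * _); apply: eq_bigr => l _; rewrite interpE //; exact: path_val.
have a1 := mean_cylinder_le1 s mB; have b1 := mean_cylinder_le1 s' mB'.
(* The bound e' <= 1 absorbs the second-order term (a - a') (b - b'); the product then costs 3 e'
   and the joint mean e'. *)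
apply/ler_addgt0Pr => e e0; pose e' := Num.min 1 (e / 5).
have e'0 : 0 < e' by rewrite lt_min ltr01 divr_gt0.
have e'1 : e' <= 1 by rewrite ge_min lexx.
have e'e : e' <= e / 5 by rewrite ge_min lexx orbT.
have [N1 H1] := lim_mean_near oF e'0; have [N2 H2] := lim_mean_near oG e'0.
have [N3 H3] := lim_mean_near oH e'0.
have [j Tj jN] := infinite_nat_pick (maxn (maxn N N1) (maxn N2 N3)) Tinf.
move: jN; rewrite !geq_max => /andP[/andP[j0 j1] /andP[j2 j3]].
have := HN j j0; rewrite -EH -!window_mean_indic.
move: (H1 j j1 Tj) (H2 j j2 Tj) (H3 j j3 Tj) a1 b1.
set a := window_mean _ _ _ _; set a' := Rintegral _ _ _.
set b := window_mean _ _ _ _; set b' := Rintegral _ _ _.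
set h := window_mean _ _ _ _; set h' := Rintegral _ _ _.
move=> ha hb hh a1 b1 hm.
have ab : `|a * b - a' * b'| <= 3 * e'.
  have -> : a * b - a' * b' = (a - a') * (b - b') + ((a - a') * b' + a' * (b - b')) by ring.
  have n1 : `|(a - a') * (b - b')| <= e'.
    rewrite normrM -[e']mulr1; apply: ler_pM => //; first exact: ltW.
    exact: le_trans (ltW hb) e'1.
  have n2 : `|(a - a') * b'| <= e'.
    by rewrite normrM -[e']mulr1; apply: ler_pM => //; exact: ltW.
  have n3 : `|a' * (b - b')| <= e'.
    by rewrite normrM -[e']mul1r; apply: ler_pM => //; exact: ltW.
  have := ler_normD ((a - a') * (b - b')) ((a - a') * b' + a' * (b - b')).
  have := ler_normD ((a - a') * b') (a' * (b - b')); lra.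
have := ler_distD h h' (a' * b'); have := ler_distD (a * b) h (a' * b').
rewrite (distrC h' h); lra.
Qed.

Lemma geometric_small (C q e : R) : 0 <= q < 1 -> 0 < e ->
  exists N, forall n, (N <= n)%N -> C * q ^+ n < e.
Proof.
move=> /andP[q0 q1] e0; have C0 : 0 < `|C| + 1 by rewrite ltr_wpDl.
have qn : `|q| < 1 by rewrite ger0_norm.
have /cvgrPdist_lt /(_ (e / (`|C| + 1))) := cvg_expr qn.
case=> [|N _ HN]; first by rewrite divr_gt0.
exists N => n nN; have := HN n nN; rewrite /= sub0r normrN ger0_norm ?exprn_ge0 //.
rewrite ltr_pdivlMr // mulrC; apply: le_lt_trans.
by rewrite ler_wpM2r ?exprn_ge0 // (le_trans (ler_norm _)) // lerDl.
Qed.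

(** J is chosen first, for the term without n; with K^J fixed, the other two terms tend to 0 in
    n. *)
Lemma mix_err_cvg0 c (e : R) : 0 < e ->
  exists J N, forall n, (N <= n)%N -> mix_err k c J n < e.
Proof.
move=> e0; have e3 : 0 < e / 3 by rewrite divr_gt0.
pose a : R := 4 * ((2 * c).+1 + (2 * c).+1)%:R.
pose J := Num.truncn (a / (e / 3)); pose L := (K ^ J)%N.
have Lgt0 : 0 < L%:R :> R by rewrite ltr0n expn_gt0.
have term1 : 4 * (((2 * c).+1 + (2 * c).+1)%:R / L%:R) < e / 3.
  rewrite mulrA ltr_pdivrMr // (mulrC (e / 3)) -ltr_pdivrMr // -/a.
  have lt := truncnS_gt (a / (e / 3)).

  apply: (lt_le_trans lt); rewrite ler_nat -/J /L.
  by rewrite ltn_expl // ltnS (leq_trans _ k5).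
have [N2 H2] : exists N, forall n, (N <= n)%N -> 2 * 2 ^+ L * (3 / 4) ^+ n < e / 3.
  by apply: geometric_small => //; lra.
have [N3 H3] : exists N, forall n, (N <= n)%N -> 2 * (1 - 2^-1 ^+ L) ^+ n < e / 3.
  apply: geometric_small => //; have : (0 : R) < 2^-1 ^+ L by rewrite exprn_gt0 ?invr_gt0.
  have : (2^-1 : R) ^+ L <= 1 by rewrite exprn_ile1 // ?invr_ge0 // invf_le1 // ler1n.
  by move=> h1 h2; lra.
exists J, (N2 + (N3 * L + (2 * c).+1))%N => n nN.
have nN2 : (N2 <= n)%N by lia.
have nN3 : (N3 <= (n - (2 * c).+1) %/ L)%N.
  by rewrite leq_divRL ?expn_gt0 //; lia.
have := H2 n nN2; have := H3 _ nN3; rewrite /mix_err -/L.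
move: term1; rewrite -!mulrA.
set t1 := 4 * _; set t2 := 2 * (2 ^+ L * _); set t3 := 2 * (_ ^+ (_ %/ _)).
move=> h1 h2 h3; lra.
Qed.

Lemma limit_mixing : mixing mu coord.
Proof.
apply: mixing_of_cylinders limit_stationary _ => [l|s B s' B' mB mB'].
  exact: measurable_coord.
have prv A v : mu A = v%:E -> pr mu A = v by rewrite /pr => ->.
have E1 n : trace coord 0 (cylinder s B) `&` trace coord n%:Z (cylinder s' B') =
    events (joint_index s s') (joint_pos n) (joint_set B B').
  apply/seteqP; split => w /=.
    move=> [w1 w2] i /=; rewrite mem_cat => /orP[]/mapP[l ls ->] /=.
      by have := w1 l ls; rewrite /traj addr0.
    exact: w2.
  move=> h; split => l ls.
    have /= := h (inl l); rewrite mem_cat map_f // /traj addr0; exact.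
  have /= := h (inr l); rewrite mem_cat map_f ?orbT //; exact.
have mj i : measurable (joint_set B B' i) by case: i.
have E2 s0 B0 : (forall l, measurable (B0 l)) ->
    pr mu (trace coord 0 (cylinder s0 B0)) = 'E (cylinder_poly s0 B0).
  move=> mB0; apply: prv; rewrite -(events_prob k_odd Tinf lim_mean s0 id mB0).
  by congr (mu _); apply/seteqP; split => w /= h l ls; have := h l ls; rewrite /traj addr0.
rewrite !E2 //; apply/cvgrPdist_lt => e e0.
pose c := maxn (radius s) (radius s').
have [J [N HN]] := mix_err_cvg0 c e0.
exists (maxn N (2 * c).+1) => // n /=; rewrite geq_max => /andP[nN nc].
rewrite E1 (prv _ _ (events_prob k_odd Tinf lim_mean _ _ mj)) distrC.
apply: le_lt_trans (HN n nN).
by apply: limit_mix_err => //; rewrite ?leq_maxl ?leq_maxr.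
Qed.

Lemma limit_psumZ_eq n l v :
  (forall j, (n <= K ^ j)%N -> Em j n (fun x => xsum n x ^+ l) = v) ->
  'E (fun x => psumZ n x ^+ l) = v.
Proof.
move=> H; apply: (mean_eq Tinf lim_mean (observableX l (observable_psumZ (leqnSn n)))).
exists (2 * n.+1).+1 => j nj; rewrite -(H j); last by apply: (expK_gt k5); lia.
by apply: (@window_mean_sum R k k_odd k5 j n l n.+1); lia.
Qed.

Lemma limit_psumZ_le n l v N :
  (forall j, (n <= K ^ j)%N -> (N <= j)%N -> Em j n (fun x => xsum n x ^+ l) <= v) ->
  'E (fun x => psumZ n x ^+ l) <= v.
Proof.
move=> H; apply: (mean_le Tinf lim_mean (observableX l (observable_psumZ (leqnSn n)))).
exists (N + (2 * n.+1).+1)%N => j nj; apply: le_trans (H j _ _); last by lia.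
  by rewrite [leLHS](@window_mean_sum R k k_odd k5 j n l n.+1) //; lia.
by apply: (expK_gt k5); lia.
Qed.

Lemma limit_psumZ_mean n : 'E (psumZ n) = 0.
Proof.
have <- := @limit_psumZ_eq n 1 0; first by congr Rintegral; apply/funext => w; rewrite expr1.
move=> j nj; rewrite -[RHS](Em_xsum_mean R k_odd k5 nj).
by apply: eq_Em => x; rewrite expr1.
Qed.

Lemma limit_psumZ_sqr n : 'E (fun x => psumZ n x ^+ 2) = n%:R / 2.
Proof. by apply: limit_psumZ_eq => j nj; exact: Em_xsum_sqr. Qed.

Lemma limit_psumZ_moment n l : (l < K)%N -> 'E (fun x => psumZ n x ^+ l) <= gmom l (n%:R / 2).
Proof.
move=> lK; apply: (@limit_psumZ_le n l _ 0) => j nj _.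
by apply: (Em_moment k_odd k5 (L := K)); rewrite // orbC leqnn.
Qed.

(** If K^(l+1) <= n/4 < K^(l+2), then K^l / 3 is at least n / (3 K^2 4); this turns the gap of
    [Em_moment_gap] at level l into a multiple of n^(K/2). *)
Definition gap : R := 2^-1 * (3 * K%:R ^+ 2 * 4)^-1 ^+ K./2.

Lemma gap_gt0 : 0 < gap.
Proof. by rewrite mulr_gt0 ?invr_gt0 // exprn_gt0 // invr_gt0 !mulr_gt0 ?exprn_gt0 ?ltr0n. Qed.

Lemma limit_psumZ_gap n : (4 * K <= n)%N ->
  'E (fun x => psumZ n x ^+ K) <= gmom K (n%:R / 2) - gap * n%:R ^+ K./2.
Proof.
move=> Kn; have K1 : (1 < K)%N by rewrite ltnS (leq_trans _ k5).
pose p := (n %/ 4)%N; have pK : (K <= p)%N by rewrite leq_divRL // mulnC.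
have p0 : (0 < p)%N by apply: leq_trans pK.
have /andP[] := trunc_log_bounds K1 p0.
have : (0 < trunc_log K p)%N by rewrite trunc_log_gt0; lia.
case: (trunc_log K p) => // l _ lp pl.
have nl : (n < 4 * K ^ l.+2)%N by rewrite mulnC -ltn_divLR.
apply: (@limit_psumZ_le n K _ l.+1) => j nj lj.
have h := @Em_moment_gap R k k_odd k5 (j - l.+1) l n.
rewrite subnK // in h; apply: le_trans (h nj _) _.
  by rewrite mulnC -leq_divRL.
rewrite lerD2l lerN2 /gap -[leLHS]mulrA ler_pM2l ?invr_gt0 // -exprMn.
apply: lerXn2r; rewrite ?nnegrE; first by rewrite mulr_ge0 // invr_ge0 !mulr_ge0.
  by rewrite divr_ge0.
rewrite mulrC ler_pdivrMr ?mulr_gt0 ?exprn_gt0 ?ltr0n //.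
have -> : (K ^ l)%:R / 3 * (3 * K%:R ^+ 2 * 4) = (4 * K ^ l.+2)%:R :> R.
  have e : K%:R ^+ l.+2 = K%:R ^+ l * K%:R ^+ 2 :> R by rewrite -exprD addn2.
  by rewrite natrM !natrX e; field.
by rewrite ler_nat ltnW.
Qed.

Lemma limit_coord_mean : 'E (fun x => x 0) = 0.
Proof.
apply: (@mean_eq R k Tset mu Tinf lim_mean 0 (fun x => x 0)); first exact: observable_coord.
exists 1%N => j j1.
by apply: Em_mean1 => //; apply: (expK_gt k5).
Qed.

Lemma limit_coord_sqr : 'E (fun x => x 0 ^+ 2) = 1 / 2.
Proof.
apply: (@mean_eq R k Tset mu Tinf lim_mean 0 (fun x => x 0 ^+ 2)).
  by apply: observableX; exact: observable_coord.
exists 1%N => j j1.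
rewrite /window_mean; under eq_Em do rewrite expr2.
by rewrite (Em_prod2 R k_odd k5) // ?eqxx //; apply: (expK_gt k5).
Qed.

Let Y (n : nat) (w : R) : R := psumZ n (fun l => coord l w) / Num.sqrt n%:R.

Let observableY n l : observable n (fun x : int -> R => (psumZ n x / Num.sqrt n%:R) ^+ l).
Proof.
apply: observableX; apply: (@observableM _ n (psumZ n) (fun=> (Num.sqrt n%:R)^-1)); last exact: observable_cst.
exact: observable_psumZ.
Qed.

Let mY n : measurable_fun setT (Y n).
Proof.
have [_ c _] := observableY n 1; apply: continuous_measurable_fun.
suff -> : Y n = fun w => (psumZ n (fun l => coord l w) / Num.sqrt n%:R) ^+ 1 by exact: c.
by apply/funext => w; rewrite expr1.
Qed.

Let iY n l : mu.-integrable setT (EFin \o (fun w => Y n w ^+ l)).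
Proof. exact: observable_integrable (observableY n l). Qed.

Lemma gmom_scale a (c v : R) : gmom a.*2 (c * v) = c ^+ a * gmom a.*2 v.
Proof. by rewrite !gmom_double exprMn; ring. Qed.

Let moment_scale n a : (0 < n)%N ->
  \int[mu]_w Y n w ^+ a.*2 = 'E (fun x => psumZ n x ^+ a.*2) / n%:R ^+ a.
Proof.
move=> n0; rewrite -RintegralZr //; last first.
  apply: (@observable_integrable R mu n (fun x => psumZ n x ^+ a.*2)).
  by apply: observableX; exact: observable_psumZ.
congr Rintegral; apply/funext => w; rewrite /Y exprMn; congr (_ * _).
by rewrite -mul2n exprM exprVn sqr_sqrtr ?ler0n // exprVn.
Qed.

Lemma normalized_sum_limit (Q : set nat) : infinite_set Q ->
  exists (Tset : set nat) (nu : probability R R),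
    Tset `<=` Q /\ infinite_set Tset /\ nondeg_law nu /\ non_normal nu /\
    cvg_dist_along mu Tset (fun n w => Ssum coord n w / Num.sqrt n%:R) nu.
Proof.
(* The moment gap is available from n = 4 K on. *)
move=> Qinf; pose Q' := Q `&` [set n | (4 * K <= n)%N].
have Q'inf : infinite_set Q'.
  have -> : Q' = Q `\` `I_(4 * K).
    apply/seteqP; split => n [Qn /= nK]; split => //=; first by apply/negP; rewrite -leqNgt.
    by rewrite leqNgt; apply/negP.
  by apply: infinite_setD => //; exact: finite_II.
have Qpos n : Q' n -> (0 < n)%N by case=> _ /=; lia.
have nn n : Q' n -> n%:R != 0 :> R by move=> /Qpos; rewrite pnatr_eq0 -lt0n.
have M1 n : Q' n -> \int[mu]_w Y n w ^+ 1 = 0.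
  move=> _; have -> : (fun w => Y n w ^+ 1) = (fun w => psumZ n (fun l => coord l w) * (Num.sqrt n%:R)^-1).
    by apply/funext => w; rewrite expr1.
  rewrite RintegralZr //; last first.
    by apply: (@observable_integrable R mu n (psumZ n)); exact: observable_psumZ.
  by rewrite limit_psumZ_mean mul0r.
have M2 n : Q' n -> \int[mu]_w Y n w ^+ 2 = 2^-1.
  move=> Qn; rewrite (@moment_scale n 1 (Qpos n Qn)).
  by rewrite limit_psumZ_sqr expr1 mulrAC divff ?mul1r // nn.
have ub a n B : Q' n -> 'E (fun x => psumZ n x ^+ a.*2) <= n%:R ^+ a * B ->
    \int[mu]_w Y n w ^+ a.*2 <= B.
  move=> Qn h; rewrite (moment_scale a (Qpos n Qn)) ler_pdivrMr 1?mulrC //.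
  by rewrite exprn_gt0 // ltr0n Qpos.
(* Fourth moments make the squares uniformly integrable, so that the variance 1/2 survives in the
   limit. *)
have M4 n : Q' n -> \int[mu]_w Y n w ^+ 2.*2 <= gmom 2.*2 2^-1.
  move=> Qn; apply: ub => //; rewrite -gmom_scale.
  by apply: limit_psumZ_moment; rewrite ltnS (leq_trans _ k5).
have Ke : K = K./2.*2 by rewrite -[LHS]odd_double_half /= k_odd.
have MK n : Q' n -> \int[mu]_w Y n w ^+ K./2.*2 <= gmom K 2^-1 - gap.
  move=> Qn; apply: ub => //; rewrite -Ke.
  apply: le_trans (limit_psumZ_gap _) _; first by case: Qn.
  by rewrite {1}Ke gmom_scale -Ke mulrBr [gap * _]mulrC.
have v0 : 0 <= 2^-1 :> R by rewrite invr_ge0.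
have [T [nu [TQ Tinf' weak]]] := weak_limit_exists mY iY Q'inf v0 M2.
have [iK bK] := weak_fatou mY iY Tinf' weak (fun n Tn => MK n (TQ n Tn)).
have [i4 b4] := weak_fatou mY iY Tinf' weak (fun n Tn => M4 n (TQ n Tn)).
have mean : \int[nu]_x x = 0.
  rewrite -(weak_moment mY iY Tinf' weak (l := 1) (B := 2^-1) (fun n Tn => M1 n (TQ n Tn))).
    by congr Rintegral; apply/funext => x; rewrite expr1.
  by move=> n Tn; rewrite (M2 n (TQ n Tn)).
have var : \int[nu]_x x ^+ 2 = 2^-1.
  exact: (weak_moment mY iY Tinf' weak (fun n Tn => M2 n (TQ n Tn)) (fun n Tn => M4 n (TQ n Tn))).
exists T, nu; split; first by move=> n /TQ [].
split => //; split; last split.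
(* A point mass at c would have c = 0 by the mean, hence second moment 0 instead of 1/2. *)
- move=> c; apply/eqP => nuc.
  have ae : {ae nu, forall x, x = c}.
    exists (~` [set c]); split; [exact: measurableC|by rewrite probability_setC // nuc subee|].
    by [].
  have ae_int (f : R -> R) : continuous f -> \int[nu]_x f x = f c.
    move=> cf; have E : (\int[nu]_x (f x)%:E = \int[nu]_x (f c)%:E)%E.
      apply: ae_eq_integral => //.
        by apply/measurable_EFinP; exact: continuous_measurable_fun.
      by apply: filterS ae => x -> _.
    by rewrite /Rintegral E -/(Rintegral nu setT (fun=> f c)) Rintegral_cst_probability.
  have c0 : c = 0 by rewrite -mean; apply/esym/(ae_int id) => x; exact: cvg_id.
  have : (2^-1 : R) = 0.
    by rewrite -var (ae_int (fun x => x ^+ 2)) ?c0 ?expr0n //; exact: exprn_continuous.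
  by move/eqP; rewrite invr_eq0 pnatr_eq0.
- case=> m [s [s0 nuE]].
  have K2 : (2 <= K)%N by rewrite ltnS (leq_trans _ k5).
  have Ki l : (l <= K)%N -> nu.-integrable setT (fun x : R => (x ^+ l)%:E).
    by move=> lK; apply: even_moment_integrable iK; rewrite -Ke.
  have := normal_moments s0 nuE K2 Ki mean var (leqnn K).
  by move: bK; rewrite -Ke => bK h; move: bK; rewrite h; have := gap_gt0; lra.
- move=> f cf bf eps eps0; have [N HN] := weak f cf bf eps eps0.
  exists N => // n nN Tn; have h := HN n nN Tn.
  have fi : nu.-integrable setT (EFin \o f) by exact: bounded_continuous_integrable.
  have gi : mu.-integrable setT (EFin \o (fun w => f (Y n w))).
    exact: (@bounded_comp_integrable _ _ _ mu Y mY f n cf bf).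
  have E1 : ('E_mu[f \o (fun w => (Ssum coord n w / Num.sqrt n%:R)%R)] = (\int[mu]_w f (Y n w))%:E)%E.
    by rewrite unlock /Rintegral fineK ?(integrable_fin_num _ gi).
  have E2 : (\int[nu]_x (f x)%:E = (\int[nu]_x f x)%:E)%E.
    by rewrite /Rintegral fineK ?(integrable_fin_num _ fi).
  by rewrite E1 E2 -EFinB abse_EFin lte_fin.
Qed.

End LimitTheorems.

Theorem theorem1p1 (R : realType) (M : nat) : (2 <= M)%N ->
  exists (d : measure_display) (T : measurableType d) (P : probability T R)
         (X : int -> T -> R),
    (forall k, measurable_fun setT (X k)) /\
    strictly_stationary P X /\
    ('E_P[X 0%R] = 0)%E /\
    ('E_P[fun w => (X 0 w ^+ 2)%R] = (1 / 2 : R)%:E)%E /\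
    (* (A) *) M_tuplewise_indep P M X /\
    (* (B) *) mixing P X /\
    (* (C) *) ((forall s : seq int, uniq s ->
                  indep_family P (fun k w => `|X k w|) s) /\
               (forall (k : int) (B : set R), measurable B ->
                  P ((fun w => `|X k w|) @^-1` B) =
                  P ((fun w => `|X 0 w|) @^-1` B))) /\
    (* (D) *) (forall Q : set nat, infinite_set Q ->
       exists (Tset : set nat) (mu : probability R R),
         Tset `<=` Q /\ infinite_set Tset /\
         nondeg_law mu /\ non_normal mu /\
         cvg_dist_along P Tset
           (fun n w => Ssum X n w / Num.sqrt (n%:R)) mu).
Proof.
(* This k is odd and at least 5, and K = 2 M + 6 exceeds M, so M-tuples fall under [limit_indep]. *)
move=> M2; pose k := (M.*2 + 5)%N.
have k_odd : odd k by rewrite oddD odd_double.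
have k5 : (5 <= k)%N by rewrite /k leq_addl.
have Mk : (M < k.+1)%N by rewrite /k -addnn; lia.
have [Tset [mu [Tinf lim_mean]]] := @limit_process R k k_odd k5.
have expE F : observable 0 F ->
    ('E_mu[fun w => F (fun l => coord l w)] = (\int[mu]_w F (fun l => coord l w))%:E)%E.
  move=> oF; have iF := @observable_integrable R mu 0 F oF.
  by rewrite unlock /Rintegral fineK ?(integrable_fin_num _ iF).
exists _, R, mu, (@coord R).
split; first exact: measurable_coord.
split; first apply: (limit_stationary k_odd k5 Tinf lim_mean).
split.
  rewrite (expE (fun x => x 0)); last exact: observable_coord.
  by rewrite (limit_coord_mean k_odd k5 Tinf lim_mean).
split.
  rewrite (expE (fun x => x 0 ^+ 2)); last by apply: observableX; exact: observable_coord.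
  by rewrite (limit_coord_sqr k_odd k5 Tinf lim_mean).
split; first by move=> s us sM; apply: (limit_indep k_odd k5 Tinf lim_mean us); rewrite sM.
split; first exact: (limit_mixing k_odd k5 Tinf lim_mean).
split; last by move=> Q; exact: (normalized_sum_limit k_odd k5 Tinf lim_mean).
split; first exact: (limit_abs_indep k_odd k5 Tinf lim_mean).
exact: (limit_abs_law k_odd k5 Tinf lim_mean).
Qed.
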